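(* Let $G=\{g_\eta \mid \eta\in(-\eta_0,\eta_0)\}$, $g_\eta\cdot(x,u)=(\Xi_\eta(x),\Phi_\eta(x,u))$, be a slowly increasing (in particular projectable) one-parameter symmetry group of the system $\Delta_i(x,u^{(n)})=0$, $i=1,\dots,s$. Suppose that there exist $p<k_1<\dots<k_s\le N$ such that, setting $J_{k_1,\dots,k_s}(\Delta):=\left(\frac{\partial\Delta_i}{\partial z_{k_j}}\right)_{i,j=1,\dots,s}$, the following conditions are satisfied: (i) the map $z\mapsto(z',\Delta(z))$ is injective, where $z'=(z_1,\dots,\widehat{z_{k_1}},\dots,\widehat{z_{k_s}},\dots,z_N)$ (hats denote omitted entries); (ii) the function $z\mapsto(\det J_{k_1,\dots,k_s}(\Delta))^{-1}(z)$ is defined globally and is slowly increasing, uniformly for $(z_1,\dots,z_p)$ varying in compact sets. Then there exists a smooth mapping $Q:\mathcal W\to\mathbb R^{s^2}$ (with values viewed as $s\times s$ matrices), which is slowly increasing in $z\in\mathcal M^{(n)}$, uniformly for $(z_1,\dots,z_p)$ varying in compact sets, such that $$\Delta(\mathrm{pr}^{(n)}g_\eta(z))=Q(\eta,z)\,\Delta(z)\qquad((\eta,z)\in\mathcal W).$$ In particular, for any smooth $u:\Omega\subseteq\mathbb R^p\to\mathbb R^q$ such that $g_\eta u$ exists, $$\Delta\big(\Xi_\eta(x),\mathrm{pr}^{(n)}(g_\eta u)(\Xi_\eta(x))\big)=Q(\eta,x,\mathrm{pr}^{(n)}u(x))\,\Delta(x,\mathrm{pr}^{(n)}u(x)).$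$
   Context: $\mathcal M\subseteq\mathbb R^p\times\mathbb R^q$ is open, with points $(x,u)$ ($x$ independent, $u$ dependent variables). $\mathcal M^{(n)}=\mathcal M\times\mathcal U_1\times\dots\times\mathcal U_n$ is the $n$-jet space, where $\mathcal U_k$ is the Euclidean space with coordinates $u^\alpha_J$ ($1\le\alpha\le q$, $J$ running over the derivative multi-indices of order $k$ in $p$ variables). $N=\dim\mathcal M^{(n)}$, and points are written $z=(z_1,\dots,z_N)=(x,u^{(n)})$ with $(z_1,\dots,z_p)=x$. $\mathrm{pr}^{(n)}u$ denotes the function consisting of $u$ and all its partial derivatives up to order $n$; $\mathrm{pr}^{(n)}g_\eta$ is the $n$-th prolongation of the group action to $\mathcal M^{(n)}$. The system is given by a smooth $\Delta=(\Delta_1,\dots,\Delta_s):\mathcal M^{(n)}\to\mathbb R^s$. Standing assumptions: the system is nondegenerate (locally solvable and of maximal rank, i.e. the Jacobian of $\Delta$ has rank $s$ on the zero set of $\Delta$), and $u^{(n)}\mapsto\Delta(x,u^{(n)})$ is slowly increasing, uniformly for $x$ in compact sets. A symmetry group is a local transformation group $G$ on $\mathcal M$ such that $g\cdot u$ is a solution whenever $u$ is a smooth solution, $g\in G$ and $g\cdot u$ is defined; here $g_\eta u=\Phi_\eta\circ(\mathrm{id}\times u)\circ\Xi_\eta^{-1}$. $G$ is projectable if $\Xi_\eta$ depends only on $x$. A smooth function $f(x,v)$ is slowly increasing in $v$, uniformly for $x$ in compact sets, if for every compact $K$ and every multi-index $\alpha$ there is $r>0$ with $\sup_{x\in K,\,v}(1+|v|)^{-r}|\partial^\alpha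 f(x,v)|<\infty$. A projectable $g$ is slowly increasing if $u\mapsto\Phi_g(x,u)$ is slowly increasing, uniformly for $x$ in compact sets. $\mathcal W$ is the open subset of $\mathbb R\times\mathcal M^{(n)}$, containing $\{0\}\times\mathcal M^{(n)}$, of those $(\eta,z)$ for which $\mathrm{pr}^{(n)}g_\eta(z)$ is defined. *)

(* Defs.v *)
From HB Require Import structures.
From mathcomp Require Import all_boot all_order all_algebra.
From mathcomp Require Import all_classical all_reals all_analysis.

Set Implicit Arguments.
Unset Strict Implicit.
Unset Printing Implicit Defensive.

Import Order.TTheory GRing.Theory Num.Theory.
Import numFieldNormedType.Exports.

Local Open Scope classical_set_scope.
Local Open Scope ring_scope.

Section Calculus.
Variable R : realType.

Definition iterated_derive (V W : normedModType R) (l : seq V) (f : V -> W) :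
  V -> W := foldr (fun v g x => 'D_v g x) f l.

(* Only used with D open. *)
Definition smooth_on (V W : normedModType R) (D : set V) (f : V -> W) :=
  forall (l : seq V) (x : V), D x ->
    {for x, continuous (iterated_derive l f)} /\
    (forall v, derivable (iterated_derive l f) x v).

Definition coord_vec m (i : 'I_m) : 'rV[R]_m := delta_mx 0 i.

Definition multi_derive (W : normedModType R) m (J : 'I_m -> nat)
    (f : 'rV[R]_m -> W) : 'rV[R]_m -> W :=
  iterated_derive (flatten [seq nseq (J i) (coord_vec i) | i <- enum 'I_m]) f.

(* A point (x, v) is row_mx x v.  The supremum below runs over *all* v, so f is
   required to be defined on full fibres: D contains {x} x R^m whenever it
   meets it.  K ranges over the compact subsets of the projection of D.  Any
   norm on R^m may be used; `|v| is the sup norm. *)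
Definition slowly_increasing (W : normedModType R) p m
    (D : set 'rV[R]_(p + m)) (f : 'rV[R]_(p + m) -> W) :=
  [/\ forall x v w, D (row_mx x v) -> D (row_mx x w),
      smooth_on D f
    & forall (K : set 'rV[R]_p) (J : 'I_(p + m) -> nat),
        compact K -> K `<=` lsubmx @` D ->
        exists2 r : R, 0 < r &
          has_ubound [set (1 + `|v|) `^ (- r) * `|multi_derive J f (row_mx x v)|
                     | x in K & v in [set: 'rV[R]_m]]].

Definition Jacobian_mx m s (F : 'rV[R]_m -> 'cV[R]_s) (z : 'rV[R]_m) :
  'M[R]_(s, m) := \matrix_(i, j) 'D_(coord_vec j) (fun y => F y i 0) z.

End Calculus.

Section JetCoordinates.
Variables p q : nat.

Definition multi_index (k : nat) : finType :=
  {J : {ffun 'I_p -> 'I_k.+1} | (\sum_i J i == k)%N}.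

Fact multi_index0_subproof : (\sum_i [ffun=> ord0 : 'I_1] (i : 'I_p) == 0)%N.
Proof. by rewrite big1 // => i _; rewrite ffunE. Qed.

Definition multi_index0 : multi_index 0 :=
  exist _ [ffun=> ord0] multi_index0_subproof.

(* The coordinates u^alpha_J with |J| <= n, sorted by |J|: the enumeration of a
   sigma type is lexicographic. *)
Definition jet_var (n : nat) : finType :=
  {k : 'I_n.+1 & ('I_q * multi_index k)%type}.

Definition undiff_var n (a : 'I_q) : jet_var n :=
  Tagged (fun k : 'I_n.+1 => ('I_q * multi_index k)%type)
    ((a, multi_index0) : 'I_q * multi_index (ord0 : 'I_n.+1)).

Definition var_dep n (c : jet_var n) : 'I_q := (tagged c).1.
Definition var_order n (c : jet_var n) : 'I_p -> nat :=
  fun i => val (tagged c).2 i.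

End JetCoordinates.

Notation jet_dim p q n := (p + #|jet_var p q n|)%N.

Section Jets.
Variables (R : realType) (p q n : nat).

Definition pr (u : 'rV[R]_p -> 'rV[R]_q) (x : 'rV[R]_p) :
    'rV[R]_#|jet_var p q n| :=
  \row_c multi_derive (var_order (enum_val c))
           (fun y => u y 0 (var_dep (enum_val c))) x.

Definition base_point (z : 'rV[R]_(jet_dim p q n)) : 'rV[R]_(p + q) :=
  row_mx (lsubmx z) (\row_a rsubmx z 0 (enum_rank (undiff_var p n a))).

Definition jet_space (M : set 'rV[R]_(p + q)) : set 'rV[R]_(jet_dim p q n) :=
  [set z | M (base_point z)].

Definition graph_in (D : set 'rV[R]_(p + q)) (Omega : set 'rV[R]_p)
    (u : 'rV[R]_p -> 'rV[R]_q) :=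
  forall x, Omega x -> D (row_mx x (u x)).

Definition is_solution s (M : set 'rV[R]_(p + q))
    (Delta : 'rV[R]_(jet_dim p q n) -> 'cV[R]_s)
    (Omega : set 'rV[R]_p) (u : 'rV[R]_p -> 'rV[R]_q) :=
  [/\ open Omega, smooth_on Omega u, graph_in M Omega u
    & forall x, Omega x -> Delta (row_mx x (pr u x)) = 0].

Definition locally_solvable s (M : set 'rV[R]_(p + q))
    (Delta : 'rV[R]_(jet_dim p q n) -> 'cV[R]_s) :=
  forall z, jet_space M z -> Delta z = 0 ->
    exists Omega u, [/\ is_solution M Delta Omega u, Omega (lsubmx z)
                      & pr u (lsubmx z) = rsubmx z].

Definition maximal_rank s (M : set 'rV[R]_(p + q))
    (Delta : 'rV[R]_(jet_dim p q n) -> 'cV[R]_s) :=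
  forall z, jet_space M z -> Delta z = 0 -> \rank (Jacobian_mx Delta z) = s.

Definition nondegenerate_system s (M : set 'rV[R]_(p + q))
    (Delta : 'rV[R]_(jet_dim p q n) -> 'cV[R]_s) :=
  locally_solvable M Delta /\ maximal_rank M Delta.

End Jets.

Section Groups.
Variable R : realType.

(* A local one-parameter transformation group on M: g eta z is meaningful for
   (eta, z) in dom. *)
Record local_transformation_group m (M : set 'rV[R]_m) (eta0 : R)
    (dom : set (R * 'rV[R]_m)) (g : R -> 'rV[R]_m -> 'rV[R]_m) : Prop := {
  ltg_param : 0 < eta0;
  ltg_open : open dom;
  ltg_dom : forall eta z, dom (eta, z) -> `|eta| < eta0 /\ M z;
  ltg_dom0 : forall z, M z -> dom (0, z);
  ltg_smooth : smooth_on dom (fun t : R * 'rV[R]_m => g t.1 t.2);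
  ltg_codom : forall eta z, dom (eta, z) -> M (g eta z);
  ltg_id : forall z, M z -> g 0 z = z;
  ltg_comp : forall eta eps z, dom (eps, z) -> dom (eta, g eps z) ->
    dom (eta + eps, z) -> g eta (g eps z) = g (eta + eps) z;
  ltg_inv : forall eta z, dom (eta, z) ->
    dom (- eta, g eta z) /\ g (- eta) (g eta z) = z }.

Variables p q : nat.
Implicit Types (dom : set (R * 'rV[R]_(p + q))) (eta : R).
Implicit Types (Xi : R -> 'rV[R]_p -> 'rV[R]_p).
Implicit Types (Phi : R -> 'rV[R]_(p + q) -> 'rV[R]_q).

Definition projectable_action Xi Phi eta (z : 'rV[R]_(p + q)) :
  'rV[R]_(p + q) := row_mx (Xi eta (lsubmx z)) (Phi eta z).

Definition dom_at dom eta : set 'rV[R]_(p + q) := [set z | dom (eta, z)].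

(* g_eta u = Phi_eta o (id x u) o Xi_eta^-1, where u has domain Omega; it has
   domain Xi_eta(Omega), and exists when graph_in (dom_at dom eta) Omega u. *)
Definition act_fun Xi Phi eta (Omega : set 'rV[R]_p)
    (u : 'rV[R]_p -> 'rV[R]_q) : 'rV[R]_p -> 'rV[R]_q :=
  Phi eta \o (fun x => row_mx x (u x)) \o pinv Omega (Xi eta).

Definition symmetry_group n s (M : set 'rV[R]_(p + q))
    (Delta : 'rV[R]_(jet_dim p q n) -> 'cV[R]_s) eta0 dom Xi Phi :=
  local_transformation_group M eta0 dom (projectable_action Xi Phi) /\
  forall eta Omega u, `|eta| < eta0 -> is_solution M Delta Omega u ->
    graph_in (dom_at dom eta) Omega u ->
    is_solution M Delta (Xi eta @` Omega) (act_fun Xi Phi eta Omega u).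

Definition slowly_increasing_group eta0 dom Xi Phi :=
  (forall eta, `|eta| < eta0 -> slowly_increasing (dom_at dom eta) (Phi eta)).

(* w = pr^(n) g_eta (z), computed with a local representative u of the jet z. *)
Definition prolongs n dom Xi Phi eta (z w : 'rV[R]_(jet_dim p q n)) :=
  exists Omega u,
    [/\ open Omega /\ Omega (lsubmx z), smooth_on Omega u,
        graph_in (dom_at dom eta) Omega u,
        pr n u (lsubmx z) = rsubmx z
      & w = row_mx (Xi eta (lsubmx z))
              (pr n (act_fun Xi Phi eta Omega u) (Xi eta (lsubmx z)))].

Definition pr_action n dom Xi Phi eta (z : 'rV[R]_(jet_dim p q n)) :
  'rV[R]_(jet_dim p q n) := xget z [set w | prolongs dom Xi Phi eta z w].

Definition pr_dom n dom Xi Phi : set (R * 'rV[R]_(jet_dim p q n)) :=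
  [set t | exists w, prolongs dom Xi Phi t.1 t.2 w].

End Groups.

Section Minors.
Variables (R : realType) (N s : nat).

Definition omit_coords (k : 'I_s -> 'I_N) (z : 'rV[R]_N) :
    'rV[R]_#|[predC codom k]| :=
  colsub (fun j : 'I_#|[predC codom k]| => enum_val j) z.

Definition Jacobian_minor (k : 'I_s -> 'I_N) (F : 'rV[R]_N -> 'cV[R]_s)
  (z : 'rV[R]_N) : 'M[R]_s := colsub k (Jacobian_mx F z).

End Minors.

(* Main.v *)
Require Import Defs.
From HB Require Import structures.
From mathcomp Require Import all_boot all_order all_algebra.
From mathcomp Require Import all_classical all_reals all_analysis.
From mathcomp Require Import ring lra.

Set Implicit Arguments.
Unset Strict Implicit.
Unset Printing Implicit Defensive.

Import Order.TTheory GRing.Theory Num.Theory.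
Import numFieldNormedType.Exports.

Local Open Scope classical_set_scope.
Local Open Scope ring_scope.

(** Put F(eta, z) = Delta(pr g_eta z).  Local solvability and the fact that G
    maps solutions to solutions make F(eta, z) vanish whenever Delta(z) = 0
    ([prolongation_zero]).  The factor Q is a quotient of F by Delta; what has
    to be achieved is that the quotient is smooth and that all its
    z-derivatives grow polynomially.

    Close to the zero set, the quotient is an integral.  Keep all coordinates
    except z_{k_1}, ..., z_{k_s} fixed.  On the fibre obtained in this way Delta
    is injective and its Jacobian J is invertible, with an inverse that grows
    polynomially.  If Delta(z) is small compared with the inverse of |J^-1| on
    the unit ball around z in its fibre, then every value t Delta(z),
    -1 < t < 2, is taken at a unique point lambda(t, z) of the fibre, at
    distance at most 1 from z ([fibre_path_exists]); it minimizes a penalized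
    residual ([solution_by_descent]).  The path lambda goes from the zero set at t = 0 to
    z at t = 1 with velocity J(lambda)^-1 Delta(z), so that the fundamental
    theorem of calculus gives
      F(eta, z) = (\int_0^1 d_k F(eta, lambda(t, z)) J(lambda(t, z))^-1 dt) Delta(z),
    where d_k F collects the derivatives along the fibre.
    Away from the zero set one divides by |Delta|^2 and takes
    F Delta^T / |Delta|^2.  The two expressions are glued by a cutoff function
    of |Delta|^2 H, where H is a smooth function of polynomial growth that
    dominates |J^-1|^2 near each point ([smooth_majorant], [quotient_eq]).

    Growth is tracked by the class [tempered]: differentiability up to a given
    order, with polynomial bounds on a prescribed set for the derivatives along
    prescribed directions.  The bounds that are available, and wanted, hold for
    a fixed group parameter and for independent variables in a compact set; only
    the derivatives along z are bounded, and the group parameter is a direction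
    without bounds.  The class is stable under products, inverses, composition,
    solution of implicit equations and integration over a parameter
    ([tempered_comp], [tempered_solution], [tempered_unit_integral]), hence the
    quotient is tempered as soon as F is ([tempered_quotient]).

    It remains to see that F is tempered.  The prolonged action can be computed
    from any function with the given jet, because the jet of a composite depends
    only on the jets of its factors ([same_jet_comp]); the Taylor polynomial of
    the jet is such a function, and it turns pr g_eta z into an explicit
    expression in Xi, Phi and z ([pr_act_fun]).  As Xi does not involve the
    dependent variables, it enters only through its values over compact sets,
    while Phi is slowly increasing ([tempered_prolongation]). *)

(** * Partial derivatives and the chain rule *)

Section PartialDerivatives.
Variable R : realType.
Local Notation e_ i := (coord_vec R i).

Lemma derive_comp_affine (U V W : normedModType R) (h L : U -> V)
    (f : V -> W) x v :
  (forall t u w, h (t *: u + w) = t *: L u + h w) ->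
  'D_v (f \o h) x = 'D_(L v) f (h x).
Proof. by move=> hL; rewrite /derive/=; under [X in lim (X @ _)]eq_fun do rewrite hL. Qed.

Lemma derivable_comp_affine (U V W : normedModType R) (h L : U -> V)
    (f : V -> W) x v :
  (forall t u w, h (t *: u + w) = t *: L u + h w) ->
  derivable (f \o h) x v <-> derivable f (h x) (L v).
Proof. by move=> hL; rewrite /derivable/=; under [X in cvg (X @ _)]eq_fun do rewrite hL. Qed.

Lemma is_derive_line (V W : normedModType R) (f : V -> W) x v t df :
  is_derive (t *: v + x) v f df -> is_derive t 1 (fun s => f (s *: v + x)) df.
Proof.
have hL (s u w : R) : (s *: u + w) *: v + x = s *: (u *: v) + (w *: v + x).
  by rewrite scalerDl scalerA addrA.
case=> dfx <-; split.
  by apply/(@derivable_comp_affine R^o V W _ ( *:%R^~ v) f t 1 hL); rewrite scale1r.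
by rewrite (@derive_comp_affine R^o V W _ ( *:%R^~ v) f t 1 hL) scale1r.
Qed.

(** The increment c of a coordinate may have either sign, whence the absolute
    values in the range of t. *)
Lemma segment_MVT (V : normedModType R) (f df : V -> R) (x v : V) (c : R) :
  (forall t : R, `|t| <= `|c| -> is_derive (t *: v + x) v f (df (t *: v + x))) ->
  exists2 t : R, `|t| <= `|c| & f (c *: v + x) - f x = c * df (t *: v + x).
Proof.
move=> dfx.
have dg (t : R) : `|t| <= `|c| ->
    is_derive t (1 : R) (fun s => f (s *: v + x)) (df (t *: v + x)).
  by move=> /dfx /is_derive_line.
have cont (a b : R) : (forall t : R, t \in `[a, b] -> `|t| <= `|c|) ->
    {within `[a, b], continuous (fun s => f (s *: v + x))}.
  move=> ab; apply: derivable_within_continuous => t /ab /dg [].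
  by [].
have [c0|c0] := leP 0 c.
- have in0c (t : R) : t \in `[0, c] -> `|t| <= `|c|.
    by rewrite in_itv/= => /andP[t0 tc]; rewrite !ger0_norm.
  have [t tc] := MVT_segment c0 (fun t tc => dg t (in0c t (subset_itv_oo_cc tc)))
    (cont _ _ in0c).
  rewrite subr0 scale0r add0r mulrC => ->.
  by exists t => //; exact: in0c.
- have inc0 (t : R) : t \in `[c, 0] -> `|t| <= `|c|.
    by rewrite in_itv/= => /andP[t0 tc]; rewrite !ler0_norm ?lerN2// ltW.
  have [t tc] := MVT_segment (ltW c0)
    (fun t tc => dg t (inc0 t (subset_itv_oo_cc tc))) (cont _ _ inc0).
  rewrite scale0r add0r sub0r => tE.
  exists t; first exact: inc0.
  by rewrite -[LHS]opprB tE; ring.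
Qed.

Lemma ler_mx_norm m n (M : 'M[R]_(m, n)) i j : `|M i j| <= `|M|.
Proof.
rewrite [leRHS]/Num.Def.normr/= mx_normrE.
exact: (le_bigmax _ (fun ij => `|M ij.1 ij.2|) (i, j)).
Qed.

Lemma mx_norm_le m n (M : 'M[R]_(m, n)) c :
  0 <= c -> (forall i j, `|M i j| <= c) -> `|M| <= c.
Proof.
move=> c0 Mc; rewrite [leLHS]/Num.Def.normr/= mx_normrE.
by apply: bigmax_le => // -[i j] _; exact: Mc.
Qed.

Lemma row_mx0_coord b (i : 'I_b) a : row_mx 0 (e_ i) = e_ (rshift a i).
Proof.
apply/rowP => j; rewrite [LHS]mxE [RHS]mxE.
case: (fintype.splitP j) => l jl; rewrite !mxE eqxx /= -[j == _](inj_eq val_inj) /= jl.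
  by rewrite ltn_eqF// ltn_addr.
by rewrite eqn_add2l.
Qed.

(** Changing the coordinates one at a time, each increment is controlled by the
    mean value theorem; continuity of the partial derivatives replaces their
    values at the intermediate points by those at x. *)
Lemma C1_estimate m (f : 'rV[R]_m -> R) (d : 'I_m -> 'rV[R]_m -> R) x :
  (\forall y \near x, forall i, is_derive y (e_ i) f (d i y)) ->
  (forall i, {for x, continuous (d i)}) ->
  forall e, 0 < e -> \forall h \near (0 : 'rV[R]_m),
    `|f (h + x) - f x - \sum_i h 0 i * d i x| <= e * `|h|.
Proof.
move=> dfx dcont e e0.
have e'0 : 0 < e / m.+1%:R by rewrite divr_gt0.
have : \forall y \near x, (forall i, is_derive y (e_ i) f (d i y)) /\
    forall i, `|d i y - d i x| <= e / m.+1%:R.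
  near=> y; split; first by near: y.
  near: y; apply: filter_forall => i.
  near=> y; rewrite distrC; near: y.
  exact: (cvgrPdist_le _ _).1 (dcont i) _ e'0.
move=> /nbhs_ballP[r /= r0 xr].
apply/nbhs_ballP; exists r => //= h; rewrite -ball_normE/= sub0r normrN => hr.
(* The increment h truncated to its first k coordinates. *)
pose hk k : 'rV[R]_m := \row_j (if (j < k)%N then h 0 j else 0).
have hk0 : hk 0 = 0 by apply/rowP => j; rewrite !mxE.
have hkm : hk m = h by apply/rowP => j; rewrite !mxE ltn_ord.
have hkS (k : 'I_m) : hk k.+1 = h 0 k *: e_ k + hk k.
  apply/rowP => j; rewrite !mxE/= ltnS leq_eqVlt.
  have [->|jk] := eqVneq j k; first by rewrite eqxx ltnn/= mulr1 addr0.
  by rewrite (_ : (j == k :> nat) = false) ?mulr0 ?add0r//; exact/negbTE.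
have step (k : 'I_m) :
    `|f (hk k.+1 + x) - f (hk k + x) - h 0 k * d k x| <= e / m.+1%:R * `|h|.
  have near_x t : `|t| <= `|h 0 k| -> ball x r (t *: e_ k + (hk k + x)).
    move=> tk; rewrite -ball_normE/= addrA opprD addrCA subrr addr0 normrN.
    rewrite (le_lt_trans _ hr)//.
    apply: mx_norm_le => // i j; rewrite !mxE/= ord1 eqxx/=.
    have [->|jk] := eqVneq j k.
      by rewrite ltnn addr0 mulr1 (le_trans tk)// ler_mx_norm.
    by rewrite mulr0 add0r; case: ifP => _; rewrite ?normr0// ler_mx_norm.
  have [t tk ft] := @segment_MVT _ f (d k) (hk k + x) (e_ k) (h 0 k)
    (fun t tk => (xr _ (near_x t tk)).1 k).
  rewrite hkS -[_ + hk k + x]addrA ft -mulrBr normrM mulrC ler_pM//.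
    exact: (xr _ (near_x t tk)).2.
  exact: ler_mx_norm.
have -> : f (h + x) - f x = \sum_(k < m) (f (hk k.+1 + x) - f (hk k + x)).
  rewrite -(big_mkord xpredT (fun k => f (hk k.+1 + x) - f (hk k + x))).
  by rewrite telescope_sumr// hk0 hkm add0r.
rewrite -sumrB (le_trans (ler_norm_sum _ _ _))//.
rewrite (le_trans (ler_sum _ (fun k _ => step k)))//.
rewrite sumr_const card_ord -[leLHS]mulr_natl mulrA ler_wpM2r//.
by rewrite mulrCA ler_piMr ?(ltW e0)// ler_pdivrMr// mul1r ler_nat.
Unshelve. all: by end_near. Qed.

End PartialDerivatives.

Section ChainRule.
Variable R : realType.
Local Notation e_ i := (coord_vec R i).

Lemma C1_differentiable m (f : 'rV[R]_m -> R) (d : 'I_m -> 'rV[R]_m -> R) x :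
  (\forall y \near x, forall i, is_derive y (e_ i) f (d i y)) ->
  (forall i, {for x, continuous (d i)}) ->
  differentiable f x /\ forall v, 'd f x v = \sum_i v 0 i * d i x.
Proof.
move=> dfx dcont.
pose L (h : 'rV[R]_m) : R := \sum_i h 0 i * d i x.
have L_lin : linear L.
  move=> a u v; rewrite /L scaler_sumr -big_split/=; apply: eq_bigr => i _.
  by rewrite !mxE mulrDl -mulrA.
pose Lp := GRing.isLinear.Build _ _ _ _ _ L_lin.
pose LL : {linear 'rV[R]_m -> R} := HB.pack L Lp.
have Lcont : continuous LL.
  have -> : (LL : _ -> _) = \sum_i (fun h : 'rV[R]_m => h 0 i * d i x).
    by apply/funext => h; rewrite fct_sumE.
  elim/big_rec: _ => [|i F _ IH]; first by move=> h; exact: cst_continuous.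
  move=> h; apply: continuousD; last exact: IH.
  by apply: continuousM; [exact: coord_continuous|exact: cst_continuous].
have fo : f \o shift x = cst (f x) + (LL : _ -> _) +o_ (0 : 'rV[R]_m) id.
  apply/eqaddoP => e e0; near=> h.
  rewrite [X in `|X|](_ : _ = f (h + x) - f x - \sum_i h 0 i * d i x).
    by near: h; exact: C1_estimate.
  by rewrite !fctE/= /L opprD addrA.
have dfL := diff_unique Lcont fo.
split; last by move=> v; rewrite dfL.
by apply/diff_locallyP; rewrite dfL.
Unshelve. all: by end_near. Qed.

Lemma is_derive_C1 m (f : 'rV[R]_m -> R) (d : 'I_m -> 'rV[R]_m -> R) x v :
  (\forall y \near x, forall i, is_derive y (e_ i) f (d i y)) ->
  (forall i, {for x, continuous (d i)}) ->
  is_derive x v f (\sum_i v 0 i * d i x).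
Proof.
move=> dfx dcont; have [df dfE] := C1_differentiable dfx dcont.
by apply: DeriveDef; [exact: diff_derivable|rewrite deriveE].
Qed.

(** Only the curve t |-> phi (t v + x) enters, which reduces the claim to the
    composition of f with a differentiable function of one variable. *)
Lemma is_derive_comp_C1 (U : normedModType R) m (f : 'rV[R]_m -> R)
    (d : 'I_m -> 'rV[R]_m -> R) (phi : U -> 'rV[R]_m) (dphi : 'I_m -> R) x v :
  (forall j, is_derive x v (fun y => phi y 0 j) (dphi j)) ->
  (\forall y \near phi x, forall i, is_derive y (e_ i) f (d i y)) ->
  (forall i, {for phi x, continuous (d i)}) ->
  is_derive x v (f \o phi) (\sum_j dphi j * d j (phi x)).
Proof.
move=> dphix dfx dcont; have [df dfE] := C1_differentiable dfx dcont.
have phix : derivable phi x v.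
  by apply/derivable_mxP => i j; rewrite ord1; exact: ex_derive.
pose c (t : R) : 'rV[R]_m := phi (t *: v + x).
have c0 : c 0 = phi x by rewrite /c scale0r add0r.
have dline : derivable c (0 : R) (1 : R) := iffLR (derivable1P phi x v) phix.
have dline' := iffLR (derivable1_diffP _ _) dline.
have dcomp : differentiable (f \o c) (0 : R).
  by apply: differentiable_comp => //=; rewrite c0.
have dcomp' : derivable (f \o c) (0 : R) (1 : R) :=
  iffRL (derivable1_diffP _ _) dcomp.
split; first exact: (iffRL (derivable1P (f \o phi) x v) dcomp').
have -> : 'D_v (f \o phi) x = derive1 (f \o c) 0.
  rewrite derive1E /derive/= /c scale0r add0r.
  by under [X in _ = lim (X @ _)]eq_fun do rewrite addr0 [_%:A]mulr1.
have dfc : differentiable f (c 0) by rewrite c0.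
rewrite (derive1E' dcomp) (diff_comp dline' dfc) [LHS]/= c0 dfE; apply: eq_bigr => j _; congr (_ * _).
have -> : 'd c (0 : R) (1 : R) = 'D_v phi x.
  rewrite -(derive1E' dline') derive1E /derive/= /c scale0r add0r.
  by under [X in lim (X @ _) = _]eq_fun do rewrite addr0 [_%:A]mulr1.
rewrite (derive_mx phix) mxE.
by case: (dphix j).
Qed.

End ChainRule.

(** * Functions of polynomial growth with all their derivatives *)

Section Tempered.
Variable R : realType.
Local Notation e_ i := (coord_vec R i).

(** Bounds are asserted on the part of the domain that lies in K. Keeping D and
    K apart lets a function be smooth on D and be bounded on the thin set K
    only. *)
Definition growth a (D K : set 'rV[R]_a) (f : 'rV[R]_a -> R) :=
  exists (C : R) (n : nat), forall x, D x -> K x -> `|f x| <= C * (1 + `|x|) ^+ n.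

(** Typically K is the set of jets over a compact set of independent variables,
    at a fixed group parameter. Directions outside B, such as that of the group
    parameter, carry no bounds: after a derivative along one of them, K is
    replaced by the empty set. With K empty, this is the class of functions of
    class C^k. *)
Fixpoint tempered k a (D K : set 'rV[R]_a) (B : pred 'I_a)
    (f : 'rV[R]_a -> R) : Prop :=
  [/\ forall x, D x -> {for x, continuous f}, growth D K f
    & if k is k'.+1 then
        forall i, (forall x, D x -> derivable f x (e_ i)) /\
          tempered k' D (if B i then K else set0) B (fun x => 'D_(e_ i) f x)
      else True].

Section Growth.
Variable a : nat.
Implicit Types (D K : set 'rV[R]_a) (f g : 'rV[R]_a -> R).

Lemma growth_ge0 D K f : growth D K f ->
  exists2 C : R, 0 <= C &
    exists n, forall x, D x -> K x -> `|f x| <= C * (1 + `|x|) ^+ n.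
Proof.
move=> [C [n fC]]; exists `|C| => //; exists n => x Dx Kx.
by rewrite (le_trans (fC _ Dx Kx))// ler_wpM2r ?ler_norm.
Qed.

Lemma growth_le D K D' K' f g : (forall x, D' x -> K' x -> D x /\ K x) ->
  (forall x, D' x -> K' x -> `|g x| <= `|f x|) -> growth D K f -> growth D' K' g.
Proof.
move=> sub gf [C [n fC]]; exists C, n => x Dx Kx.
by rewrite (le_trans (gf _ Dx Kx))//; apply: fC; have [] := sub _ Dx Kx.
Qed.

Lemma growth_set0 D f : growth D set0 f.
Proof. by exists 0, 0%N. Qed.

Lemma growth_cst D K c : growth D K (fun=> c).
Proof. by exists `|c|, 0%N => x _ _; rewrite expr0 mulr1. Qed.

Lemma growth_normr D K : growth D K (fun x => `|x|).
Proof. by exists 1, 1%N => x _ _; rewrite expr1 mul1r normr_id lerDr. Qed.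

Lemma growth_coord D K j : growth D K (fun x => x 0 j).
Proof.
apply: growth_le (growth_normr D K) => // x _ _.
by rewrite normr_id ler_mx_norm.
Qed.

Lemma growthD D K f g : growth D K f -> growth D K g ->
  growth D K (fun x => f x + g x).
Proof.
move=> /growth_ge0[C C0 [n fC]] /growth_ge0[C' C'0 [n' gC]].
exists (C + C'), (n + n')%N => x Dx Kx.
rewrite (le_trans (ler_normD _ _))// mulrDl lerD//.
  by rewrite (le_trans (fC _ Dx Kx))// ler_wpM2l// ler_weXn2l ?lerDl ?leq_addr.
by rewrite (le_trans (gC _ Dx Kx))// ler_wpM2l// ler_weXn2l ?lerDl ?leq_addl.
Qed.

Lemma growthM D K f g : growth D K f -> growth D K g ->
  growth D K (fun x => f x * g x).
Proof.
move=> [C [n fC]] [C' [n' gC]].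
exists (C * C'), (n + n')%N => x Dx Kx.
by rewrite normrM exprD mulrACA ler_pM// ?fC ?gC.
Qed.

Lemma growth_sum D K (I : finType) (P : pred I) (F : I -> 'rV[R]_a -> R) :
  (forall i, P i -> growth D K (F i)) -> growth D K (fun x => \sum_(i | P i) F i x).
Proof.
move=> FG.
suff : forall r : seq I, growth D K (fun x => \sum_(i <- r | P i) F i x) by exact.
elim=> [|i r IH].
  by apply: growth_le (growth_cst D K 0) => // x _ _; rewrite big_nil.
have [Pi|nPi] := boolP (P i).
  apply: growth_le (growthD (FG i Pi) IH) => // x _ _.
  by rewrite big_cons Pi.
by apply: growth_le IH => // x _ _; rewrite big_cons (negbTE nPi).
Qed.

Lemma growthX D K f n : growth D K f -> growth D K (fun x => f x ^+ n).
Proof.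
move=> fG; elim: n => [|n IH].
  by apply: growth_le (growth_cst D K 1) => // x _ _; rewrite expr0.
by apply: growth_le (growthM fG IH) => // x _ _; rewrite exprS.
Qed.

Lemma growth_mx_norm D K b (phi : 'rV[R]_a -> 'rV[R]_b) :
  (forall j, growth D K (fun x => phi x 0 j)) -> growth D K (fun x => `|phi x|).
Proof.
move=> phiG.
have absG j : growth D K (fun x => `|phi x 0 j|).
  by apply: growth_le (phiG j) => // x _ _; rewrite normr_id.
have sG := @growth_sum D K _ xpredT _ (fun j _ => absG j).
apply: growth_le sG => // x _ _; rewrite normr_id ger0_norm ?sumr_ge0//.
apply: mx_norm_le; first by rewrite sumr_ge0.
by move=> i j; rewrite ord1 (bigD1 j)//= lerDl sumr_ge0.
Qed.

End Growth.

Lemma growth_comp a b (D1 K1 : set 'rV[R]_a) (D2 K2 : set 'rV[R]_b)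
    (f : 'rV[R]_b -> R) (phi : 'rV[R]_a -> 'rV[R]_b) :
  (forall x, D1 x -> K1 x -> D2 (phi x) /\ K2 (phi x)) ->
  (forall j, growth D1 K1 (fun x => phi x 0 j)) ->
  growth D2 K2 f -> growth D1 K1 (f \o phi).
Proof.
move=> sub phiG /growth_ge0[C C0 [n fC]].
have pG := growthM (growth_cst D1 K1 C)
  (growthX n (growthD (growth_cst D1 K1 1) (growth_mx_norm phiG))).
apply: growth_le pG => // x Dx Kx /=; have [D2x K2x] := sub _ Dx Kx.
rewrite (le_trans (fC _ D2x K2x))// ger0_norm//.
by rewrite mulr_ge0// exprn_ge0// addr_ge0.
Qed.

Lemma near_radius (V : normedModType R) (x : V) (P : V -> Prop) :
  (\forall y \near x, P y) -> exists2 r, 0 < r & forall y, `|y - x| < r -> P y.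
Proof.
move=> /nbhs_ballP[r /= r0 rP]; exists r => // y yx.
by apply: rP; rewrite -ball_normE/= distrC.
Qed.

Lemma continuous_near (T : topologicalType) (W : normedModType R) (f : T -> W) x e :
  {for x, continuous f} -> 0 < e -> \forall y \near x, `|f x - f y| <= e.
Proof. by move=> cf e0; exact: (cvgrPdist_le _ _).1 cf _ e0. Qed.

Lemma near_radius_forall (I : finType) (V : normedModType R) (x : V)
    (P : I -> V -> Prop) :
  (forall i, \forall y \near x, P i y) ->
  exists2 r, 0 < r & forall y, `|y - x| < r -> forall i, P i y.
Proof. by move=> H; apply: near_radius; exact: filter_forall. Qed.

Lemma continuous_radius (V W : normedModType R) (f : V -> W) x :
  (forall e, 0 < e -> exists2 r, 0 < r & forall y, `|y - x| < r -> `|f x - f y| <= e) ->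
  {for x, continuous f}.
Proof.
move=> H; apply/cvgrPdist_le => e /H[r r0 rP]; apply/nbhs_ballP.
by exists r => // y; rewrite -ball_normE/= distrC => /rP.
Qed.

Section Closure.
Variable a : nat.
Implicit Types (D K : set 'rV[R]_a) (B : pred 'I_a) (f g : 'rV[R]_a -> R).

Lemma temperedW k D K B f : tempered k.+1 D K B f -> tempered k D K B f.
Proof.
elim: k K f => [|k IH] K f; first by case=> ? ? _; split.
move=> [cf gf df]; split => // i; have [dif Tf] := df i; split => //.
exact: IH.
Qed.

Lemma tempered_sub k D K D' K' B f : (forall x, D' x -> D x) ->
  (forall x, D' x -> K' x -> K x) ->
  tempered k D K B f -> tempered k D' K' B f.
Proof.
move=> DD; elim: k K K' f => [|k IH] K K' f KK [cf gf df].
  split => //; first by move=> x /DD/cf.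
  by apply: growth_le gf => // x Dx Kx; split; [exact: DD|exact: KK].
split.
- by move=> x /DD/cf.
- by apply: growth_le gf => // x Dx Kx; split; [exact: DD|exact: KK].
- move=> i; have [dif Tf] := df i; split; first by move=> x /DD/dif.
  by apply: IH Tf => x; case: (B i) => //; exact: KK.
Qed.

Lemma tempered_if k D K B f (b : bool) :
  tempered k D K B f -> tempered k D (if b then K else set0) B f.
Proof. by case: b => // ; apply: tempered_sub => // x _ []. Qed.

Lemma tempered_set0 k D K B f :
  tempered k D K B f -> tempered k D set0 B f.
Proof. by apply: tempered_sub => // x _ []. Qed.

Lemma near_open (T : topologicalType) (D : set T) x :
  open D -> D x -> \forall y \near x, D y.
Proof. by move=> oD Dx; apply: open_nbhs_nbhs. Qed.

Lemma tempered_eq k D K B f g : open D -> (forall x, D x -> f x = g x) ->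
  tempered k D K B f -> tempered k D K B g.
Proof.
move=> oD.
have nfg (h h' : 'rV[R]_a -> R) : (forall x, D x -> h x = h' x) ->
    forall x, D x -> \forall y \near x, h y = h' y.
  move=> hh' x Dx; have := near_open oD Dx.
  by apply: filterS => y /hh'.
elim: k K f g => [|k IH] K f g fg [cf gf df].
- split => //.
  + move=> x Dx; rewrite /prop_for /continuous_at -(fg x Dx).
    exact: cvg_trans (near_eq_cvg (nfg _ _ fg _ Dx)) (cf x Dx).
  + by apply: growth_le gf => // x Dx _; rewrite fg.
- split.
  + move=> x Dx; rewrite /prop_for /continuous_at -(fg x Dx).
    exact: cvg_trans (near_eq_cvg (nfg _ _ fg _ Dx)) (cf x Dx).
  + by apply: growth_le gf => // x Dx _; rewrite fg.
  + move=> i; have [dif Tf] := df i; split.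
      by move=> x Dx; apply: near_eq_derivable (dif _ Dx); exact: nfg fg _ Dx.
    by apply: IH Tf => x Dx; apply: near_eq_derive; exact: nfg fg _ Dx.
Qed.

(** Derivatives may be supplied by any formula valid on the open set D, which
    is how all closure properties below are proved. *)
Lemma temperedS k D K B f (d : 'I_a -> 'rV[R]_a -> R) : open D ->
  (forall x, D x -> {for x, continuous f}) -> growth D K f ->
  (forall i x, D x -> is_derive x (e_ i) f (d i x)) ->
  (forall i, tempered k D (if B i then K else set0) B (d i)) ->
  tempered k.+1 D K B f.
Proof.
move=> oD cf gf df dT; split => // i; split=> [x /(df i)[]//|].
by apply: tempered_eq (dT i) => // x /(df i)[].
Qed.

Lemma tempered_continuous k D K B f :
  tempered k D K B f -> forall x, D x -> {for x, continuous f}.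
Proof. by case: k => [|k] []. Qed.

Lemma tempered_growth k D K B f : tempered k D K B f -> growth D K f.
Proof. by case: k => [|k] []. Qed.

Lemma tempered_is_derive k D K B f i x : D x -> tempered k.+1 D K B f ->
  is_derive x (e_ i) f ('D_(e_ i) f x).
Proof. by move=> Dx [_ _ /(_ i)[df _]]; exact/derivableP/df. Qed.

Lemma tempered_derive k D K B f i : tempered k.+1 D K B f ->
  tempered k D (if B i then K else set0) B ('D_(e_ i) f).
Proof. by move=> [_ _ /(_ i)[]]. Qed.

Lemma tempered_cst k D K B c : open D -> tempered k D K B (fun=> c).
Proof.
move=> oD; elim: k K c => [|k IH] K c.
  split => //; last exact: growth_cst.
  by move=> x _; exact: cst_continuous.
apply: (@temperedS _ _ _ _ _ (fun _ _ => 0)) => //.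
- by move=> x _; exact: cst_continuous.
- exact: growth_cst.
Qed.

Lemma tempered_coord k D K B j : open D -> tempered k D K B (fun x => x 0 j).
Proof.
move=> oD; case: k => [|k].
  split => //; last exact: growth_coord.
  by move=> x _; exact: coord_continuous.
apply: (@temperedS _ _ _ _ _ (fun i _ => (e_ i : 'rV[R]_a) 0 j)) => //.
- by move=> x _; exact: coord_continuous.
- exact: growth_coord.
- move=> i x _; split.
    apply: (iffLR (derivable_mxP id x (e_ i))).
    exact: derivable_id.
  have := derive_mx (@derivable_id _ _ x (e_ i)).
  by rewrite derive_id => /rowP/(_ j) ->; rewrite mxE.
- by move=> i; exact: tempered_cst.
Qed.

Lemma temperedD k D K B f g : open D -> tempered k D K B f ->
  tempered k D K B g -> tempered k D K B (fun x => f x + g x).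
Proof.
move=> oD; elim: k K f g => [|k IH] K f g Tf Tg.
- split => //.
    move=> x Dx; apply: continuousD;
      [exact: (tempered_continuous Tf)|exact: (tempered_continuous Tg)].
  by apply: growthD; [exact: (tempered_growth Tf)|exact: (tempered_growth Tg)].
- apply: (@temperedS _ _ _ _ _
    (fun i x => 'D_(e_ i) f x + 'D_(e_ i) g x)) => //.
  + move=> x Dx; apply: continuousD;
      [exact: (tempered_continuous Tf)|exact: (tempered_continuous Tg)].
  + by apply: growthD; [exact: (tempered_growth Tf)|exact: (tempered_growth Tg)].
  + move=> i x Dx.
    exact: is_deriveD (tempered_is_derive i Dx Tf) (tempered_is_derive i Dx Tg).
  + by move=> i; apply: IH; exact: tempered_derive.
Qed.

Lemma temperedM k D K B f g : open D -> tempered k D K B f ->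
  tempered k D K B g -> tempered k D K B (fun x => f x * g x).
Proof.
move=> oD; elim: k K f g => [|k IH] K f g Tf Tg.
- split => //.
    move=> x Dx; apply: continuousM;
      [exact: (tempered_continuous Tf)|exact: (tempered_continuous Tg)].
  by apply: growthM; [exact: (tempered_growth Tf)|exact: (tempered_growth Tg)].
- apply: (@temperedS _ _ _ _ _
    (fun i x => f x * 'D_(e_ i) g x + g x * 'D_(e_ i) f x)) => //.
  + move=> x Dx; apply: continuousM;
      [exact: (tempered_continuous Tf)|exact: (tempered_continuous Tg)].
  + by apply: growthM; [exact: (tempered_growth Tf)|exact: (tempered_growth Tg)].
  + move=> i x Dx.
    exact: is_deriveM (tempered_is_derive i Dx Tf) (tempered_is_derive i Dx Tg).
  + move=> i; apply: temperedD => //; apply: IH.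
    * exact/tempered_if/temperedW.
    * exact: tempered_derive.
    * exact/tempered_if/temperedW.
    * exact: tempered_derive.
Qed.

Lemma tempered_sum k D K B (I : finType) (P : pred I) (F : I -> 'rV[R]_a -> R) :
  open D -> (forall i, P i -> tempered k D K B (F i)) ->
  tempered k D K B (fun x => \sum_(i | P i) F i x).
Proof.
move=> oD FT.
suff : forall r : seq I, tempered k D K B (fun x => \sum_(i <- r | P i) F i x) by exact.
elim=> [|i r IH].
  by apply: tempered_eq (tempered_cst k K B 0 oD) => // x _; rewrite big_nil.
have [Pi|nPi] := boolP (P i).
  apply: tempered_eq (temperedD oD (FT i Pi) IH) => // x _.
  by rewrite big_cons Pi.
by apply: tempered_eq IH => // x _; rewrite big_cons (negbTE nPi).
Qed.

Lemma tempered_prod k D K B (I : finType) (P : pred I) (F : I -> 'rV[R]_a -> R) :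
  open D -> (forall i, P i -> tempered k D K B (F i)) ->
  tempered k D K B (fun x => \prod_(i | P i) F i x).
Proof.
move=> oD FT.
suff : forall r : seq I, tempered k D K B (fun x => \prod_(i <- r | P i) F i x) by exact.
elim=> [|i r IH].
  by apply: tempered_eq (tempered_cst k K B 1 oD) => // x _; rewrite big_nil.
have [Pi|nPi] := boolP (P i).
  apply: tempered_eq (temperedM oD (FT i Pi) IH) => // x _.
  by rewrite big_cons Pi.
by apply: tempered_eq IH => // x _; rewrite big_cons (negbTE nPi).
Qed.

Lemma temperedZ k D K B c f : open D -> tempered k D K B f ->
  tempered k D K B (fun x => c * f x).
Proof. by move=> oD; apply: temperedM => //; exact: tempered_cst. Qed.

Lemma temperedB k D K B f g : open D -> tempered k D K B f ->
  tempered k D K B g -> tempered k D K B (fun x => f x - g x).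
Proof.
move=> oD Tf Tg; apply: tempered_eq (temperedD oD Tf (temperedZ (-1) oD Tg)) => //.
by move=> x _; rewrite mulN1r.
Qed.

Lemma temperedX k D K B f n : open D -> tempered k D K B f ->
  tempered k D K B (fun x => f x ^+ n).
Proof.
move=> oD Tf; elim: n => [|n IH].
  by apply: tempered_eq (tempered_cst k K B 1 oD) => // x _; rewrite expr0.
by apply: tempered_eq (temperedM oD Tf IH) => // x _; rewrite exprS.
Qed.

(** A bound for the inverse itself is enough, since the derivatives of 1/f are
    polynomials in 1/f and in the derivatives of f. *)
Lemma temperedV k D K B f : open D -> (forall x, D x -> f x != 0) ->
  growth D K (fun x => (f x)^-1) -> tempered k D K B f ->
  tempered k D K B (fun x => (f x)^-1).
Proof.
move=> oD f0; elim: k K => [|k IH] K Vf Tf.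
  split => // x Dx; apply: continuousV; first exact: f0.
  exact: (tempered_continuous Tf).
apply: (@temperedS _ _ _ _ _ (fun i x => - 1 * ((f x)^-1 ^+ 2 * 'D_(e_ i) f x))) => //.
- move=> x Dx; apply: continuousV; first exact: f0.
  exact: (tempered_continuous Tf).
- move=> i x Dx; have [dfx _] := tempered_is_derive i Dx Tf; split.
    exact: derivableV (f0 _ Dx) dfx.
  by rewrite (deriveV (f0 _ Dx) dfx) mulN1r scaleNr -exprVn.
- move=> i; apply: temperedZ => //; apply: temperedM => //.
    apply: temperedX => //; apply: IH; last exact/tempered_if/temperedW.
    by case: (B i) => //; exact: growth_set0.
  exact: tempered_derive.
Qed.

Lemma tempered_setU k D1 D2 K B f : tempered k D1 K B f -> tempered k D2 K B f ->
  tempered k (D1 `|` D2) K B f.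
Proof.
have gU K' h : growth D1 K' h -> growth D2 K' h -> growth (D1 `|` D2) K' h.
  move=> /growth_ge0[C C0 [n fC]] /growth_ge0[C' C'0 [n' gC]].
  exists (C + C'), (n + n')%N => x [Dx|Dx] Kx.
    rewrite (le_trans (fC _ Dx Kx))// ler_pM ?exprn_ge0 ?addr_ge0 ?lerDl//.
    by rewrite ler_weXn2l ?lerDl ?leq_addr.
  rewrite (le_trans (gC _ Dx Kx))// ler_pM ?exprn_ge0 ?addr_ge0 ?lerDr//.
  by rewrite ler_weXn2l ?lerDl ?leq_addl.
elim: k K f => [|k IH] K f [cf gf df] [cf' gf' df'].
  by split; [move=> x [/cf|/cf']|exact: gU|].
split; [by move=> x [/cf|/cf']|exact: gU|move=> i].
have [dif Tf] := df i; have [dif' Tf'] := df' i; split.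
  by move=> x [/dif|/dif'].
exact: IH.
Qed.

Lemma tempered_local k D B f :
  (forall x, D x -> exists2 D', D' x & tempered k D' set0 B f) ->
  tempered k D set0 B f.
Proof.
elim: k f => [|k IH] f floc.
  split => //; last exact: growth_set0.
  by move=> x /floc[D' D'x /tempered_continuous]; apply.
split; last 1 first.
- move=> i; split.
    by move=> x /floc[D' D'x [_ _ /(_ i)[]]] + _; apply.
  have -> : (if B i then set0 else set0) = set0 :> set 'rV[R]_a by case: ifP.
  apply: IH => x /floc[D' D'x /(tempered_derive i)/tempered_set0 T].
  by exists D'.
- by move=> x /floc[D' D'x /tempered_continuous]; apply.
- exact: growth_set0.
Qed.

(** Bounds concern the points of K only, so they may be proved on a smaller
    open set D' containing them, once smoothness on D is known. *)
Lemma tempered_tube k D D' K B f : (forall x, D x -> K x -> D' x) ->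
  tempered k D set0 B f -> tempered k D' K B f -> tempered k D K B f.
Proof.
elim: k K f => [|k IH] K f DK Tf Tf'.
  split => //; first exact: (tempered_continuous Tf).
  have := tempered_growth Tf'; apply: growth_le => // x Dx Kx.
  by split => //; exact: DK.
split.
- exact: (tempered_continuous Tf).
- have := tempered_growth Tf'; apply: growth_le => // x Dx Kx.
  by split => //; exact: DK.
- move=> i; split; first by move=> x Dx; have [] := tempered_is_derive i Dx Tf.
  apply: IH (tempered_derive i Tf'); last first.
    exact/tempered_set0/(tempered_derive i Tf).
  by move=> x Dx; case: ifP => // _; exact: DK.
Qed.

End Closure.

Lemma continuous_mx (U : topologicalType) r c (phi : U -> 'M[R]_(r, c)) x :
  (forall i j, {for x, continuous (fun y => phi y i j)}) ->
  {for x, continuous phi}.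
Proof.
move=> cphi; apply/cvgrPdist_le => e e0.
have : \forall y \near x, forall i j, `|phi x i j - phi y i j| <= e.
  apply: filter_forall => i; apply: filter_forall => j.
  exact: (cvgrPdist_le _ _).1 (cphi i j) _ e0.
apply: filterS => y xy; apply: mx_norm_le; first exact: ltW.
by move=> i j; rewrite !mxE.
Qed.

(** Induction along the chain rule. Derivatives of f along a direction outside
    B2 are unbounded, hence the requirement that a good direction of the source
    leaves the coordinates of phi outside B2 unchanged. *)
Lemma tempered_comp k a b (D1 K1 : set 'rV[R]_a) (D2 K2 : set 'rV[R]_b)
    (B1 : pred 'I_a) (B2 : pred 'I_b)
    (f : 'rV[R]_b -> R) (phi : 'rV[R]_a -> 'rV[R]_b) :
  open D1 -> open D2 ->
  (forall x, D1 x -> D2 (phi x)) -> (forall x, D1 x -> K1 x -> K2 (phi x)) ->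
  (forall i j, B1 i -> ~~ B2 j ->
     forall x, D1 x -> 'D_(e_ i) (fun y => phi y 0 j) x = 0) ->
  (forall j, tempered k D1 K1 B1 (fun x => phi x 0 j)) ->
  tempered k D2 K2 B2 f -> tempered k D1 K1 B1 (f \o phi).
Proof.
move=> oD1 oD2 D12; elim: k K1 K2 f => [|k IH] K1 K2 f K12 B12 phiT fT.
  split => //.
    move=> x Dx; apply: continuous_comp.
      by apply: continuous_mx => i j; rewrite (ord1 i); exact: tempered_continuous (phiT j) x Dx.
    exact: (tempered_continuous fT) (D12 _ Dx).
  apply: growth_comp (tempered_growth fT).
    by move=> x Dx Kx; split; [exact: D12|exact: K12].
  by move=> j; exact: tempered_growth (phiT j).
pose d i x := \sum_j 'D_(e_ i) (fun y => phi y 0 j) x * 'D_(e_ j) f (phi x).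
apply: (@temperedS _ _ _ _ _ _ d) => //.
- move=> x Dx; apply: continuous_comp.
    by apply: continuous_mx => i j; rewrite (ord1 i); exact: tempered_continuous (phiT j) x Dx.
  exact: (tempered_continuous fT) (D12 _ Dx).
- apply: growth_comp (tempered_growth fT).
    by move=> x Dx Kx; split; [exact: D12|exact: K12].
  by move=> j; exact: tempered_growth (phiT j).
- move=> i x Dx; apply: (is_derive_comp_C1 (d := fun j => 'D_(e_ j) f)).
  + by move=> j; apply: tempered_is_derive (phiT j).
  + have := near_open oD2 (D12 _ Dx); apply: filterS => y Dy j.
    exact: tempered_is_derive fT.
  + by move=> j; apply: (tempered_continuous (tempered_derive j fT)); exact: D12.
- move=> i; apply: tempered_sum => // j _.
  have [Bi|nBi] := boolP (B1 i); last first.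
    apply: temperedM => //.
      by have := tempered_derive i (phiT j); rewrite (negbTE nBi).
    apply: (IH set0 set0 ('D_(e_ j) f)) => //.
    + by move=> j'; exact/tempered_set0/temperedW/phiT.
    + exact/tempered_set0/(tempered_derive j fT).
  have [Bj|nBj] := boolP (B2 j); last first.
    apply: tempered_eq (tempered_cst k K1 B1 0 oD1) => // x Dx.
    by rewrite B12// mul0r.
  apply: temperedM => //.
    by have := tempered_derive i (phiT j); rewrite Bi.
  apply: (IH K1 K2 ('D_(e_ j) f)) => //.
  + by move=> j'; exact/temperedW/phiT.
  + by have := tempered_derive j fT; rewrite Bj.
Qed.

End Tempered.

(** * Smooth functions and the order of differentiation *)

Section Smooth.
Variable R : realType.
Local Notation e_ i := (coord_vec R i).

Lemma iterated_derive_comp_affine (U V W : normedModType R) (h L : U -> V)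
    (f : V -> W) (l : seq U) :
  (forall t u w, h (t *: u + w) = t *: L u + h w) ->
  iterated_derive l (f \o h) = iterated_derive (map L l) f \o h.
Proof.
move=> hL; elim: l => //= v l ->; apply/funext => x.
by rewrite (derive_comp_affine _ _ _ hL).
Qed.

(** For an affine map the iterated derivatives of the composite are again
    iterated derivatives, along the images of the directions. *)
Lemma smooth_on_comp_affine (U V W : normedModType R) (h L : U -> V)
    (D : set V) (f : V -> W) :
  (forall t u w, h (t *: u + w) = t *: L u + h w) -> continuous h ->
  smooth_on D f -> smooth_on (h @^-1` D) (f \o h).
Proof.
move=> hL hc fs l x Dx; rewrite (iterated_derive_comp_affine _ _ hL).
have [fc fd] := fs (map L l) _ Dx; split.
  by apply: continuous_comp; [exact: hc|exact: fc].
by move=> v; apply/(derivable_comp_affine _ _ _ hL).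
Qed.

Lemma smooth_on_entry (V : normedModType R) r c (D : set V)
    (F : V -> 'M[R]_(r, c)) i j l x :
  open D -> smooth_on D F -> D x ->
  iterated_derive l F x i j = iterated_derive l (fun y => F y i j) x.
Proof.
move=> oD Fs; elim: l x => //= v l IH x Dx.
rewrite (derive_mx ((Fs l x Dx).2 v)) mxE; apply: near_eq_derive.
by have := near_open oD Dx; apply: filterS.
Qed.

Lemma near_eq_continuous (T U : topologicalType) (f g : T -> U) x :
  (\forall y \near x, f y = g y) -> {for x, continuous f} -> {for x, continuous g}.
Proof.
move=> fg cf; rewrite /prop_for /continuous_at -(nbhs_singleton fg).
exact: cvg_trans (near_eq_cvg fg) cf.
Qed.

Lemma smooth_on_entries (V : normedModType R) r c (D : set V)
    (F : V -> 'M[R]_(r, c)) :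
  open D -> (smooth_on D F <-> forall i j, smooth_on D (fun y => F y i j)).
Proof.
move=> oD; split=> [Fs i j l x Dx|Fs].
  have nE : \forall y \near x,
      iterated_derive l F y i j = iterated_derive l (fun y => F y i j) y.
    have := near_open oD Dx; apply: filterS => y.
    exact: smooth_on_entry.
  have [Fc Fd] := Fs l x Dx; split.
    apply: near_eq_continuous nE _.
    by apply: (@continuous_comp _ _ _ (iterated_derive l F) (fun M : 'M[R]_(r, c) => M i j));
      [exact: Fc|exact: coord_continuous].
  move=> v; apply: near_eq_derivable nE _.
  exact: (iffLR (derivable_mxP _ _ _) (Fd v)).
have main l x : D x ->
    iterated_derive l F x = \matrix_(i, j) iterated_derive l (fun y => F y i j) x.
  elim: l x => [|v l IH] x Dx /=; first by apply/matrixP => i j; rewrite mxE.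
  have nE : \forall y \near x, \matrix_(i, j) iterated_derive l (fun y => F y i j) y
      = iterated_derive l F y.
    by have := near_open oD Dx; apply: filterS => y /IH ->.
  rewrite -(near_eq_derive _ nE) derive_mx.
    apply/matrixP => i j; rewrite !mxE; congr (derive _ _ _).
    by apply/funext => y; rewrite mxE.
  apply/derivable_mxP => i j.
  under eq_fun do rewrite mxE.
  exact: (Fs i j l x Dx).2.
move=> l x Dx.
have nE : \forall y \near x, \matrix_(i, j) iterated_derive l (fun y => F y i j) y
      = iterated_derive l F y.
  by have := near_open oD Dx; apply: filterS => y /main ->.
split.
  apply: near_eq_continuous nE _; apply: continuous_mx => i j.
  apply: near_eq_continuous (Fs i j l x Dx).1.
  by apply: nearW => y; rewrite mxE.
move=> v; apply: near_eq_derivable nE _; apply/derivable_mxP => i j.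
under eq_fun do rewrite mxE.
exact: (Fs i j l x Dx).2.
Qed.

Section TemperedSmooth.
Variable a : nat.
Implicit Types (D K : set 'rV[R]_a) (B : pred 'I_a) (f : 'rV[R]_a -> R).

Lemma smooth_on_tempered D B f : smooth_on D f ->
  forall k, tempered k D set0 B f.
Proof.
move=> fs k; suff : forall l, tempered k D set0 B (iterated_derive l f).
  by move=> /(_ [::]); exact.
elim: k => [|k IH] l.
  by split; [by move=> x Dx; exact: (fs l x Dx).1|exact: growth_set0|].
split; [by move=> x Dx; exact: (fs l x Dx).1|exact: growth_set0|move=> i; split].
  by move=> x Dx; exact: (fs l x Dx).2.
by case: ifP => _; exact: (IH (e_ i :: l)).
Qed.

(** Only the derivatives along good directions have to be bounded: [tempered]
    asks for nothing but smoothness after a bad one. *)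
Lemma iterated_growth_tempered D K B f : smooth_on D f ->
  (forall s, all B s -> growth D K (iterated_derive [seq e_ i | i <- s] f)) ->
  forall k, tempered k D K B f.
Proof.
move=> fs fg k.
have T0 l : tempered k D set0 B (iterated_derive l f).
  apply: smooth_on_tempered => l' x Dx.
  rewrite (_ : iterated_derive l' (iterated_derive l f) = iterated_derive (l' ++ l) f).
    exact: fs.
  by rewrite /iterated_derive foldr_cat.
suff : forall s, all B s -> tempered k D K B (iterated_derive [seq e_ i | i <- s] f).
  by move=> /(_ [::]); exact.
elim: k T0 => [|k IH] T0 s Bs.
  by split; [by move=> x Dx; exact: (fs _ x Dx).1|exact: fg|].
split; [by move=> x Dx; exact: (fs _ x Dx).1|exact: fg|move=> i; split].
  by move=> x Dx; exact: (fs _ x Dx).2.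
have [Bi|nBi] := boolP (B i); last exact/temperedW/(T0 (e_ i :: _)).
by apply: (IH _ (i :: s)) => [l|]; [exact/temperedW/T0|rewrite /= Bi].
Qed.

Lemma tempered_derive_dir k D K B f x v : open D -> tempered k.+1 D K B f -> D x ->
  is_derive x v f (\sum_i v 0 i * 'D_(e_ i) f x).
Proof.
move=> oD fT Dx; apply: (is_derive_C1 (d := fun i => 'D_(e_ i) f)).
  have := near_open oD Dx; apply: filterS => y Dy i.
  exact: tempered_is_derive fT.
by move=> i; exact: (tempered_continuous (tempered_derive i fT)).
Qed.

(** Partial derivatives suffice, since a C^1 function has as derivative along v
    the combination of its partial derivatives with the coordinates of v. *)
Lemma tempered_smooth_on D B f : open D -> (forall k, tempered k D set0 B f) ->
  smooth_on D f.
Proof.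
move=> oD fT l; suff main k : tempered k D set0 xpred0 (iterated_derive l f).
  move=> x Dx; split; first exact: (tempered_continuous (main 0%N)).
  move=> v; have main1 := main 1%N.
  suff [] : is_derive x v (iterated_derive l f)
    (\sum_i v 0 i * 'D_(e_ i) (iterated_derive l f) x) by [].
  exact: tempered_derive_dir main1 Dx.
elim: l k => [|v l IH] k /=.
  elim: k f fT => [|k IH] f fT; first by have [] := fT 0%N; split.
  have [cf gf df] := fT 1%N; split => // i; split; first by have [] := df i.
  apply: IH => k'; have := tempered_derive i (fT k'.+1).
  exact: tempered_set0.
apply: tempered_eq (_ : tempered k D set0 xpred0 (fun x =>
   \sum_i v 0 i * 'D_(e_ i) (iterated_derive l f) x)) => //.
  move=> x Dx; have main1 := IH 1%N.
  suff [] : is_derive x v (iterated_derive l f)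
    (\sum_i v 0 i * 'D_(e_ i) (iterated_derive l f) x) by [].
  exact: tempered_derive_dir main1 Dx.
apply: tempered_sum => // i _; apply: temperedZ => //.
exact: (tempered_derive i (IH k.+1)).
Qed.

Lemma tempered_iterated D K B f s : (forall k, tempered k D K B f) -> all B s ->
  forall k, tempered k D K B (iterated_derive [seq e_ i | i <- s] f).
Proof.
move=> fT; elim: s => //= i s IH /andP[Bi Bs] k.
by have := tempered_derive i (IH Bs k.+1); rewrite Bi.
Qed.

(** Two applications of the mean value theorem, first along i and then along j,
    express the second difference by a mixed derivative at a point close to
    x. *)
Lemma second_difference D f i j x : open D -> tempered 2 D set0 xpred0 f ->
  D x -> forall e, 0 < e -> exists2 r, 0 < r & forall s, 0 < s -> s < r ->
  `|f (s *: e_ i + s *: e_ j + x) - f (s *: e_ i + x) - f (s *: e_ j + x) + f x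
    - s * s * 'D_(e_ j) ('D_(e_ i) f) x| <= s * s * e.
Proof.
move=> oD fT Dx e e0.
have dfT := tempered_derive i fT; have ddfT := tempered_derive j dfT.
have : \forall y \near x, D y /\
    `|'D_(e_ j) ('D_(e_ i) f) x - 'D_(e_ j) ('D_(e_ i) f) y| <= e.
  have near1 := near_open oD Dx.
  have near2 := (cvgrPdist_le _ _).1 (tempered_continuous ddfT Dx) _ e0.
  near=> y; split; near: y; [exact: near1|exact: near2].
move=> /nbhs_ballP[r /= r0 xr].
exists (r / 2); first by rewrite divr_gt0.
move=> s s0 sr.
have ax t t' : `|t| <= s -> `|t'| <= s -> ball x r (t' *: e_ j + (t *: e_ i + x)).
  move=> ts t's; rewrite -ball_normE/= addrA opprD addrCA subrr addr0 normrN.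
  rewrite (le_lt_trans (ler_normD _ _))// (splitr r) ltrD//.
    rewrite (le_lt_trans _ sr)// normrZ (le_trans _ t's)// ler_piMr//.
    by apply: mx_norm_le => // u v; rewrite !mxE; case: (_ && _); rewrite ?normr1 ?normr0.
  rewrite (le_lt_trans _ sr)// normrZ (le_trans _ ts)// ler_piMr//.
  by apply: mx_norm_le => // u v; rewrite !mxE; case: (_ && _); rewrite ?normr1 ?normr0.
pose g y := f (s *: e_ j + y) - f y.
have gd (t : R) : `|t| <= `|s| -> is_derive (t *: e_ i + x) (e_ i) g
    ('D_(e_ i) f (s *: e_ j + (t *: e_ i + x)) - 'D_(e_ i) f (t *: e_ i + x)).
  rewrite (gtr0_norm s0) => ts.
  have D1 : D (s *: e_ j + (t *: e_ i + x)).
    by apply: (xr _ (ax _ _ ts _)).1; rewrite gtr0_norm.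
  have D2 : D (t *: e_ i + x).
    have := (xr _ (ax t 0 ts _)).1; rewrite scale0r add0r normr0; apply.
    exact: ltW.
  have hL (c : R) (u w : 'rV[R]_a) : s *: e_ j + (c *: u + w) = c *: u + (s *: e_ j + w).
    by rewrite addrCA.
  apply: is_deriveB.
    split.
      apply/(derivable_comp_affine (L := id) _ _ _ hL).
      by have [] := tempered_is_derive i D1 fT.
    by rewrite (derive_comp_affine (L := id) f _ _ hL).
  exact: (tempered_is_derive i D2 fT).
have [t ts gt] := segment_MVT
  (df := fun y => 'D_(e_ i) f (s *: e_ j + y) - 'D_(e_ i) f y) gd.
rewrite (gtr0_norm s0) in ts.
have dd (t' : R) : `|t'| <= `|s| -> is_derive (t' *: e_ j + (t *: e_ i + x)) (e_ j)
    ('D_(e_ i) f) ('D_(e_ j) ('D_(e_ i) f) (t' *: e_ j + (t *: e_ i + x))).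
  rewrite (gtr0_norm s0) => t's.
  exact: (tempered_is_derive j (xr _ (ax _ _ ts t's)).1 dfT).
have [t' t's dt] := segment_MVT (df := 'D_(e_ j) ('D_(e_ i) f)) dd.
rewrite (gtr0_norm s0) in t's.
rewrite dt /g in gt.
have -> : f (s *: e_ i + s *: e_ j + x) - f (s *: e_ i + x) - f (s *: e_ j + x) + f x
  = f (s *: e_ j + (s *: e_ i + x)) - f (s *: e_ i + x) - (f (s *: e_ j + x) - f x).
  by rewrite [s *: e_ i + s *: e_ j]addrC -[_ + _ + x]addrA; ring.
rewrite gt mulrA -mulrBr normrM gtr0_norm ?mulr_gt0// ler_wpM2l ?mulr_ge0 ?(ltW s0)//.
by rewrite distrC; have [] := xr _ (ax _ _ ts t's).
Unshelve. all: by end_near. Qed.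

(** The second difference does not depend on the order of i and j, and divided
    by the area of the square it approaches both mixed derivatives. *)
Lemma derive_sym D f i j x : open D -> tempered 2 D set0 xpred0 f -> D x ->
  'D_(e_ j) ('D_(e_ i) f) x = 'D_(e_ i) ('D_(e_ j) f) x.
Proof.
move=> oD fT Dx; apply/eqP; rewrite -subr_eq0 -normr_le0.
apply/ler_addgt0Pl => e e0; rewrite addr0.
have e20 : 0 < e / 2 by rewrite divr_gt0.
have [r r0 rP] := second_difference i j oD fT Dx e20.
have [r' r'0 rP'] := second_difference j i oD fT Dx e20.
pose s := Num.min r r' / 2.
have s0 : 0 < s by rewrite divr_gt0// lt_min r0.
have sm : s < Num.min r r' by rewrite ltr_pdivrMr// ltr_pMr ?lt_min ?r0// ltr1n.
have := rP s s0 (lt_le_trans sm _); rewrite ge_min lexx => /(_ isT) H1.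
have := rP' s s0 (lt_le_trans sm _); rewrite ge_min lexx orbT => /(_ isT) H2.
have ss0 : 0 < s * s by rewrite mulr_gt0.
rewrite -(ler_pM2l ss0) -{1}(gtr0_norm ss0) -normrM mulrBr.
rewrite [s *: e_ j + s *: e_ i]addrC in H2.
move: (f (s *: e_ i + s *: e_ j + x)) (f (s *: e_ i + x)) (f (s *: e_ j + x)) H1 H2.
move: (f x) ('D_(e_ j) _ x) ('D_(e_ i) _ x) => u P Q A b c H1 H2.
have -> : s * s * P - s * s * Q =
    (A - c - b + u - s * s * Q) - (A - b - c + u - s * s * P) by ring.
by rewrite (le_trans (ler_normB _ _))// (splitr e) mulrDr lerD.
Qed.

End TemperedSmooth.

End Smooth.

Section MultiIndices.
Variable R : realType.
Local Notation e_ i := (coord_vec R i).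
Local Notation iter_pd s f := (iterated_derive [seq e_ i | i <- s] f).

Lemma near_iterated_derive a (D : set 'rV[R]_a) (f g : 'rV[R]_a -> R) s t i x :
  open D -> (forall y, D y -> iter_pd s f y = iter_pd t g y) -> D x ->
  iter_pd (i :: s) f x = iter_pd (i :: t) g x.
Proof.
move=> oD st Dx; apply: near_eq_derive.
by have := near_open oD Dx; apply: filterS.
Qed.

Lemma iterated_derive_perm a (D : set 'rV[R]_a) (f : 'rV[R]_a -> R) s t x :
  open D -> (forall k, tempered k D set0 xpred0 f) -> perm_eq s t -> D x ->
  iter_pd s f x = iter_pd t f x.
Proof.
move=> oD fT.
have fTs r k : tempered k D set0 xpred0 (iter_pd r f).
  elim: r k => [|i r IH] k; first exact: fT.
  exact: (tempered_derive i (IH k.+1)).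
have swap t1 t2 i y : D y -> iter_pd (t1 ++ i :: t2) f y = iter_pd (i :: t1 ++ t2) f y.
  elim: t1 y => // j t1 IH y Dy.
  rewrite [LHS](near_iterated_derive j oD IH Dy).
  exact: derive_sym oD (fTs _ _) Dy.
elim: s t x => [|i s IH] t x st Dx.
  by move: st; rewrite perm_sym => /perm_nilP ->.
have : i \in t by rewrite -(perm_mem st) mem_head.
move=> it; move: st; case/path.splitPr: it => t1 t2 st.
rewrite swap//; apply: near_iterated_derive (Dx) => // y Dy; apply: IH => //.
by rewrite -(perm_cons i) (perm_trans st)// perm_sym -cat1s perm_catCA.
Qed.

(** The order in which [multi_derive] applies the partial derivatives. *)
Definition canonical_seq a (J : 'I_a -> nat) : seq 'I_a :=
  flatten [seq nseq (J i) i | i <- enum 'I_a].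

Lemma count_canonical_seq a (J : 'I_a -> nat) i : count_mem i (canonical_seq J) = J i.
Proof.
rewrite count_flatten -map_comp sumnE big_map big_enum/=.
rewrite (bigD1 i)//= count_nseq/= eqxx mul1n big1 ?addn0// => j ji.
by rewrite count_nseq/= (negbTE ji).
Qed.

Lemma size_canonical_seq a (J : 'I_a -> nat) : size (canonical_seq J) = (\sum_i J i)%N.
Proof.
rewrite size_flatten /shape -map_comp sumnE big_map -big_enum; apply: eq_bigr => i _.
by rewrite /= size_nseq.
Qed.

Lemma perm_canonical_seq a (t : seq 'I_a) :
  perm_eq t (canonical_seq (fun i => count_mem i t)).
Proof. by apply/allP => x _ /=; rewrite count_canonical_seq. Qed.

Lemma multi_deriveE a (W : normedModType R) (J : 'I_a -> nat) (f : 'rV[R]_a -> W) :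
  multi_derive J f = iter_pd (canonical_seq J) f.
Proof.
rewrite /multi_derive map_flatten -map_comp; congr (iterated_derive (flatten _) f).
by apply: eq_map => i /=; rewrite map_nseq.
Qed.

(** By symmetry of mixed derivatives, an iterated partial derivative only
    depends on the number of occurrences of each direction. *)
Lemma iterated_derive_count a (D : set 'rV[R]_a) (f : 'rV[R]_a -> R) s x :
  open D -> (forall k, tempered k D set0 xpred0 f) -> D x ->
  iter_pd s f x = multi_derive (fun i => count_mem i s) f x.
Proof.
move=> oD fT Dx; rewrite multi_deriveE.
exact: iterated_derive_perm oD fT (perm_canonical_seq s) Dx.
Qed.

Definition tube p m (K : set 'rV[R]_p) : set 'rV[R]_(p + m) := [set z | K (lsubmx z)].

Lemma norm_rsubmx_le p m (z : 'rV[R]_(p + m)) : `|rsubmx z| <= `|z|.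
Proof. by apply: mx_norm_le => // i j; rewrite mxE ler_mx_norm. Qed.

Lemma norm_row_mx_le p m (x : 'rV[R]_p) (v : 'rV[R]_m) : `|row_mx x v| <= `|x| + `|v|.
Proof.
apply: mx_norm_le => [|i j]; first exact: addr_ge0.
rewrite mxE; case: fintype.split => k.
  by rewrite (le_trans (ler_mx_norm _ _ _))// lerDl.
by rewrite (le_trans (ler_mx_norm _ _ _))// lerDr.
Qed.

(** The real exponent of the bound is rounded up to a natural number, and the
    norm of the fibre part is at most the norm of the whole vector. *)
Lemma slowly_increasing_growth p m (W : normedModType R) (D : set 'rV[R]_(p + m))
    (f : 'rV[R]_(p + m) -> W) (K : set 'rV[R]_p) (J : 'I_(p + m) -> nat) :
  slowly_increasing D f -> compact K -> K `<=` lsubmx @` D ->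
  growth D (tube K) (fun z => `|multi_derive J f z|).
Proof.
move=> [_ _ /(_ K J)] + cK KD => /(_ cK KD)[r r0 [C CP]].
have [n rn] : exists n : nat, r <= n%:R.
  by exists (Num.bound r); rewrite ltW// archi_boundP// ltW.
exists C, n => z Dz Kz; rewrite normr_id.
have := CP _ (ex_intro2 _ _ (lsubmx z) Kz (ex_intro2 _ _ (rsubmx z) I erefl)).
rewrite hsubmxK powRN mulrC ler_pdivrMr ?powR_gt0 ?ltr_pwDl//.
move=> /le_trans; apply.
have C0 : 0 <= C.
  have := CP _ (ex_intro2 _ _ (lsubmx z) Kz (ex_intro2 _ _ (rsubmx z) I erefl)).
  by apply: le_trans; rewrite mulr_ge0// powR_ge0.
rewrite ler_wpM2l// -powR_mulrn ?addr_ge0//.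
rewrite (@le_trans _ _ ((1 + `|rsubmx z|) `^ n%:R))//.
  by apply: ler_powR => //; rewrite lerDl.
by rewrite ge0_ler_powR ?nnegrE ?addr_ge0// lerD2l norm_rsubmx_le.
Qed.

(** On a compact K the norm of x is bounded, so that a bound by powers of 1 +
    |(x, v)| is a bound by powers of 1 + |v|. *)
Lemma growth_slowly_increasing p m (W : normedModType R) (D : set 'rV[R]_(p + m))
    (f : 'rV[R]_(p + m) -> W) :
  (forall x v w, D (row_mx x v) -> D (row_mx x w)) -> smooth_on D f ->
  (forall (K : set 'rV[R]_p) J, compact K -> K `<=` lsubmx @` D ->
    growth D (tube K) (fun z => `|multi_derive J f z|)) ->
  slowly_increasing D f.
Proof.
move=> fib fs fg; split => // K J cK KD.
have /growth_ge0[C C0 [n fC]] := fg K J cK KD.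
have [M0 [_ MK0]] := compact_bounded cK.
pose M := M0 + 1.
have MK x : K x -> `|x| <= `|M|.
  move=> Kx; apply: le_trans (ler_norm M).
  by apply: MK0 => //; rewrite /M ltrDl.
exists n.+1%:R; first by rewrite ltr0n.
exists (C * (1 + `|M|) ^+ n) => _ [x Kx [v _ <-]].
have Dxv : D (row_mx x v).
  by have [z Dz zx] := KD _ Kx; apply: (fib x (rsubmx z)); rewrite -zx hsubmxK.
have v1 : 1 <= 1 + `|v| by rewrite lerDl.
have v0 : 0 <= 1 + `|v| by rewrite addr_ge0.
have M1 : 0 <= 1 + `|M| by rewrite addr_ge0.
have Kxv : tube K (row_mx x v) by rewrite /tube/= row_mxKl.
rewrite powRN mulrC ler_pdivrMr ?powR_gt0 ?ltr_pwDl// -[leLHS]normr_id.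
apply: (le_trans (fC _ Dxv Kxv)); rewrite powR_mulrn// -mulrA ler_wpM2l//.
apply: (@le_trans _ _ ((1 + `|M|) ^+ n * (1 + `|v|) ^+ n)).
  rewrite -exprMn lerXn2r ?nnegrE ?addr_ge0// ?mulr_ge0//.
  apply: (@le_trans _ _ (1 + (`|x| + `|v|))); first by rewrite lerD2l norm_row_mx_le.
  have xM := MK _ Kx; have Mv : 0 <= `|M| * `|v| by rewrite mulr_ge0.
  by rewrite mulrDl mul1r mulrDr mulr1; lra.
by rewrite ler_wpM2l ?exprn_ge0// ler_weXn2l.
Qed.

End MultiIndices.

(** * Solving equations along the fibres of a coordinate projection *)

Section SolvingByMinimization.
Variable R : realType.

Lemma derive_estimate (V W : normedModType R) (f : V -> W) x v df e :
  is_derive x v f df -> 0 < e -> exists2 r, 0 < r & forall t : R, `|t| < r ->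
    t != 0 -> `|t^-1 *: (f (t *: v + x) - f x) - df| <= e.
Proof.
move=> [dfx <-] e0.
have := (cvgrPdist_le _ _).1 dfx _ e0.
move=> [r /= r0 H]; exists r => // t tr t0.
rewrite distrC; apply: (H t) => //.
by rewrite /ball_/= sub0r normrN.
Qed.

(** Minimize |y - Psi w| + |w - w0| / (2 L) over C. Comparison with the value
    at w0 gives |w - w0| <= 2 L |y - Psi w0| for a minimizer w, which therefore
    lies where descent directions exist. A step t d lowers the residual r = |y
    - Psi w| by t r up to o(t), and increases the penalty by at most t |d| / (2
    L) <= t r / 2; so r = 0. *)
Lemma solution_by_descent N (W : normedModType R) (C : set 'rV[R]_N)
    (Psi : 'rV[R]_N -> W) (y : W) (w0 : 'rV[R]_N) (L rho : R) :
  compact C -> C w0 -> 0 < L -> (forall w, C w -> {for w, continuous Psi}) ->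
  (forall w, C w -> `|w - w0| < rho -> exists d,
     [/\ exists2 r, 0 < r & forall t, 0 < t -> t < r -> C (t *: d + w),
         is_derive w d Psi (y - Psi w) & `|d| <= L * `|y - Psi w|]) ->
  2 * L * `|y - Psi w0| < rho ->
  exists w, [/\ C w, Psi w = y & `|w - w0| <= 2 * L * `|y - Psi w0|].
Proof.
move=> cC Cw0 L0 cPsi desc rhoP.
have L20 : 0 < 2 * L by rewrite mulr_gt0.
pose phi w := `|y - Psi w| + (2 * L)^-1 * `|w - w0|.
have cphi : {within C, continuous phi}.
  apply: continuous_in_subspaceT => w /set_mem Cw.
  have c1 : {for w, continuous (fun w : 'rV[R]_N => y - Psi w)}.
    by apply: continuousB; [exact: cst_continuous|exact: (cPsi _ Cw)].
  have c2 : {for w, continuous (fun w : 'rV[R]_N => w - w0)}.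
    by apply: continuousB; [exact: cvg_id|exact: cst_continuous].
  have c3 : {for w, continuous (fun w : 'rV[R]_N => `|y - Psi w|)}.
    exact: (continuous_comp c1 (@norm_continuous _ _ _)).
  have c4 : {for w, continuous (fun w : 'rV[R]_N => `|w - w0|)}.
    exact: (continuous_comp c2 (@norm_continuous _ _ _)).
  apply: (continuousD c3).
  by apply: continuousM => //; exact: cst_continuous.
have C_neq0 : C !=set0 by exists w0.
have [w /set_mem Cw wmin] := EVT_min_rV C_neq0 cC cphi.
have ww0 : `|w - w0| <= 2 * L * `|y - Psi w0|.
  have := wmin w0 (mem_set Cw0).
  rewrite /phi subrr normr0 mulr0 addr0 => H.
  rewrite -ler_pdivrMl//; apply: le_trans H.
  by rewrite lerDr.
exists w; split => //; apply/eqP; rewrite eq_sym -subr_eq0 -normr_eq0.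
rewrite eq_le normr_ge0 andbT leNgt; apply/negP => r0.
have [d [[e e0 Cd] dd dL]] := desc w Cw (le_lt_trans ww0 rhoP).
set r := `|y - Psi w| in r0 dL.
have r40 : 0 < r / 4 by rewrite divr_gt0.
have [e' e'0 dde] := derive_estimate dd r40.
(* With this t the error in the linearization of Psi is at most t r / 4, so
   that the total change is at most - t r / 4. *)
pose t := Num.min 1 (Num.min e e') / 2.
have m0 : 0 < Num.min 1 (Num.min e e') by rewrite !lt_min ltr01 e0.
have t0 : 0 < t by rewrite divr_gt0.
have tm : t < Num.min 1 (Num.min e e') by rewrite ltr_pdivrMr// ltr_pMr// ltr1n.
move: (tm); rewrite !lt_min => /and3P[t1 te te'].
have := wmin _ (mem_set (Cd _ t0 te)).
have {}dde : `|Psi (t *: d + w) - Psi w - t *: (y - Psi w)| <= t * (r / 4).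
  have := dde t; rewrite gtr0_norm// gt_eqF// => /(_ te' isT).
  rewrite -(ler_pM2l t0) -{1}(gtr0_norm t0) -normrZ scalerBr scalerA.
  by rewrite divff ?gt_eqF// scale1r.
have H1 : `|y - Psi (t *: d + w)| <= (1 - t) * r + t * (r / 4).
  rewrite (_ : y - _ = (1 - t) *: (y - Psi w)
      - (Psi (t *: d + w) - Psi w - t *: (y - Psi w))); last first.
    by rewrite scalerBl scale1r opprB addrA subrK opprB addrA subrK.
  rewrite (le_trans (ler_normB _ _))// lerD// normrZ ger0_norm// subr_ge0.
  exact: ltW.
have H2 : `|t *: d + w - w0| <= t * (L * r) + `|w - w0|.
  by rewrite -addrA (le_trans (ler_normD _ _))// lerD2r normrZ gtr0_norm// ler_pM2l.
rewrite /phi -/r => H3.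
have H4 : (2 * L)^-1 * `|t *: d + w - w0| <= t * r / 2 + (2 * L)^-1 * `|w - w0|.
  have -> : t * r / 2 + (2 * L)^-1 * `|w - w0| =
      (2 * L)^-1 * (t * (L * r) + `|w - w0|) by field; rewrite gt_eqF.
  by rewrite ler_pM2l// invr_gt0.
have tr : 0 < t * r by rewrite mulr_gt0.
lra.
Qed.

End SolvingByMinimization.

Section ImplicitFunction.
Variable R : realType.
Local Notation e_ i := (coord_vec R i).

Lemma is_derive_mx (V : normedModType R) r c (F : V -> 'M[R]_(r, c)) x v (M : 'M[R]_(r, c)) :
  (forall i j, is_derive x v (fun y => F y i j) (M i j)) -> is_derive x v F M.
Proof.
move=> dF; have dF' : derivable F x v.
  by apply/derivable_mxP => i j; have [] := dF i j.
split => //; rewrite derive_mx//; apply/matrixP => i j; rewrite mxE.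
by have [] := dF i j.
Qed.

Lemma is_derive_entry (V : normedModType R) r c (F : V -> 'M[R]_(r, c)) x v
    (M : 'M[R]_(r, c)) i j :
  is_derive x v F M -> is_derive x v (fun y => F y i j) (M i j).
Proof.
case=> dF <-; split; first exact: (iffLR (derivable_mxP _ _ _) dF).
by rewrite derive_mx// mxE.
Qed.

Variables (N s : nat) (Delta : 'rV[R]_N -> 'cV[R]_s) (k : 'I_s -> 'I_N).
Variables (D : set 'rV[R]_N).
Hypothesis oD : open D.
Hypothesis k_inj : injective k.

(** The coordinates k_1, ..., k_s are those along the fibre. *)
Definition same_fibre (z w : 'rV[R]_N) := forall j, j \notin codom k -> w 0 j = z 0 j.

(** A column of increments of the fibre coordinates, as an increment of all
    coordinates. *)
Definition lift_cV (c : 'cV[R]_s) : 'rV[R]_N := \row_j \sum_(i | k i == j) c i 0.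

Lemma lift_cV_k c i : lift_cV c 0 (k i) = c i 0.
Proof.
rewrite mxE (bigD1 i)//= big1 ?addr0// => i' /andP[/eqP/k_inj ->].
by rewrite eqxx.
Qed.

Lemma lift_cV_off c j : j \notin codom k -> lift_cV c 0 j = 0.
Proof.
move=> jk; rewrite mxE big1// => i /eqP ij.
by rewrite -ij codom_f in jk.
Qed.

Lemma norm_lift_cV_le c : `|lift_cV c| <= `|c|.
Proof.
apply: mx_norm_le => // i j; rewrite ord1.
have [/codomP[l ->]|jk] := boolP (j \in codom k).
  by rewrite lift_cV_k ler_mx_norm.
by rewrite lift_cV_off// normr0.
Qed.

Local Notation J := (Jacobian_minor k Delta).

Lemma Jacobian_minorE z i l : J z i l = 'D_(e_ (k l)) (fun y => Delta y i 0) z.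
Proof. by rewrite !mxE. Qed.

Hypothesis Delta1 : forall i, tempered 1 D set0 xpred0 (fun z => Delta z i 0).

Lemma sum_lift_cV c (g : 'I_N -> R) :
  \sum_j lift_cV c 0 j * g j = \sum_l c l 0 * g (k l).
Proof.
under eq_bigr do rewrite mxE mulr_suml.
rewrite (exchange_big_dep xpredT)//=; apply: eq_bigr => l _.
by rewrite (big_pred1 (k l))// => j'; rewrite /= eq_sym.
Qed.

Lemma J_mul_lift_cV w c i : (J w *m c) i 0 =
  \sum_j lift_cV c 0 j * 'D_(e_ j) (fun z => Delta z i 0) w.
Proof.
rewrite sum_lift_cV mxE; apply: eq_bigr => l _.
by rewrite Jacobian_minorE mulrC.
Qed.

Lemma is_derive_lift_cV w c : D w -> is_derive w (lift_cV c) Delta (J w *m c).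
Proof.
move=> Dw; apply: is_derive_mx => i j; rewrite (ord1 j) J_mul_lift_cV.
exact: (tempered_derive_dir (lift_cV c) oD (Delta1 i) Dw).
Qed.

Hypothesis J_unit : forall z, D z -> J z \in unitmx.

Lemma Delta_continuous w : D w -> {for w, continuous Delta}.
Proof.
move=> Dw; apply: continuous_mx => i j; rewrite (ord1 j).
exact: (tempered_continuous (Delta1 i) Dw).
Qed.

(** Newton's direction J(w)^-1 (y - Delta w), which stays in the fibre, is a
    descent direction for the residual, with length at most L |y - Delta w|. *)
Lemma fibre_solution z rho L y : D z -> 0 < rho -> 0 < L ->
  (forall w, same_fibre z w -> `|w - z| <= rho ->
     D w /\ forall c : 'cV[R]_s, `|invmx (J w) *m c| <= L * `|c|) ->
  2 * L * `|y - Delta z| < rho ->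
  exists w, [/\ D w, same_fibre z w, Delta w = y &
    `|w - z| <= 2 * L * `|y - Delta z|].
Proof.
move=> Dz rho0 L0 fib small.
pose C := [set w | same_fibre z w /\ `|w - z| <= rho].
have cC : compact C.
  pose A j : set R := if j \in codom k then `[z 0 j - rho, z 0 j + rho]%classic
    else [set z 0 j].
  have -> : C = [set w | forall j, A j (w ord0 j)].
    apply/seteqP; split => w /=.
      move=> [fw wz] j; rewrite /A; case: ifPn => jk; last exact: fw.
      rewrite /= in_itv/= -ler_distlC distrC.
      by have := le_trans (ler_mx_norm (w - z) 0 j) wz; rewrite !mxE.
    move=> Aw; split.
      by move=> j jk; have := Aw j; rewrite /A (negbTE jk).
    apply: mx_norm_le; first exact: ltW.
    move=> i j; rewrite (ord1 i) !mxE; have := Aw j; rewrite /A; case: ifPn => _ /=.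
      by rewrite in_itv/= -ler_distlC distrC.
    by move=> ->; rewrite subrr normr0 ltW.
  apply: rV_compact => j; rewrite /A; case: ifP => _; last exact: compact_set1.
  exact: segment_compact.
have Cz : C z by split; [by []|rewrite subrr normr0 ltW].
have [w [[fw wz] wy wle]] : exists w, [/\ C w, Delta w = y &
    `|w - z| <= 2 * L * `|y - Delta z|].
  apply: (solution_by_descent cC Cz L0 _ _ small).
    by move=> w [fw wz]; apply: Delta_continuous; exact: (fib w fw wz).1.
  move=> w [fw wz] wrho; have [Dw Lw] := fib w fw wz.
  pose d := lift_cV (invmx (J w) *m (y - Delta w)).
  exists d; split.
  - have d1 : 0 < `|d| + 1 by rewrite ltr_pwDr.
    exists ((rho - `|w - z|) / (`|d| + 1)); first by rewrite divr_gt0 ?subr_gt0.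
    move=> t t0; rewrite ltr_pdivlMr// => tr; split.
      move=> j jk; have := fw j jk; have := lift_cV_off (invmx (J w) *m (y - Delta w)) jk.
      by rewrite -/d => d0 wz0; rewrite [LHS]mxE [X in X + _]mxE d0 mulr0 add0r.
    rewrite -addrA (le_trans (ler_normD _ _))// normrZ gtr0_norm//.
    by move: tr; rewrite mulrDr mulr1; lra.
  - have := is_derive_lift_cV (invmx (J w) *m (y - Delta w)) Dw.
    by rewrite mulKVmx// J_unit.
  - by rewrite (le_trans (norm_lift_cV_le _)).
have [Dw _] := fib w fw wz.
by exists w.
Qed.

Lemma norm_mulmx_le r c (A : 'M[R]_(r, c)) (v : 'cV[R]_c) :
  `|A *m v| <= (\sum_i \sum_l `|A i l|) * `|v|.
Proof.
apply: mx_norm_le => [|i j].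
  by rewrite mulr_ge0// sumr_ge0// => i _; rewrite sumr_ge0.
rewrite mxE (le_trans (ler_norm_sum _ _ _))//.
rewrite (bigD1 i)//= mulrDl ler_wpDr//.
  by rewrite mulr_ge0// sumr_ge0// => i' _; rewrite sumr_ge0.
rewrite mulr_suml ler_sum// => l _; rewrite normrM ler_wpM2l//.
exact: ler_mx_norm.
Qed.

Hypothesis Delta_inj : forall z w, D z -> D w -> same_fibre z w ->
  Delta z = Delta w -> z = w.
Hypothesis Ji_continuous : forall i l z, D z ->
  {for z, continuous (fun w => invmx (J w) i l)}.

Lemma Delta_estimate w e : D w -> 0 < e -> exists2 r, 0 < r &
  forall h : 'rV[R]_N, `|h| < r -> forall i,
  `|Delta (h + w) i 0 - Delta w i 0 - \sum_j h 0 j * 'D_(e_ j) (fun z => Delta z i 0) w|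
    <= e * `|h|.
Proof.
move=> Dw e0.
have Hi i : \forall h \near (0 : 'rV[R]_N),
  `|Delta (h + w) i 0 - Delta w i 0 - \sum_j h 0 j * 'D_(e_ j) (fun z => Delta z i 0) w|
    <= e * `|h|.
  apply: (C1_estimate (f := fun z => Delta z i 0) (d := fun j => 'D_(e_ j) (fun z => Delta z i 0))) => //.
    have := near_open oD Dw; apply: filterS => y Dy j.
    exact: tempered_is_derive (Delta1 i).
  by move=> j; exact: (tempered_continuous (tempered_derive j (Delta1 i))).
have [r r0 Hr] := near_radius_forall Hi.
by exists r => // h hr; apply: Hr; rewrite subr0.
Qed.

(** Move the solution at t0 to the fibre of b t and solve there for the right
    hand side y t: the solution found is close to la t0, and it equals la t by
    injectivity. *)
Lemma solution_lipschitz (T : topologicalType) (O : set T) (b : T -> 'rV[R]_N)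
    (y : T -> 'cV[R]_s) (la : T -> 'rV[R]_N) (t0 : T) :
  open O -> O t0 -> {for t0, continuous b} -> {for t0, continuous y} ->
  (forall t, O t -> [/\ D (la t), same_fibre (b t) (la t) & Delta (la t) = y t]) ->
  exists2 C, 0 <= C & \forall t \near t0,
    `|la t - la t0| <= C * (`|b t - b t0| + `|y t - y t0|).
Proof.
move=> oO Ot0 cb cy laP; have [D0 f0 y0] := laP _ Ot0.
pose L : R := \sum_i \sum_l (`|invmx (J (la t0)) i l| + 1) + 1.
have L0 : 0 < L.
  by rewrite ltr_wpDl// sumr_ge0// => i _; rewrite sumr_ge0// => l _; rewrite addr_ge0.
pose M : R := \sum_i \sum_j `|'D_(e_ j) (fun z => Delta z i 0) (la t0)| + 1.
have M0 : 0 <= M.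
  by rewrite addr_ge0// sumr_ge0// => i _; rewrite sumr_ge0.
have [r r0 rP] : exists2 r, 0 < r & forall w, `|w - la t0| < r -> [/\ D w,
    forall c : 'cV[R]_s, `|invmx (J w) *m c| <= L * `|c| &
    `|Delta w - Delta (la t0)| <= M * `|w - la t0|].
  have H1 il : \forall w \near la t0,
      `|invmx (J (la t0)) il.1 il.2 - invmx (J w) il.1 il.2| <= 1.
    exact: (continuous_near (@Ji_continuous il.1 il.2 _ D0) ltr01).
  have [r1 r10 H1r] := near_radius_forall H1.
  have [r2 r20 H2r] := near_radius (near_open oD D0).
  have [r3 r30 H3r] := Delta_estimate D0 ltr01.
  exists (Num.min r1 (Num.min r2 r3)); first by rewrite !lt_min r10 r20.
  move=> w; rewrite !lt_min => /and3P[w1 w2 w3]; split.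
  - exact: H2r.
  - move=> c; rewrite (le_trans (norm_mulmx_le _ _))// ler_wpM2r//.
    rewrite ler_wpDr// ler_sum// => i _; rewrite ler_sum// => l _.
    have /= := H1r w w1 (i, l); rewrite distrC => /(le_trans (lerB_dist _ _)).
    by rewrite lerBlDl addrC.
  - apply: mx_norm_le => [|i j]; first by rewrite mulr_ge0.
    rewrite (ord1 j) mxE [X in _ + X]mxE; have := H3r _ w3 i.
    rewrite subrK mul1r => /(le_trans (lerB_dist _ _)).
    rewrite lerBlDl => /le_trans; apply.
    rewrite /M mulrDl mul1r lerD2r (le_trans (ler_norm_sum _ _ _))//.
    rewrite (bigD1 i)//= mulrDl ler_wpDr//.
      by rewrite mulr_ge0// sumr_ge0// => i' _; rewrite sumr_ge0.
    rewrite mulr_suml ler_sum// => l _; rewrite normrM mulrC ler_wpM2l//.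
    exact: ler_mx_norm.
pose off (z : 'rV[R]_N) : 'rV[R]_N :=
  \row_j if j \in codom k then (la t0) 0 j else z 0 j.
have off_b t : `|off (b t) - la t0| <= `|b t - b t0|.
  apply: mx_norm_le => // i j; rewrite (ord1 i) !mxE; case: ifPn => jk.
    by rewrite subrr normr0.
  by rewrite f0//; have := ler_mx_norm (b t - b t0) 0 j; rewrite !mxE.
exists (2 * L + 2 * L * M + 1); first by rewrite !addr_ge0// ?mulr_ge0// ltW.
(* Chosen so that 2 L |y t - Delta (off (b t))| < r / 2: the ball of radius r /
   2 around off (b t) lies in that of radius r around la t0. *)
pose c := Num.min (r / 2) (r / 2 / (2 * L + 2 * L * M)).
have LM0 : 0 < 2 * L + 2 * L * M by rewrite ltr_wpDr ?mulr_ge0 ?mulr_gt0// ltW.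
have c0 : 0 < c by rewrite lt_min !divr_gt0.
have cb' : \forall t \near t0, `|b t0 - b t| < c by exact: (cvgrPdist_lt _ _).1 cb _ c0.
have cy' : \forall t \near t0, `|y t0 - y t| < c by exact: (cvgrPdist_lt _ _).1 cy _ c0.
near=> t.
have Ot : O t by near: t; exact: near_open.
have bt : `|b t - b t0| < c by rewrite distrC; near: t.
have yt : `|y t - y t0| < c by rewrite distrC; near: t.
have [Dt ft Et] := laP _ Ot.
move: bt yt; rewrite !lt_min => /andP[bt1 bt2] /andP[yt1 yt2].
have r20 : 0 < r / 2 by rewrite divr_gt0.
have near_off w : `|w - off (b t)| <= r / 2 -> `|w - la t0| < r.
  move=> w1; rewrite -(subrK (off (b t)) w) -addrA (le_lt_trans (ler_normD _ _))//.
  by have := off_b t; lra.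
have off_r : `|off (b t) - la t0| < r by apply: near_off; rewrite subrr normr0 ltW.
have [Do _ Mo] := rP _ off_r.
have yo : `|y t - Delta (off (b t))| <= `|y t - y t0| + M * `|b t - b t0|.
  rewrite -(subrK (y t0) (y t)) -addrA (le_trans (ler_normD _ _))// lerD//.
    by rewrite subrK.
  by rewrite distrC -y0 (le_trans Mo)// ler_wpM2l.
have L20 : 0 <= 2 * L by rewrite mulr_ge0// ltW.
have LyM : 2 * L * `|y t - Delta (off (b t))| <=
    2 * L * (`|y t - y t0| + M * `|b t - b t0|) by rewrite ler_wpM2l.
have small : 2 * L * `|y t - Delta (off (b t))| < r / 2.
  apply: (le_lt_trans LyM); rewrite mulrDr mulrA.
  apply: (@lt_le_trans _ _ ((2 * L + 2 * L * M) * (r / 2 / (2 * L + 2 * L * M)))).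
    set c' := r / 2 / _ in bt2 yt2 *.
    have A1 : 2 * L * `|y t - y t0| < 2 * L * c' by rewrite ltr_pM2l// mulr_gt0.
    have A2 : 2 * L * M * `|b t - b t0| <= 2 * L * M * c'.
      by rewrite ler_wpM2l ?(ltW bt2)// mulr_ge0.
    by rewrite [ltRHS]mulrDl; lra.
  by rewrite mulrC divfK// gt_eqF.
have fib w : same_fibre (off (b t)) w -> `|w - off (b t)| <= r / 2 ->
    D w /\ forall c : 'cV[R]_s, `|invmx (J w) *m c| <= L * `|c|.
  by move=> _ w1; have [? ? _] := rP w (near_off _ w1).
have [w [Dw fw yw wo]] := fibre_solution Do r20 L0 fib small.
have -> : la t = w.
  apply: Delta_inj => //; last by rewrite Et.
  by move=> j jk; rewrite fw// ft// mxE (negbTE jk).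
rewrite -(subrK (off (b t)) w) -addrA (le_trans (ler_normD _ _))//.
rewrite (le_trans (lerD wo (off_b t)))//.
have H1 : 0 <= 2 * L * `|b t - b t0| by rewrite mulr_ge0.
have H2 : 0 <= 2 * L * M * `|y t - y t0| by rewrite mulr_ge0// mulr_ge0.
have H3 : 0 <= `|y t - y t0| by [].
move: LyM H1 H2 H3; rewrite mulrDr; lra.
Unshelve. all: by end_near. Qed.

Lemma solution_continuous (T : topologicalType) (O : set T) (b : T -> 'rV[R]_N)
    (y : T -> 'cV[R]_s) (la : T -> 'rV[R]_N) (t0 : T) :
  open O -> O t0 -> {for t0, continuous b} -> {for t0, continuous y} ->
  (forall t, O t -> [/\ D (la t), same_fibre (b t) (la t) & Delta (la t) = y t]) ->
  {for t0, continuous la}.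
Proof.
move=> oO Ot0 cb cy laP; have [C C0 lip] := solution_lipschitz oO Ot0 cb cy laP.
apply/cvgrPdist_le => eps eps0.
have C1 : 0 < C + 1 by rewrite ltr_wpDl.
have d0 : 0 < eps / (C + 1) / 2 by rewrite !divr_gt0.
have nb := continuous_near cb d0; have ny := continuous_near cy d0.
near=> t.
have H1 : `|b t0 - b t| <= eps / (C + 1) / 2 by near: t.
have H2 : `|y t0 - y t| <= eps / (C + 1) / 2 by near: t.
have H3 : `|la t - la t0| <= C * (`|b t - b t0| + `|y t - y t0|) by near: t.
rewrite distrC (le_trans H3)// distrC [X in _ + X]distrC.
rewrite (@le_trans _ _ ((C + 1) * (eps / (C + 1))))//; last by rewrite mulrC divfK// gt_eqF.
by rewrite ler_pM ?addr_ge0 ?lerDl//; lra.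
Unshelve. all: by end_near. Qed.

(** Implicit differentiation of Delta (la e) = y e. The difference quotients of
    la outside the fibre directions are those of b; inserting them in the first
    order expansion of Delta, whose error is o(t) thanks to the Lipschitz
    bound, and applying J(la e0)^-1 gives those along the fibre. *)
Lemma is_derive_solution (V : normedModType R) (O : set V) (b : V -> 'rV[R]_N)
    (y : V -> 'cV[R]_s) (la : V -> 'rV[R]_N) e0 v (u : 'rV[R]_N) (dy : 'cV[R]_s) :
  open O -> O e0 -> {for e0, continuous b} -> {for e0, continuous y} ->
  (forall e, O e -> [/\ D (la e), same_fibre (b e) (la e) & Delta (la e) = y e]) ->
  is_derive e0 v b u -> is_derive e0 v y dy ->
  let uo := \row_j if j \in codom k then 0 else u 0 j in
  let c := invmx (J (la e0)) *m \col_i (dy i 0 -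
      \sum_j uo 0 j * 'D_(e_ j) (fun z => Delta z i 0) (la e0)) in
  is_derive e0 v la (uo + lift_cV c).
Proof.
move=> oO Oe cb cy laP db dy_ uo c; have [D0 f0 y0] := laP _ Oe.
have [C C0 lip] := solution_lipschitz oO Oe cb cy laP.
have [r1 r10 lipr] := near_radius lip.
have [r2 r20 Or] := near_radius (near_open oO Oe).
pose h t := la (t *: v + e0) - la e0.
pose B := C * (`|u| + `|dy| + 2).
have B0 : 0 <= B by rewrite mulr_ge0// !addr_ge0.
have [r r0 rP] : exists2 r, 0 < r & forall t : R, `|t| < r -> t != 0 ->
    O (t *: v + e0) /\ `|h t| <= B * `|t|.
  have [r3 r30 b3] := derive_estimate db ltr01.
  have [r4 r40 y4] := derive_estimate dy_ ltr01.
  have v1 : 0 < `|v| + 1 by rewrite ltr_pwDr.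
  exists (Num.min (Num.min r1 r2 / (`|v| + 1)) (Num.min r3 r4)).
    by rewrite !lt_min divr_gt0 ?lt_min ?r10 ?r30.
  move=> t; rewrite !lt_min ltr_pdivlMr// lt_min => /andP[/andP[t1 t2] /andP[t3 t4]] t0.
  have tv : `|t *: v + e0 - e0| <= `|t| * (`|v| + 1).
    by rewrite addrK normrZ ler_wpM2l// lerDl.
  split; first by apply: Or; exact: le_lt_trans tv t2.
  rewrite (le_trans (lipr _ (le_lt_trans tv t1)))// /B -mulrA ler_wpM2l//.
  have tt0 : 0 < `|t| by rewrite normr_gt0.
  have bound (W : normedModType R) (x d : W) : `|t^-1 *: x - d| <= 1 -> `|x| <= (`|d| + 1) * `|t|.
    move=> xd; rewrite -ler_pdivrMr// mulrC -normfV -normrZ.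
    by rewrite -(subrK d (_ *: x)) (le_trans (ler_normD _ _))// addrC lerD2l.
  have := bound _ _ _ (b3 t t3 t0); have := bound _ _ _ (y4 t t4 t0).
  by rewrite !mulrDl; lra.
(* The error of the first order expansion of Delta, divided by t. *)
pose rho t i := t^-1 * (Delta (h t + la e0) i 0 - Delta (la e0) i 0 -
  \sum_j h t 0 j * 'D_(e_ j) (fun z => Delta z i 0) (la e0)).
have rho0 i : (fun t => rho t i) @ (0 : R)^' --> (0 : R).
  apply/cvgrPdist_le => e epos.
  have e'0 : 0 < e / (B + 1) by rewrite divr_gt0// ltr_wpDl.
  have [r3 r30 r3P] := Delta_estimate D0 e'0.
  have B1 : 0 < B + 1 by rewrite ltr_wpDl.
  have m0 : 0 < Num.min r (r3 / (B + 1)) by rewrite lt_min r0 divr_gt0.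
  exists (Num.min r (r3 / (B + 1))) => //= t.
  rewrite /ball_/= sub0r normrN lt_min ltr_pdivlMr// => /andP[tr tr3] t0.
  have [_ ht] := rP t tr t0.
  have ht' : `|h t| <= (B + 1) * `|t| by rewrite (le_trans ht)// ler_wpM2r// lerDl.
  rewrite sub0r normrN /rho normrM normfV ler_pdivrMl ?normr_gt0//.
  rewrite (le_trans (r3P (h t) _ i))//; first by rewrite (le_lt_trans ht')// mulrC.
  by rewrite (le_trans (ler_wpM2l (ltW e'0) ht'))// mulrA divfK ?gt_eqF// mulrC.
pose U t j : R := if j \in codom k then 0 else t^-1 * (b (t *: v + e0) 0 j - b e0 0 j).
have Ucvg j : (fun t => U t j) @ (0 : R)^' --> uo 0 j.
  rewrite mxE; rewrite /U; case: ifP => _; first exact: cvg_cst.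
  have [dbx <-] := db; rewrite derive_mx// mxE.
  exact: (iffLR (derivable_mxP _ _ _) dbx 0 j).
pose Y t i : R := t^-1 * (y (t *: v + e0) i 0 - y e0 i 0).
have Ycvg i : (fun t => Y t i) @ (0 : R)^' --> dy i 0.
  have [dyx <-] := dy_; rewrite derive_mx// mxE.
  exact: (iffLR (derivable_mxP _ _ _) dyx i 0).
pose c_ t : 'cV[R]_s := invmx (J (la e0)) *m \col_i (Y t i -
      \sum_j U t j * 'D_(e_ j) (fun z => Delta z i 0) (la e0) - rho t i).
have c_cvg i : (fun t => c_ t i 0) @ (0 : R)^' --> c i 0.
  rewrite mxE; under eq_fun do rewrite mxE.
  apply: cvg_big => [|l _]; first exact: add_continuous.
  apply: cvgM; first exact: cvg_cst.
  rewrite mxE; under eq_fun do rewrite mxE.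
  have rho0' := rho0 l; rewrite -[_ l 0 - _]subr0; apply: cvgB; last exact: rho0'.
  apply: cvgB; first exact: Ycvg.
  apply: cvg_big => [|j _]; first exact: add_continuous.
  by apply: cvgM; [exact: Ucvg|exact: cvg_cst].
have main : \forall t \near (0 : R)^', forall j, t^-1 *: (la (t *: v + e0) 0 j - la e0 0 j) =
    U t j + lift_cV (c_ t) 0 j.
  exists r => //= t; rewrite /ball_/= sub0r normrN => tr t0 j.
  have [Ot _] := rP t tr t0; have [Dt ft Et] := laP _ Ot.
  have [/codomP[i ->]|jk] := boolP (j \in codom k); last first.
    by rewrite /U (negbTE jk) lift_cV_off// addr0 ft// f0.
  rewrite lift_cV_k /U codom_f add0r.
  suff -> : c_ t = \col_l (t^-1 * h t 0 (k l)) by rewrite mxE /h !mxE.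
  set c' := \col_l _; rewrite -[RHS](mulKmx (J_unit D0)) /c_; congr (_ *m _).
  have hU j' : t^-1 * h t 0 j' = U t j' + lift_cV c' 0 j'.
    have [/codomP[l ->]|jk] := boolP (j' \in codom k).
      by rewrite lift_cV_k [c' _ _]mxE /U codom_f add0r.
    by rewrite /U (negbTE jk) lift_cV_off// addr0 /h !mxE ft// f0.
  apply/matrixP => l m; rewrite (ord1 m) J_mul_lift_cV mxE /rho subrK Et y0.
  rewrite mulrBr -/(Y t l) mulr_sumr.
  under [X in _ - (_ - X)]eq_bigr do rewrite mulrA hU mulrDl.
  rewrite big_split/=.
  move: (Y t l) (\sum_(j' < N) U t j' * _) (\sum_(j' < N) lift_cV c' 0 j' * _).
  by move=> A1 A2 A3; ring.
apply: is_derive_mx => i j; rewrite (ord1 i).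
suff H : (fun t => t^-1 *: (la (t *: v + e0) 0 j - la e0 0 j)) @ (0 : R)^' -->
    (uo + lift_cV c) 0 j.
  by split; [apply/cvg_ex; exists ((uo + lift_cV c) 0 j)|exact: cvg_lim H].
have H : (fun t => U t j + lift_cV (c_ t) 0 j) @ (0 : R)^' --> (uo + lift_cV c) 0 j.
  rewrite [X in _ --> X]mxE; apply: cvgD; first exact: Ucvg.
  have [/codomP[l ->]|jk] := boolP (j \in codom k).
    rewrite lift_cV_k; under eq_fun do rewrite lift_cV_k.
    exact: c_cvg.
  rewrite lift_cV_off//; under eq_fun do rewrite lift_cV_off//.
  exact: cvg_cst.
apply: cvg_trans H; apply: near_eq_cvg.
by apply: filterS main => t Ht; rewrite Ht.
Qed.

(** The derivative of la is a combination of derivatives of b and y with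
    coefficients that are tempered functions of la, so that all orders follow
    by induction from the growth of la itself. *)
Lemma tempered_solution a (O K1 : set 'rV[R]_a) (B1 : pred 'I_a)
    (K2 : set 'rV[R]_N) (b : 'rV[R]_a -> 'rV[R]_N) (y : 'rV[R]_a -> 'cV[R]_s)
    (la : 'rV[R]_a -> 'rV[R]_N) :
  open O ->
  (forall n j, tempered n O K1 B1 (fun e => b e 0 j)) ->
  (forall n i, tempered n O K1 B1 (fun e => y e i 0)) ->
  (forall n i, tempered n D K2 predT (fun z => Delta z i 0)) ->
  (forall n i l, tempered n D K2 predT (fun z => invmx (J z) i l)) ->
  (forall e, O e -> [/\ D (la e), same_fibre (b e) (la e) & Delta (la e) = y e]) ->
  (forall e, O e -> K1 e -> K2 (la e)) ->
  (forall j, growth O K1 (fun e => la e 0 j)) ->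
  forall n j, tempered n O K1 B1 (fun e => la e 0 j).
Proof.
move=> oO bT yT DeltaT JiT laP laK lag.
have bc e : O e -> {for e, continuous b}.
  move=> Oe; apply: continuous_mx => i j; rewrite (ord1 i).
  exact: (tempered_continuous (bT 0%N j) Oe).
have yc e : O e -> {for e, continuous y}.
  move=> Oe; apply: continuous_mx => i j; rewrite (ord1 j).
  exact: (tempered_continuous (yT 0%N i) Oe).
pose uo i e : 'rV[R]_N :=
  \row_j if j \in codom k then 0 else 'D_(e_ i) (fun e => b e 0 j) e.
pose c i e : 'cV[R]_s := invmx (J (la e)) *m \col_l ('D_(e_ i) (fun e => y e l 0) e -
      \sum_j uo i e 0 j * 'D_(e_ j) (fun z => Delta z l 0) (la e)).
have dla i j e : O e -> is_derive e (e_ i) (fun e => la e 0 j)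
    ((uo i e + lift_cV (c i e)) 0 j).
  move=> Oe; apply: is_derive_entry.
  have db : is_derive e (e_ i) b (\row_j 'D_(e_ i) (fun e => b e 0 j) e).
    apply: is_derive_mx => i' j'; rewrite (ord1 i') mxE.
    exact: (tempered_is_derive i Oe (bT 1%N j')).
  have dy : is_derive e (e_ i) y (\col_l 'D_(e_ i) (fun e => y e l 0) e).
    apply: is_derive_mx => i' j'; rewrite (ord1 j') mxE.
    exact: (tempered_is_derive i Oe (yT 1%N i')).
  have := is_derive_solution oO Oe (bc e Oe) (yc e Oe) laP db dy.
  congr (is_derive _ _ _ _); congr (_ + lift_cV _).
    by apply/rowP => j'; rewrite !mxE.
  congr (_ *m _); apply/colP => l; rewrite !mxE; congr (_ - _).
  by apply: eq_bigr => j' _; rewrite !mxE.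
have lac j e : O e -> {for e, continuous (fun e => la e 0 j)}.
  move=> Oe; exact: (continuous_comp (solution_continuous oO Oe (bc e Oe) (yc e Oe) laP)
    (@coord_continuous _ _ _ 0 j _)).
elim=> [|n IH] j; first by split => //; exact: lac.
apply: (temperedS oO (lac j) (lag j) (fun i x => @dla i j x)) => i.
have uoT j' : tempered n O (if B1 i then K1 else set0) B1 (fun e => uo i e 0 j').
  have [jk|jk] := boolP (j' \in codom k).
    apply: tempered_eq (tempered_cst _ _ _ 0 oO) => // x _.
    by rewrite mxE jk.
  apply: tempered_eq (tempered_derive i (bT n.+1 j')) => // x _.
  by rewrite mxE (negbTE jk).
have compT f : tempered n D K2 predT f ->
    tempered n O (if B1 i then K1 else set0) B1 (fun e => f (la e)).
  move=> fT; apply: tempered_if.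
  apply: (tempered_comp (D2 := D) (K2 := K2) (B2 := predT) (f := f)) => //.
  by move=> x /laP[].
apply: tempered_eq (_ : tempered n O _ B1 (fun e => uo i e 0 j +
   \sum_(l | k l == j) c i e l 0)) => //.
  by move=> e _; rewrite !mxE.
apply: temperedD => //; apply: tempered_sum => // l _.
apply: tempered_eq (_ : tempered n O _ B1 (fun e => \sum_l' invmx (J (la e)) l l' *
   ('D_(e_ i) (fun e => y e l' 0) e -
      \sum_j uo i e 0 j * 'D_(e_ j) (fun z => Delta z l' 0) (la e)))) => //.
  by move=> e _; rewrite mxE; apply: eq_bigr => l' _; rewrite !mxE.
apply: tempered_sum => // l' _; apply: temperedM => //.
  exact: (compT (fun z => invmx (J z) l l')).
apply: temperedB => //; first exact: (tempered_derive i (yT n.+1 l')).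
apply: tempered_sum => // j' _; apply: temperedM => //.
apply: (compT ('D_(e_ j') (fun z => Delta z l' 0))).
exact: (tempered_derive j' (DeltaT n.+1 l')).
Qed.

End ImplicitFunction.

(** * Integrals over the unit interval depending on parameters *)

Section UnitIntegral.
Variable R : realType.
Local Notation e_ i := (coord_vec R i).
Local Notation mu := (@lebesgue_measure R).

Definition unit_integral (f : R -> R) : R := (\int[mu]_(t in `[0%R, 1%R]) f t)%R.

Definition unit_continuous (f : R -> R) := {within `[0%R, 1%R], continuous f}.

Lemma unit_integrable f : unit_continuous f ->
  mu.-integrable `[0%R, 1%R] (EFin \o f).
Proof.
by move=> cf; apply: continuous_compact_integrable => //; exact: segment_compact.
Qed.

Lemma unit_integral_norm_le f c : unit_continuous f ->
  (forall t : R, 0 <= t <= 1 -> `|f t| <= c) -> `|unit_integral f| <= c.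
Proof.
move=> cf fc; have m01 : measurable (`[0%R, 1%R]%classic : set R) by [].
rewrite (le_trans (le_normr_Rintegral _ (unit_integrable cf)))//.
have -> : c = unit_integral (cst c).
  by rewrite /unit_integral Rintegral_cst//= lebesgue_measure_itv/= lte_fin ltr01 oppr0 adde0 mulr1.
apply: le_Rintegral => //.
- apply: (unit_integrable (f := fun t => `|f t|)).
  by move=> t; apply: cvg_norm; exact: cf.
- by apply: (unit_integrable (f := cst c)) => t; exact: cst_continuous.
Qed.

Lemma unit_integralB f g : unit_continuous f -> unit_continuous g ->
  unit_integral (fun t => f t - g t) = unit_integral f - unit_integral g.
Proof. by move=> cf cg; apply: RintegralB => //; exact: unit_integrable. Qed.

Lemma unit_integralD f g : unit_continuous f -> unit_continuous g ->
  unit_integral (fun t => f t + g t) = unit_integral f + unit_integral g.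
Proof. by move=> cf cg; apply: RintegralD => //; exact: unit_integrable. Qed.

Lemma unit_integralZ f c : unit_continuous f ->
  unit_integral (fun t => f t * c) = unit_integral f * c.
Proof. by move=> cf; apply: RintegralZr => //; exact: unit_integrable. Qed.

Lemma unit_integral_sumZ (I : finType) (f : I -> R -> R) (c : I -> R) :
  (forall i, unit_continuous (f i)) ->
  unit_continuous (fun t => \sum_i f i t * c i) /\
  unit_integral (fun t => \sum_i f i t * c i) = \sum_i unit_integral (f i) * c i.
Proof.
move=> cf.
suff H : forall r : seq I, unit_continuous (fun t => \sum_(i <- r) f i t * c i) /\
  unit_integral (fun t => \sum_(i <- r) f i t * c i) = \sum_(i <- r) unit_integral (f i) * c i.
  exact: (H (index_enum I)).
elim=> [|i r [IHc IH]].
  under [in unit_integral _]eq_fun do rewrite big_nil.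
  under eq_fun do rewrite big_nil.
  rewrite big_nil; split; first by move=> t; exact: cvg_cst.
  by rewrite /unit_integral Rintegral_cst//= mul0r.
have cfi : unit_continuous (fun t => f i t * c i).
  by move=> t; apply: cvgM; [exact: cf|exact: cvg_cst].
under [in unit_integral _]eq_fun do rewrite big_cons.
under eq_fun do rewrite big_cons.
rewrite big_cons; split; first by move=> t; apply: cvgD; [exact: cfi|exact: IHc].
by rewrite unit_integralD// unit_integralZ// IH.
Qed.

Lemma unit_FTC (f df : R -> R) : (forall t : R, 0 <= t <= 1 -> is_derive t (1 : R) f (df t)) ->
  unit_continuous df -> unit_integral df = f 1 - f 0.
Proof.
move=> fd cdf.
have fc (t : R) : 0 <= t <= 1 -> {for t, continuous f}.
  by move=> /fd[dft _]; apply/differentiable_continuous/derivable1_diffP.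
have := @continuous_FTC2 R df f 0 1 ltr01 cdf.
rewrite /unit_integral /Rintegral => ->//.
- split.
  + by move=> t; rewrite in_itv/= => /andP[t0 t1]; case: (fd t) => //; rewrite !ltW.
  + by apply: cvg_at_right_filter; apply: fc; rewrite lexx ler01.
  + by apply: cvg_at_left_filter; apply: fc; rewrite lexx ler01.
- move=> t; rewrite in_itv/= => /andP[t0 t1]; rewrite derive1E.
  by case: (fd t) => //; rewrite !ltW.
Qed.

Variable a : nat.

Definition with_time (t : R) (e : 'rV[R]_a) : 'rV[R]_(1 + a) := row_mx (const_mx t) e.

Lemma with_time_affine t c (u w : 'rV[R]_a) :
  with_time t (c *: u + w) = c *: (row_mx 0 u) + with_time t w.
Proof. by rewrite /with_time scale_row_mx add_row_mx scaler0 add0r. Qed.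

Lemma rsubmx_with_time t (e : 'rV[R]_a) : rsubmx (with_time t e) = e.
Proof. exact: row_mxKr. Qed.

Lemma with_time_dist t t' e e' r : `|t - t'| < r -> `|e - e'| < r ->
  `|with_time t e - with_time t' e'| < r.
Proof.
move=> tr er; rewrite /with_time opp_row_mx add_row_mx.
rewrite (@le_lt_trans _ _ (Num.max `|t - t'| `|e - e'|)) ?gt_max ?tr//.
apply: mx_norm_le; first by rewrite le_max normr_ge0.
move=> i j; rewrite mxE le_max; case: fintype.split => l.
  by rewrite !mxE lexx.
by rewrite ler_mx_norm orbT.
Qed.

(** Compactness of the unit interval. *)
Lemma uniform_in_time (O : set 'rV[R]_(1 + a)) (g : 'rV[R]_(1 + a) -> R) e0 eps :
  open O -> (forall x, O x -> {for x, continuous g}) ->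
  (forall t : R, 0 <= t <= 1 -> O (with_time t e0)) -> 0 < eps ->
  exists2 r, 0 < r & forall e, `|e - e0| < r -> forall t, 0 <= t <= 1 ->
     `|g (with_time t e) - g (with_time t e0)| <= eps.
Proof.
move=> oO cg Oe0 eps0.
have := (iffLR (compact_near_coveringP _) (@segment_compact R 0 1)).
move=> /(_ _ (nbhs e0) (fun e t =>
  `|g (with_time t e) - g (with_time t e0)| <= eps)) H.
have {H} : \forall e \near e0, `[0%R, 1%R] `<=` (fun t =>
  `|g (with_time t e) - g (with_time t e0)| <= eps).
  apply: H => t0; rewrite /= in_itv/= => t01.
  have eps20 : 0 < eps / 2 by rewrite divr_gt0.
  have [r r0 rP] := near_radius (continuous_near (cg _ (Oe0 _ t01)) eps20).
  exists ([set t | `|t - t0| < r], [set e | `|e - e0| < r]).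
    split; apply/nbhs_ballP; exists r => //= y; by rewrite -ball_normE/= distrC.
  move=> [t e] /= [tr er].
  have H1 := rP _ (with_time_dist tr er).
  have e00 : `|e0 - e0| < r by rewrite subrr normr0.
  have H2 := rP _ (with_time_dist tr e00).
  rewrite -(subrK (g (with_time t0 e0)) (g (with_time t e))) -addrA.
  by rewrite (le_trans (ler_normD _ _))// (splitr eps) lerD// distrC.
move=> /near_radius[r r0 rP]; exists r => // e er t t01.
Qed.

Lemma with_time_continuous e : continuous (fun t => with_time t e).
Proof.
move=> t; apply/cvgrPdist_lt => eps eps0; near=> t'.
apply: with_time_dist; last by rewrite subrr normr0.
near: t'; exact: (cvgrPdist_lt _ _).1 (@cvg_id _ _) _ eps0.
Unshelve. all: by end_near. Qed.

Lemma unit_continuous_with_time (O : set 'rV[R]_(1 + a)) (g : 'rV[R]_(1 + a) -> R) e :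
  (forall x, O x -> {for x, continuous g}) ->
  (forall t : R, 0 <= t <= 1 -> O (with_time t e)) ->
  unit_continuous (fun t => g (with_time t e)).
Proof.
move=> cg Oe; apply: continuous_in_subspaceT => t /set_mem/=; rewrite in_itv/= => t01.
exact: (continuous_comp (@with_time_continuous e t) (cg _ (Oe _ t01))).
Qed.

(** Differentiation under the integral sign: by the mean value theorem the
    difference quotient in e is a value of the derivative nearby, and it
    converges uniformly in t. *)
Lemma tempered_unit_integral n (O K' : set 'rV[R]_(1 + a)) (B' : pred 'I_(1 + a))
    (D K : set 'rV[R]_a) (B : pred 'I_a) (g : 'rV[R]_(1 + a) -> R) :
  open O -> open D ->
  (forall e (t : R), D e -> 0 <= t <= 1 -> O (with_time t e)) ->
  (forall e (t : R), D e -> K e -> 0 <= t <= 1 -> K' (with_time t e)) ->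
  (forall i, B i -> B' (rshift 1 i)) ->
  tempered n O K' B' g ->
  tempered n D K B (fun e => unit_integral (fun t => g (with_time t e))).
Proof.
move=> oO oD DO KK' BB'.
have cgI m K'' h : tempered m O K'' B' h ->
  forall x, D x -> {for x, continuous (fun e => unit_integral (fun t => h (with_time t e)))}.
  move=> /tempered_continuous ch e0 De0; apply: continuous_radius => eps eps0.
  have [r r0 rP] := uniform_in_time oO ch (fun t => DO _ t De0) eps0.
  have [r' r'0 r'P] := near_radius (near_open oD De0).
  exists (Num.min r r'); first by rewrite lt_min r0.
  move=> e; rewrite lt_min => /andP[er er'].
  have De := r'P _ er'.
  rewrite distrC -unit_integralB; try exact: (unit_continuous_with_time ch (fun t => DO _ t _)).
  apply: unit_integral_norm_le; last exact: rP.
  move=> t; apply: cvgB; exact: (unit_continuous_with_time ch (fun t => DO _ t _)).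
have gI m K1 K1' h : (forall e (t : R), D e -> K1 e -> 0 <= t <= 1 -> K1' (with_time t e)) ->
    tempered m O K1' B' h ->
    growth D K1 (fun e => unit_integral (fun t => h (with_time t e))).
  move=> KK1 hT; have ch := tempered_continuous hT.
  have /growth_ge0[C C0 [k hC]] := tempered_growth hT.
  exists (C * 2 ^+ k), k => e De Ke; apply: unit_integral_norm_le.
    exact: (unit_continuous_with_time ch (fun t => DO _ t De)).
  move=> t t01; rewrite (le_trans (hC _ (DO _ _ De t01) (KK1 _ _ De Ke t01)))//.
  rewrite -mulrA ler_wpM2l// -exprMn lerXn2r ?nnegrE ?mulr_ge0 ?addr_ge0//.
  have H1 : `|with_time t e| <= `|const_mx t : 'rV[R]_1| + `|e| := norm_row_mx_le _ _.
  have H2 : `|const_mx t : 'rV[R]_1| <= 1.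
    by apply: mx_norm_le => // i j; rewrite mxE ger0_norm//; case/andP: t01.
  have H3 : 0 <= `|e| by [].
  lra.
elim: n K K' g KK' => [|n IH] K K' g KK' gT.
  by split; [exact: (cgI _ _ _ gT)|exact: (gI _ _ _ _ KK' gT)|].
pose d i e := unit_integral (fun t => 'D_(e_ (rshift 1 i)) g (with_time t e)).
apply: (temperedS oD (d := d)).
- exact: (cgI _ _ _ gT).
- exact: (gI _ _ _ _ KK' gT).
- move=> i e0 De0; have gd := tempered_derive (rshift 1 i) gT.
  have cg := tempered_continuous gT; have cgd := tempered_continuous gd.
  suff H : (fun c : R => c^-1 *: (unit_integral (fun t => g (with_time t (c *: e_ i + e0))) -
      unit_integral (fun t => g (with_time t e0)))) @ 0^' --> d i e0.
    by split; [apply/cvg_ex; exists (d i e0)|exact: cvg_lim H].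
  apply/cvgrPdist_le => eps eps0.
  have [r r0 rP] := uniform_in_time oO cgd (fun t => DO _ t De0) eps0.
  have [r' r'0 r'P] := near_radius (near_open oD De0).
  exists (Num.min r r'); first by rewrite /= lt_min r0.
  move=> c; rewrite /ball_/= sub0r normrN lt_min => /andP[cr cr'] c0.
  have near_e0 (c' : R) : `|c'| <= `|c| -> `|c' *: e_ i + e0 - e0| <= `|c|.
    move=> c'c; rewrite addrK normrZ (le_trans _ c'c)// ler_piMr//.
    by apply: mx_norm_le => // u v; rewrite !mxE; case: (_ && _); rewrite ?normr1 ?normr0.
  have Dc c' : `|c'| <= `|c| -> D (c' *: e_ i + e0).
    by move=> /near_e0 /le_lt_trans H; apply: r'P; exact: H.
  have ct e : D e -> unit_continuous (fun t => g (with_time t e)).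
    by move=> De; exact: (unit_continuous_with_time cg (fun t => DO _ t De)).
  have ctd e : D e -> unit_continuous (fun t => 'D_(e_ (rshift 1 i)) g (with_time t e)).
    by move=> De; exact: (unit_continuous_with_time cgd (fun t => DO _ t De)).
  have Dce := Dc c (lexx _).
  have cB : unit_continuous (fun t => g (with_time t (c *: e_ i + e0)) - g (with_time t e0)).
    by move=> t; apply: cvgB; [exact: ct|exact: ct].
  rewrite -unit_integralB; [|exact: ct|exact: ct].
  rewrite [_ *: _]mulrC -unit_integralZ// distrC /d -unit_integralB; [|move=> t|exact: ctd].
    apply: unit_integral_norm_le.
      move=> t; apply: cvgB; last exact: ctd.
      by apply: cvgM; [exact: cB|exact: cvg_cst].
    move=> t t01.
    have dl (c' : R) : `|c'| <= `|c| -> is_derive (c' *: e_ i + e0) (e_ i)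
        (fun e => g (with_time t e)) ('D_(e_ (rshift 1 i)) g (with_time t (c' *: e_ i + e0))).
      move=> c'c; have [gdx _] := tempered_is_derive (rshift 1 i) (DO _ _ (Dc _ c'c) t01) gT.
      split.
        apply/(derivable_comp_affine (L := fun u => row_mx 0 u) g _ _ (with_time_affine t)).
        by rewrite row_mx0_coord.
      by rewrite (derive_comp_affine (L := fun u => row_mx 0 u) g _ _ (with_time_affine t)) row_mx0_coord.
    have [c' c'c ->] := segment_MVT (df := fun e => 'D_(e_ (rshift 1 i)) g (with_time t e)) dl.
    rewrite mulrAC divff// mul1r; apply: rP => //.
    exact: le_lt_trans (near_e0 _ c'c) cr.
  by apply: cvgM; [exact: cB|exact: cvg_cst].
- move=> i; have := tempered_derive (rshift 1 i) gT.
  have [Bi|nBi] := boolP (B i); first by rewrite BB'//; exact: IH.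
  by move=> /tempered_set0; apply: IH.
Qed.

End UnitIntegral.

(** * Cutoff functions and smooth majorants *)

Section Cutoff.
Variable R : realType.
Local Notation e_ i := (coord_vec R i).

(** The functions t^-m exp(-1/t), extended by 0, form a family that is stable
    under differentiation, as [is_derive_flat] shows. *)
Definition flat m (t : R) : R := if 0 < t then t^-1 ^+ m * expR (- t^-1) else 0.

Lemma flat_ge0 m t : 0 <= flat m t.
Proof.
by rewrite /flat; case: ifP => // t0; rewrite mulr_ge0 ?expR_ge0// exprn_ge0// invr_ge0 ltW.
Qed.

Lemma flat_le m t : flat m t <= m`!%:R.
Proof.
rewrite /flat; case: ifP => [t0|_]; last by rewrite ler0n.
have s0 : 0 <= t^-1 by rewrite invr_ge0 ltW.
rewrite expRN ler_pdivrMr ?expR_gt0//.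
case: m => [|m]; first by rewrite expr0 fact0 mul1r (le_trans _ (expR_ge1Dx _))// lerDl.
rewrite mulrC -ler_pdivrMr ?ltr0n ?fact_gt0//.
by rewrite (le_trans _ (expR_ge1Dxn m s0))// lerDr.
Qed.

(** Near 0 this turns a bound for index m + 1 into decay for index m. *)
Lemma flatS m t : flat m t = t * flat m.+1 t.
Proof.
rewrite /flat; case: ifP => [t0|_]; last by rewrite mulr0.
by rewrite exprS !mulrA divff ?mul1r// gt_eqF.
Qed.

Lemma is_derive_flat m (t : R) :
  is_derive t (1 : R) (flat m) (- (m%:R * flat m.+1 t) + flat m.+2 t).
Proof.
have [t0|t0|->] := ltgtP t 0.
- have nt : \forall y \near t, (fun=> 0) y = flat m y.
    near=> y; rewrite /flat ltNge ltW//; near: y; exact: lt_nbhsl.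
  apply: (near_eq_is_derive nt).
  rewrite /flat ltNge (ltW t0)/= mulr0 oppr0 addr0; exact: is_derive_cst.
- have nt : \forall y \near t, y^-1 ^+ m * expR (- y^-1) = flat m y.
    near=> y; rewrite /flat ifT//; near: y; exact: lt_nbhsr.
  apply: (near_eq_is_derive nt).
  have t_neq0 : t != 0 by rewrite gt_eqF.
  have dV : is_derive t (1 : R) (fun y : R => y^-1) (- t ^- 2).
    split; first exact: (@derivableV _ _ id).
    by rewrite (@deriveV _ _ id)// derive_id /GRing.scale/= mulr1.
  have dX := is_deriveX m dV.
  have dN : is_derive t (1 : R) (fun y : R => - y^-1) (- - t ^- 2) := is_deriveN dV.
  have dE := @is_derive1_comp _ expR (fun y : R => - y^-1) t _ _ (is_derive_expR _) dN.
  have := is_deriveM dX dE.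
  rewrite exprfctE /GRing.scale/= opprK => H.
  apply: (is_derive_eq H); rewrite /flat t0.
  case: m {nt dX H} => [|m].
    by rewrite -!exprVn; ring.
  by rewrite /= -!exprVn !exprS; ring.
- have -> : - (m%:R * flat m.+1 0) + flat m.+2 0 = 0 :> R.
    by rewrite /flat ltxx mulr0 oppr0 addr0.
  suff H : (fun h : R => h^-1 *: (flat m (h *: 1 + 0) - flat m 0)) @ 0^' --> (0 : R).
    by split; [apply/cvg_ex; exists 0|exact: cvg_lim H].
  apply/cvgrPdist_le => e e0.
  have f0 : 0 < (m.+2)`!%:R :> R by rewrite ltr0n fact_gt0.
  exists (e / (m.+2)`!%:R); first by rewrite /= divr_gt0.
  move=> h; rewrite /ball_/= sub0r normrN ltr_pdivlMr// => he h0.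
  rewrite addr0 sub0r normrN /GRing.scale/= mulr1 [flat m 0]/flat ltxx subr0.
  rewrite flatS mulKf// flatS normrM (le_trans _ (ltW he))// ler_wpM2l//.
  by rewrite ger0_norm ?flat_ge0// flat_le.
Unshelve. all: by end_near. Qed.

(** One-variable calculus transferred to functions of a coordinate. *)
Lemma is_derive_coord_comp (f : R -> R) a (x : 'rV[R]_a) i j df :
  is_derive (x 0 j) (1 : R) f df ->
  is_derive x (e_ i) (fun y : 'rV[R]_a => f (y 0 j)) ((i == j)%:R * df).
Proof.
move=> dfx; have hL (c : R) (u w : 'rV[R]_a) : (c *: u + w) 0 j = c *: (u 0 j : R) + w 0 j.
  by rewrite !mxE.
have eij : (e_ i : 'rV[R]_a) 0 j = (i == j)%:R by rewrite mxE eq_sym.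
suff [? dE] : is_derive (x 0 j) ((e_ i : 'rV[R]_a) 0 j) f ((i == j)%:R * df).
  split; first exact/(derivable_comp_affine (L := fun u : 'rV_a => u 0 j) _ _ _ hL).
  by rewrite (derive_comp_affine (L := fun u : 'rV_a => u 0 j) f _ _ hL).
rewrite eij; case: (i == j) => /=; first by rewrite mul1r.
by rewrite mul0r; exact: is_derive0.
Qed.

(** All the functions of the family are bounded, so their derivatives are. *)
Lemma tempered_flat k m a D K B (j : 'I_a) : open D ->
  tempered k D K B (fun x : 'rV[R]_a => flat m (x 0 j)).
Proof.
move=> oD.
have gf m' K' : growth D K' (fun x : 'rV[R]_a => flat m' (x 0 j)).
  by exists m'`!%:R, 0%N => x _ _; rewrite expr0 mulr1 ger0_norm ?flat_ge0// flat_le.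
have cf m' x : D x -> {for x, continuous (fun x : 'rV[R]_a => flat m' (x 0 j))}.
  move=> _; have [df _] := is_derive_flat m' (x 0 j).
  apply: (continuous_comp (@coord_continuous _ _ _ 0 j x)).
  exact/differentiable_continuous/derivable1_diffP.
elim: k m K => [|k IH] m K; first by split => //; exact: cf.
apply: (temperedS (d := fun i x => (i == j)%:R *
  (- (m%:R * flat m.+1 (x 0 j)) + flat m.+2 (x 0 j)))) => //; first exact: cf.
  by move=> i x _; apply: is_derive_coord_comp; exact: is_derive_flat.
move=> i; apply: temperedZ => //; apply: temperedD => //.
apply: tempered_eq (temperedZ (- m%:R) oD (IH m.+1 _)) => // x _.
by rewrite mulNr.
Qed.

Definition cutoff (t : R) : R := flat 0 (2 - t) / (flat 0 (2 - t) + flat 0 (t - 1)).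

(** One of the two terms has its argument at least 1/2; a positive lower bound
    that is independent of t keeps the quotient tempered. *)
Lemma cutoff_denom_ge t : expR (- 2) <= flat 0 (2 - t) + flat 0 (t - 1).
Proof.
have flat_ge (u : R) : 1 / 2 <= u -> expR (- 2) <= flat 0 u.
  move=> u2; have u0 : 0 < u by lra.
  rewrite /flat u0 expr0 mul1r ler_expR lerN2 -[leRHS]invrK lef_pV2 ?posrE//.
  by rewrite -div1r.
have [t1|t1] := leP t (3 / 2).
  by rewrite ler_wpDr ?flat_ge0// flat_ge//; lra.
by rewrite ler_wpDl ?flat_ge0// flat_ge//; lra.
Qed.

Lemma cutoff_denom_gt0 t : 0 < flat 0 (2 - t) + flat 0 (t - 1).
Proof. by rewrite (lt_le_trans _ (cutoff_denom_ge t))// expR_gt0. Qed.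

Lemma cutoff_ge0 t : 0 <= cutoff t.
Proof. by rewrite mulr_ge0 ?flat_ge0// invr_ge0 ltW// cutoff_denom_gt0. Qed.

Lemma cutoff_le1 t : cutoff t <= 1.
Proof. by rewrite ler_pdivrMr ?cutoff_denom_gt0// mul1r lerDl flat_ge0. Qed.

Lemma cutoff_eq1 t : t <= 1 -> cutoff t = 1.
Proof.
move=> t1; have f0 : flat 0 (t - 1) = 0 by rewrite /flat ltNge subr_le0 t1.
have := cutoff_denom_gt0 t; rewrite /cutoff f0 addr0 => H.
by rewrite divff// gt_eqF.
Qed.

Lemma cutoff_eq0 t : 2 <= t -> cutoff t = 0.
Proof. by move=> t2; rewrite /cutoff [X in X / _]/flat ltNge subr_le0 t2/= mul0r. Qed.

Lemma tempered_cutoff k a D K B (g : 'rV[R]_a -> R) : open D ->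
  tempered k D K B g -> tempered k D K B (fun x => cutoff (g x)).
Proof.
move=> oD gT.
have comp1 (h : R -> R) (f : 'rV[R]_a -> R) : (forall n (E K' : set 'rV[R]_1) B', open E ->
    tempered n E K' B' (fun x => h (x 0 0))) -> tempered k D K B f ->
    tempered k D K B (fun x => h (f x)).
  move=> hT fT.
  apply: tempered_eq (@tempered_comp _ k _ _ D K setT setT B predT
    (fun x : 'rV[R]_1 => h (x 0 0)) (fun x => \row_j f x) oD openT _ _ _ _ (hT _ _ _ _ openT)) => //.
    by move=> x _; rewrite /= mxE.
  by move=> j; apply: tempered_eq fT => // x _; rewrite mxE.
have fl n (f : 'rV[R]_a -> R) : tempered k D K B f -> tempered k D K B (fun x => flat n (f x)).
  by apply: comp1 => ? E K' B' oE; exact: tempered_flat.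
have T1 : tempered k D K B (fun x => flat 0 (2 - g x)).
  by apply: (fl 0%N); apply: temperedB => //; exact: tempered_cst.
have T2 : tempered k D K B (fun x => flat 0 (g x - 1)).
  by apply: (fl 0%N); apply: temperedB => //; exact: tempered_cst.
apply: (temperedM oD T1); apply: temperedV => //.
- by move=> x _; rewrite gt_eqF// cutoff_denom_gt0.
- exists (expR 2), 0%N => x _ _; rewrite expr0 mulr1 normfV gtr0_norm ?cutoff_denom_gt0//.
  rewrite -[leRHS]invrK lef_pV2 ?posrE ?cutoff_denom_gt0 ?invr_gt0 ?expR_gt0//.
  by rewrite -expRN cutoff_denom_ge.
- exact: temperedD.
Qed.

End Cutoff.

Section Majorant.
Variable R : realType.
Variables p m : nat.
Implicit Types (z w : 'rV[R]_(p + m)).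

Lemma norm_le_1Dsqr a (z : 'rV[R]_a) : `|z| <= 1 + \sum_j z 0 j ^+ 2.
Proof.
apply: mx_norm_le => [|i j]; first by rewrite addr_ge0// sumr_ge0// => j _; rewrite sqr_ge0.
rewrite (ord1 i) (bigD1 j)//= addrA ler_wpDr ?sumr_ge0// => [l _|].
  by rewrite sqr_ge0.
rewrite -[z 0 j ^+ 2]real_normK ?num_real//.
have := sqr_ge0 (`|z 0 j| - 1); have := normr_ge0 (z 0 j); nra.
Qed.

(** An enumeration of the pairs made of a rational centre and a scale M: the
    cell has radius of the order of 1 / (M + 1). *)
Definition cell (i : nat) : 'rV[rat]_p * nat := odflt (0, 0%N) (unpickle i).
(** A squared Euclidean distance, hence a polynomial, scaled so that the values
    1 and 2 delimit the regions where the cutoff is 1 and 0. *)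
Definition cell_dist i z : R :=
  (cell i).2.+1%:R ^+ 2 * \sum_(j < p) (z 0 (lshift m j) - ratr ((cell i).1 0 j)) ^+ 2.
Definition cell_box i : set 'rV[R]_p :=
  [set x | forall j, ratr ((cell i).1 0 j) - 2 / (cell i).2.+1%:R <= x ord0 j
                     <= ratr ((cell i).1 0 j) + 2 / (cell i).2.+1%:R].

Lemma compact_cell_box i : compact (cell_box i).
Proof.
have := @rV_compact R p (fun j => `[ratr ((cell i).1 0 j) - 2 / (cell i).2.+1%:R,
  ratr ((cell i).1 0 j) + 2 / (cell i).2.+1%:R]%classic) (fun j => @segment_compact _ _ _).
congr compact; apply/seteqP; split => x /= H j; have := H j; by rewrite ?in_itv.
Qed.

Lemma cell_dist_box i z : cell_dist i z < 2 -> cell_box i (lsubmx z).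
Proof.
move=> zi j; rewrite mxE -ler_distlC distrC; set M := (cell i).2.+1%:R in zi *.
have M0 : 0 < M by rewrite ltr0n.
have M0' := ltW M0.
rewrite ler_pdivlMr// -ler_sqr ?nnegrE ?mulr_ge0// exprMn.
have : `|z 0 (lshift m j) - ratr ((cell i).1 0 j)| ^+ 2 * M ^+ 2 <= cell_dist i z.
  rewrite mulrC /cell_dist -/M ler_wpM2l ?sqr_ge0// real_normK ?num_real//.
  by rewrite (bigD1 j)//= lerDl sumr_ge0// => l _; rewrite sqr_ge0.
by move=> /le_trans; apply; rewrite (le_trans (ltW zi))// expr2; lra.
Qed.

Lemma tempered_cell_dist k (D K : set 'rV[R]_(p + m)) B i : open D ->
  tempered k D K B (cell_dist i).
Proof.
move=> oD; apply: temperedZ => //; apply: tempered_sum => // j _.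
by apply: temperedX => //; apply: temperedB => //; [exact: tempered_coord|exact: tempered_cst].
Qed.

(** Rational points are dense, so a sufficiently small cell with centre close
    to lsubmx z lies in X. *)
Lemma cell_cover (X : set 'rV[R]_p) z : open X -> X (lsubmx z) ->
  exists i, cell_dist i z < 1 /\ cell_box i `<=` X.
Proof.
move=> oX Xz; have [r r0 rP] := near_radius (near_open oX Xz).
have [M Mr] : exists M : nat, 3 / r < M.+1%:R.
  exists (Num.bound (3 / r)); rewrite (lt_trans (archi_boundP _))// ?divr_ge0 ?ltW//.
  by rewrite ltr_nat.
have M0 : 0 < M.+1%:R :> R by rewrite ltr0n.
pose d : R := (M.+1%:R * p.+1%:R)^-1.
have d0 : 0 < d by rewrite invr_gt0 mulr_gt0// ltr0n.
have c_ex j : exists q : rat, `|z 0 (lshift m j) - ratr q| < d.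
  have zd : z 0 (lshift m j) - d < z 0 (lshift m j) + d by lra.
  by have [q] := rat_in_itvoo zd; rewrite in_itv/= -ltr_distlC => qd; exists q.
have [c cP] := choice c_ex.
pose i := pickle ((\row_j c j, M) : 'rV[rat]_p * nat).
have ci : cell i = (\row_j c j, M) by rewrite /cell pickleK.
exists i; split.
  rewrite /cell_dist ci/=.
  apply: (@le_lt_trans _ _ (M.+1%:R ^+ 2 * \sum_(j < p) d ^+ 2)).
    rewrite ler_wpM2l ?sqr_ge0// ler_sum// => j _.
    rewrite mxE -[X in X <= _]real_normK ?num_real// ler_sqr ?nnegrE ?(ltW d0)//.
    exact: ltW.
  have cancel (x u v : R) : 0 < u -> 0 < v -> u ^+ 2 * (x * (u * v)^-1 ^+ 2) = x / v ^+ 2.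
    by move=> u0 v0; field; rewrite !gt_eqF.
  rewrite sumr_const card_ord -[_ *+ p]mulr_natl cancel ?ltr0n//.
  rewrite ltr_pdivrMr ?exprn_gt0 ?ltr0n// mul1r -natrX ltr_nat.
  by rewrite (leq_trans (ltnSn p))// -{1}(expn1 p.+1) leq_pexp2l.
move=> x; rewrite /cell_box ci/= => xc; apply: rP.
apply: (@le_lt_trans _ _ (3 / M.+1%:R)); last first.
  by rewrite ltr_pdivrMr// mulrC -ltr_pdivrMr.
apply: mx_norm_le => [|l j]; first by rewrite divr_ge0 ?ltW.
rewrite (ord1 l) !mxE.
have := xc j; rewrite mxE -ler_distlC => H1; have H2 := cP j.
have dM : d <= 1 / M.+1%:R.
  by rewrite /d invfM mulrC ler_pM2r ?invr_gt0// invf_le1 ?ltr0n// ler1n.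
rewrite -(subrK (ratr (c j)) (x 0 j)) -addrA (le_trans (ler_normD _ _))//.
have -> : 3 / M.+1%:R = 2 / M.+1%:R + 1 / M.+1%:R :> R.
  by rewrite -mulrDl; congr (_ / _); ring.
by apply: lerD; rewrite distrC// (le_trans (ltW H2)).
Qed.

Definition cell_bump (X : set 'rV[R]_p) i z : R :=
  if `[< cell_box i `<=` X >] then cutoff (cell_dist i z) else 0.

(** A partition of unity: on the inner part of the cell i every weight of index
    larger than i vanishes, which makes the family locally finite. *)
Definition cell_weight X i z : R :=
  cell_bump X i z * \prod_(j < i) (1 - cell_bump X j z).

Lemma cell_weight_sum X J z :
  \sum_(i < J) cell_weight X i z = 1 - \prod_(i < J) (1 - cell_bump X i z).
Proof.
elim: J => [|J IH]; first by rewrite !big_ord0 subrr.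
rewrite !big_ord_recr/= IH.
rewrite -[cell_weight X J z]/(cell_bump X J z * \prod_(j < J) (1 - cell_bump X j z)).
by move: (cell_bump X J z) (\prod_(j < J) _) => u v; ring.
Qed.

Lemma cell_bump_ge0 X i z : 0 <= cell_bump X i z.
Proof. by rewrite /cell_bump; case: ifP => // _; exact: cutoff_ge0. Qed.

Lemma cell_weight_ge0 X i z : 0 <= cell_weight X i z.
Proof.
rewrite mulr_ge0 ?cell_bump_ge0// prodr_ge0// => j _.
by rewrite subr_ge0 /cell_bump; case: ifP => // _; exact: cutoff_le1.
Qed.

Lemma tempered_cell_bump X k (D K : set 'rV[R]_(p + m)) B i : open D ->
  tempered k D K B (cell_bump X i).
Proof.
move=> oD; rewrite /cell_bump; case: `[< _ >]; last exact: tempered_cst.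
by apply: tempered_cutoff => //; exact: tempered_cell_dist.
Qed.

Lemma tempered_cell_weight X k (D K : set 'rV[R]_(p + m)) B i : open D ->
  tempered k D K B (cell_weight X i).
Proof.
move=> oD; apply: temperedM => //; first exact: tempered_cell_bump.
apply: tempered_prod => // j _; apply: temperedB => //; first exact: tempered_cst.
exact: tempered_cell_bump.
Qed.

Definition dominated_growth (D : set 'rV[R]_(p + m)) G :=
  forall K : set 'rV[R]_p, compact K -> K `<=` lsubmx @` D -> growth D (tube K) G.

(** On each cell a power of 3 + |z|^2, up to a constant, dominates G; these
    functions are summed with weights that depend on the independent variables
    only. Over a compact set finitely many of them occur, so the sum is again
    of polynomial growth. A displacement of length at most 1 within the fibre
    does not change the weights, and it is absorbed by the constant 3. *)
Lemma smooth_majorant (D : set 'rV[R]_(p + m)) (G : 'rV[R]_(p + m) -> R) :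
  open D -> open (lsubmx @` D) ->
  (forall (x : 'rV[R]_p) (u v : 'rV[R]_m), D (row_mx x u) -> D (row_mx x v)) ->
  dominated_growth D G ->
  exists H : 'rV[R]_(p + m) -> R,
    (forall K : set 'rV[R]_p, compact K -> K `<=` lsubmx @` D ->
       forall k, tempered k D (tube K) predT H) /\
    (forall z w, D z -> D w -> lsubmx w = lsubmx z -> `|w - z| <= 1 -> `|G w| <= H z).
Proof.
move=> oD oX fibD GD; set X := lsubmx @` D in oX GD *.
have cst i : exists Cn : R * nat, 0 <= Cn.1 /\ (cell_box i `<=` X ->
    forall w, D w -> cell_box i (lsubmx w) -> `|G w| <= Cn.1 * (1 + `|w|) ^+ Cn.2).
  have [iX|niX] := pselect (cell_box i `<=` X); last by exists (0, 0%N).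
  have /growth_ge0[C C0 [n GC]] := GD _ (@compact_cell_box i) iX.
  by exists (C, n); split => // _ w; exact: GC.
have [Cn CnP] := choice cst.
pose h i z : R := (Cn i).1 * (3 + \sum_j z 0 j ^+ 2) ^+ (Cn i).2.
pose HJ J z : R := \sum_(i < J) cell_weight X i z * h i z.
(* A point is good for J when the weights of index at least J vanish at it. *)
pose good J z := exists2 i, (i < J)%N & cell_dist i z < 1 /\ cell_box i `<=` X.
have bump1 i z : cell_dist i z < 1 -> cell_box i `<=` X -> cell_bump X i z = 1.
  by move=> iz iX; rewrite /cell_bump asboolT// cutoff_eq1// ltW.
have HJ_stable J z : good J z -> HJ J.+1 z = HJ J z.
  move=> [i iJ [iz iX]]; have w0 : cell_weight X J z = 0.
    by rewrite /cell_weight (bigD1 (Ordinal iJ))//= (bump1 i z)// subrr mul0r mulr0.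
  by rewrite /HJ big_ord_recr/= w0 mul0r addr0.
have HJ_eq J J' z : good J z -> (J <= J')%N -> HJ J' z = HJ J z.
  move=> gJ /subnK <-; elim: (J' - J)%N => [|d IH]; first by rewrite add0n.
  rewrite addSn HJ_stable//; have [i iJ iz] := gJ; exists i => //.
  by rewrite (leq_trans iJ)// leq_addl.
have goodD z : D z -> exists J, good J z.
  move=> Dz; have [i iz] := @cell_cover X z oX (ex_intro2 _ _ z Dz erefl).
  by exists i.+1, i.
pose H z := HJ (get (good ^~ z)) z.
have HE J z : good J z -> H z = HJ J z.
  move=> gJ; have gg : good (get (good ^~ z)) z by apply: (@getPex _ (good ^~ z)); exists J.
  rewrite /H; have [JJ|/ltnW JJ] := leqP J (get (good ^~ z)).
    exact: HJ_eq.
  by rewrite -(HJ_eq _ _ _ gg JJ).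
have hT k (K : set 'rV[R]_(p + m)) B J : tempered k D K B (HJ J).
  apply: tempered_sum => // i _; apply: temperedM => //.
    exact: tempered_cell_weight.
  apply: temperedZ => //; apply: temperedX => //; apply: temperedD => //.
    exact: tempered_cst.
  by apply: tempered_sum => // j _; apply: temperedX => //; exact: tempered_coord.
have oGood J : open (D `&` [set z | good J z]).
  rewrite openE => z [Dz [i iJ [iz iX]]].
  have ci := tempered_continuous (@tempered_cell_dist 0 D setT predT i oD) Dz.
  have iz0 : 0 < (1 - cell_dist i z) / 2 by rewrite divr_gt0// subr_gt0.
  have [r r0 rP] := near_radius (continuous_near ci iz0).
  have [r' r'0 r'P] := near_radius (near_open oD Dz).
  apply/nbhs_ballP; exists (Num.min r r'); first by rewrite /= lt_min r0.
  move=> y; rewrite -ball_normE/= distrC lt_min => /andP[/rP yr /r'P Dy].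
  split => //; exists i => //; split => //.
  by move: yr; rewrite ler_norml => /andP[+ _]; move: iz; lra.
have D_lsub z w : lsubmx w = lsubmx z -> D z -> D w.
  move=> wz Dz; rewrite -(hsubmxK w) wz; apply: (fibD _ (rsubmx z)).
  by rewrite hsubmxK.
have good_lsub J z w : lsubmx w = lsubmx z -> good J z -> good J w.
  move=> wz [i iJ [iz iX]]; exists i => //; split => //.
  rewrite (_ : cell_dist i w = cell_dist i z)//; congr (_ * _).
  by apply: eq_bigr => j _; move/rowP/(_ j): wz; rewrite !mxE => ->.
have compact_good (K : set 'rV[R]_p) : compact K -> K `<=` X ->
    exists J, forall z, D z -> tube K z -> good J z.
  move=> /compact_near_coveringP cK KX.
  have := cK _ \oo (fun J x => good J (row_mx x 0)) _.
  case.
    move=> x Kx; have [z Dz zx] := KX _ Kx.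
    have Dx : D (row_mx x 0) by apply: D_lsub Dz; rewrite row_mxKl.
    have [J gJ] := goodD _ Dx.
    have [r r0 rP] := near_radius (near_open (oGood J) (conj Dx gJ)).
    exists ([set y | `|y - x| < r], [set J' | (J <= J')%N]).
      split; last by exists J.
      by apply/nbhs_ballP; exists r => // y; rewrite -ball_normE/= distrC.
    move=> [y J'] /= [yr JJ'].
    have /rP[_ [i iJ iy]] : `|row_mx y 0 - row_mx x 0 : 'rV[R]_(p + m)| < r.
      rewrite opp_row_mx add_row_mx subr0 (le_lt_trans (norm_row_mx_le _ _))//.
      by rewrite normr0 addr0.
    by exists i => //; exact: leq_trans JJ'.
  move=> J _ JP; exists J => z Dz Kz.
  apply: (good_lsub J (row_mx (lsubmx z) 0)); first by rewrite row_mxKl.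
  by apply: (JP J) => //=.
have HT k (K : set 'rV[R]_(p + m)) J : tempered k (D `&` [set z | good J z]) K predT H.
  apply: tempered_eq (_ : tempered k _ K predT (HJ J)) => //.
    by move=> z [_ gJ]; rewrite (HE J).
  by apply: tempered_sub (hT k K predT J) => // z [].
exists H; split.
  move=> K cK KX k; have [J JP] := compact_good K cK KX.
  apply: tempered_tube (HT k (tube K) J).
    by move=> z Dz Kz; split => //; exact: JP.
  apply: tempered_local => z Dz; have [J' gJ'] := goodD z Dz.
  by exists (D `&` [set z | good J' z]).
move=> z w Dz Dw wz wz1.
have [J gJ] := goodD z Dz; rewrite (HE J)//.
have sum1 : \sum_(i < J) cell_weight X i z = 1.
  rewrite cell_weight_sum; have [i iJ [iz iX]] := gJ.
  by rewrite (bigD1 (Ordinal iJ))//= (bump1 i z)// subrr mul0r subr0.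
rewrite -[leLHS]mul1r -sum1 mulr_suml ler_sum// => i _.
have [->|wi] := eqVneq (cell_weight X i z) 0; first by rewrite !mul0r.
rewrite ler_wpM2l ?cell_weight_ge0//.
have : cell_bump X i z != 0 by apply: contraNneq wi; rewrite /cell_weight => ->; rewrite mul0r.
rewrite /cell_bump; case: asboolP => [iX|]; last by rewrite eqxx.
have [zi|zi _] := leP 2 (cell_dist i z); first by rewrite cutoff_eq0// eqxx.
have [Ci0 GCi] := CnP i.
have Bw : cell_box i (lsubmx w) by rewrite wz; exact: cell_dist_box.
rewrite (le_trans (GCi iX w Dw Bw))// ler_wpM2l// lerXn2r ?nnegrE ?addr_ge0//.
  by rewrite sumr_ge0// => j _; rewrite sqr_ge0.
have := norm_le_1Dsqr z; have := ler_normD (w - z) z; rewrite subrK; lra.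
Qed.

End Majorant.

(** * Division by a system with an invertible minor *)

Section TemperedMatrix.
Variable R : realType.
Local Notation e_ i := (coord_vec R i).

Lemma tempered_det n a (D K : set 'rV[R]_a) B r (A : 'rV[R]_a -> 'M[R]_r) :
  open D -> (forall i j, tempered n D K B (fun x => A x i j)) ->
  tempered n D K B (fun x => \det (A x)).
Proof.
move=> oD AT; apply: tempered_sum => // s _; apply: temperedM => //.
  exact: tempered_cst.
by apply: tempered_prod => // i _.
Qed.

Lemma tempered_cofactor n a (D K : set 'rV[R]_a) B r (A : 'rV[R]_a -> 'M[R]_r) i j :
  open D -> (forall i j, tempered n D K B (fun x => A x i j)) ->
  tempered n D K B (fun x => cofactor (A x) i j).
Proof.
move=> oD AT; apply: temperedM => //; first exact: tempered_cst.
apply: tempered_det => // i' j'.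
by apply: tempered_eq (AT (lift i i') (lift j j')) => // x _; rewrite !mxE.
Qed.

Lemma tempered_invmx n a (D K : set 'rV[R]_a) B r (A : 'rV[R]_a -> 'M[R]_r) i j :
  open D -> (forall x, D x -> \det (A x) != 0) ->
  growth D K (fun x => (\det (A x))^-1) ->
  (forall i j, tempered n D K B (fun x => A x i j)) ->
  tempered n D K B (fun x => invmx (A x) i j).
Proof.
move=> oD A0 AV AT.
apply: tempered_eq (_ : tempered n D K B
    (fun x => (\det (A x))^-1 * cofactor (A x) j i)) => //.
  by move=> x Dx; rewrite /invmx unitmxE unitfE A0// !mxE.
apply: temperedM => //; last exact: tempered_cofactor.
by apply: temperedV => //; exact: tempered_det.
Qed.

Lemma derive_coord0 a (i j : 'I_a) (x : 'rV[R]_a) : i != j ->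
  'D_(e_ i) (fun y : 'rV[R]_a => y 0 j) x = 0.
Proof.
move=> ij; have [_ ->] := is_derive_coord_comp i (is_derive_id (x 0 j) (1 : R)).
by rewrite (negbTE ij) mul0r.
Qed.

(** Composition with a map that selects coordinates, for which the derivative
    condition of [tempered_comp] is a condition on the indices. *)
Lemma tempered_select n a b (D1 K1 : set 'rV[R]_a) (D2 K2 : set 'rV[R]_b)
    (B1 : pred 'I_a) (B2 : pred 'I_b) (f : 'rV[R]_b -> R) (sel : 'I_b -> 'I_a)
    (phi : 'rV[R]_a -> 'rV[R]_b) :
  open D1 -> open D2 -> (forall x j, phi x 0 j = x 0 (sel j)) ->
  (forall j, B1 (sel j) -> B2 j) ->
  (forall x, D1 x -> D2 (phi x)) -> (forall x, D1 x -> K1 x -> K2 (phi x)) ->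
  tempered n D2 K2 B2 f -> tempered n D1 K1 B1 (fun x => f (phi x)).
Proof.
move=> oD1 oD2 phiE B12 D12 K12; have phif j : (fun x => phi x 0 j) = (fun x => x 0 (sel j)).
  by apply/funext => x; exact: phiE.
apply: (tempered_comp oD1 oD2 D12 K12) => [i j Bi Bj x _|j].
  rewrite phif derive_coord0//; apply: contraNneq Bj => ij.
  by apply: B12; rewrite -ij.
by rewrite phif; exact: tempered_coord.
Qed.

End TemperedMatrix.

Lemma continuous_ext (T U : topologicalType) (f g : T -> U) x :
  (forall y, f y = g y) -> {for x, continuous f} -> {for x, continuous g}.
Proof. by move=> /funext ->. Qed.

Lemma open_preimage_on (T U : topologicalType) (D : set T) (f : T -> U) (B : set U) :
  open D -> (forall x, D x -> {for x, continuous f}) -> open B -> open (D `&` f @^-1` B).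
Proof.
move=> oD cf oB; rewrite openE => x [Dx Bx].
apply: (filterI (near_open oD Dx)); apply: (cf x Dx); exact: near_open.
Qed.

Lemma open_lt_on (R : realType) a (D : set 'rV[R]_a) (g : 'rV[R]_a -> R) c :
  open D -> (forall x, D x -> {for x, continuous g}) -> open (D `&` [set x | g x < c]).
Proof. by move=> oD cg; exact: (open_preimage_on oD cg (@open_lt R c)). Qed.

Lemma open_gt_on (R : realType) a (D : set 'rV[R]_a) (g : 'rV[R]_a -> R) c :
  open D -> (forall x, D x -> {for x, continuous g}) -> open (D `&` [set x | c < g x]).
Proof. by move=> oD cg; exact: (open_preimage_on oD cg (@open_gt R c)). Qed.

Lemma rsubmx_continuous (R : realType) a b : continuous (@rsubmx R 1 a b).
Proof.
move=> x; apply: continuous_mx => i j; rewrite (ord1 i).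
rewrite (_ : (fun y => _) = (fun y : 'rV[R]_(a + b) => y 0 (rshift a j))).
  exact: coord_continuous.
by apply/funext => y; rewrite mxE.
Qed.

Section Lifting.
Variable R : realType.
Local Notation e_ i := (coord_vec R i).
Variables (p m s : nat).
Local Notation N := (p + m)%N.
Variables (Delta : 'rV[R]_N -> 'cV[R]_s) (k : 'I_s -> 'I_N) (D : set 'rV[R]_N).
Local Notation X := (lsubmx @` D).
Implicit Types (z w : 'rV[R]_N).
Local Notation J := (Jacobian_minor k Delta).
Hypothesis oD : open D.
Hypothesis oX : open X.
Hypothesis fibD : forall (x : 'rV[R]_p) (u v : 'rV[R]_m),
  D (row_mx x u) -> D (row_mx x v).
Hypothesis k_inj : injective k.
Hypothesis k_dep : forall j, (p <= k j)%N.
Hypothesis DeltaT : forall K : set 'rV[R]_p, compact K -> K `<=` X ->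
  forall n i, tempered n D (tube K) predT (fun z => Delta z i 0).
Hypothesis Delta_inj : forall z w, D z -> D w -> same_fibre k z w ->
  Delta z = Delta w -> z = w.
Hypothesis det_neq0 : forall z, D z -> \det (J z) != 0.
Hypothesis detV : forall K : set 'rV[R]_p, compact K -> K `<=` X ->
  growth D (tube K) (fun z => (\det (J z))^-1).

Lemma D_lsub z w : lsubmx w = lsubmx z -> D z -> D w.
Proof.
move=> wz Dz; rewrite -(hsubmxK w) wz; apply: (fibD (u := rsubmx z)).
by rewrite hsubmxK.
Qed.

Lemma same_fibre_lsub z w : same_fibre k z w -> lsubmx w = lsubmx z.
Proof.
move=> zw; apply/rowP => j; rewrite !mxE zw//; apply/codomP => -[i ji].
by have := k_dep i; rewrite -ji /= leqNgt ltn_ord.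
Qed.

Lemma tempered_invJ K : compact K -> K `<=` X -> forall n i l,
  tempered n D (tube K) predT (fun z => invmx (J z) i l).
Proof.
move=> cK KX n i l; apply: tempered_invmx => //; first exact: detV.
move=> i' j'; apply: tempered_eq (tempered_derive (k j') (DeltaT cK KX n.+1 i')) => //.
by move=> z _; rewrite Jacobian_minorE.
Qed.

Let smooth_set0 : forall n i B, tempered n D set0 B (fun z => Delta z i 0).
Proof.
move=> n i B; apply: (@smooth_on_tempered _ _ _ B).
apply: (@tempered_smooth_on _ _ _ predT) => // k'.
by apply: tempered_sub (DeltaT compact0 _ k' i).
Qed.

Lemma invJ_continuous i l z : D z -> {for z, continuous (fun w => invmx (J w) i l)}.
Proof. by apply: (tempered_continuous (tempered_invJ compact0 _ 0%N i l)). Qed.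

Lemma J_unit z : D z -> J z \in unitmx.
Proof. by move=> Dz; rewrite unitmxE unitfE det_neq0. Qed.

Definition invJ_norm z : R := \sum_i \sum_l `|invmx (J z) i l|.

Lemma invJ_norm_ge0 z : 0 <= invJ_norm z.
Proof. by rewrite sumr_ge0// => i _; rewrite sumr_ge0. Qed.

(** The square of 8 (|J^-1| + 1) is what [fibre_path_exists] requires on the
    unit ball of the fibre. *)
Lemma inverse_majorant : exists H : 'rV[R]_N -> R,
  (forall K : set 'rV[R]_p, compact K -> K `<=` X ->
       forall n, tempered n D (tube K) predT H) /\
  (forall z w, D z -> lsubmx w = lsubmx z -> `|w - z| <= 1 ->
     (8 * (invJ_norm w + 1)) ^+ 2 <= H z).
Proof.
have G : dominated_growth D (fun w => (8 * (invJ_norm w + 1)) ^+ 2).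
  move=> K cK KX; apply: growthX; apply: growthM; first exact: growth_cst.
  apply: growthD; last exact: growth_cst.
  apply: growth_sum => i _; apply: growth_sum => l _.
  apply: growth_le (tempered_growth (tempered_invJ cK KX 0%N i l)) => // x _ _.
  by rewrite normr_id.
have [H [HT HG]] := smooth_majorant oD oX fibD G.
exists H; split => // z w Dz wz wz1.
have := HG z w Dz (D_lsub wz Dz) wz wz1.
by rewrite ger0_norm// sqr_ge0.
Qed.

Variable H : 'rV[R]_N -> R.
Hypothesis HT : forall K : set 'rV[R]_p, compact K -> K `<=` X ->
  forall n, tempered n D (tube K) predT H.
Hypothesis HG : forall z w, D z -> lsubmx w = lsubmx z -> `|w - z| <= 1 ->
  (8 * (invJ_norm w + 1)) ^+ 2 <= H z.

Definition Delta_sq z : R := \sum_i Delta z i 0 ^+ 2.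
(** The quantity that decides between the two expressions of the quotient: the
    path to the zero set exists where it is less than 3. *)
Definition defect z : R := Delta_sq z * H z.
Definition small_defect : set 'rV[R]_N := D `&` [set z | defect z < 3].

Lemma tempered_Delta_sq K : compact K -> K `<=` X -> forall n, tempered n D (tube K) predT Delta_sq.
Proof.
by move=> cK KX n; apply: tempered_sum => // i _; apply: temperedX => //; exact: DeltaT.
Qed.

Lemma tempered_defect K : compact K -> K `<=` X -> forall n, tempered n D (tube K) predT defect.
Proof. by move=> cK KX n; apply: temperedM => //; [exact: tempered_Delta_sq|exact: HT]. Qed.

Lemma defect_continuous z : D z -> {for z, continuous defect}.
Proof. by apply: (tempered_continuous (tempered_defect compact0 _ 0%N)). Qed.

Lemma open_small_defect : open small_defect.
Proof. by apply: open_lt_on => //; exact: defect_continuous. Qed.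

Lemma Delta_sq_ge0 z : 0 <= Delta_sq z.
Proof. by rewrite sumr_ge0// => i _; rewrite sqr_ge0. Qed.

Lemma normsq_le_Delta_sq z : `|Delta z| ^+ 2 <= Delta_sq z.
Proof.
rewrite -[leRHS]sqr_sqrtr ?Delta_sq_ge0// ler_sqr ?nnegrE ?sqrtr_ge0//.
apply: mx_norm_le; first exact: sqrtr_ge0.
move=> i j; rewrite (ord1 j) -sqrtr_sqr ler_sqrt ?Delta_sq_ge0// /Delta_sq (bigD1 i)//= lerDl.
by rewrite sumr_ge0// => l _; rewrite sqr_ge0.
Qed.

Lemma H_gt0 z : D z -> 0 < H z.
Proof.
move=> Dz; have := HG Dz (erefl (lsubmx z)); rewrite subrr normr0 => /(_ ler01).
by apply: lt_le_trans; rewrite exprn_gt0// mulr_gt0// ltr_wpDl// invJ_norm_ge0.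
Qed.

Definition fibre_path_spec t z w :=
  [/\ D w, same_fibre k z w, Delta w = t *: Delta z & `|w - z| <= 1].

(** With L = sqrt(H z) / 8 the residual at z satisfies 2 L |t Delta z - Delta
    z| <= sqrt(H z) |Delta z| / 2 < 1, so that [fibre_solution] applies on the
    unit ball of the fibre. The open range -1 < t < 2 contains the interval of
    integration in its interior. *)
Lemma fibre_path_exists t z : small_defect z -> -1 < t -> t < 2 -> exists w, fibre_path_spec t z w.
Proof.
move=> [Dz gz] t1 t2; have Hz := H_gt0 Dz.
(* By the choice of H, |J^-1| + 1 is at most L on the unit ball of the
   fibre. *)
pose L := Num.sqrt (H z) / 8.
have L0 : 0 < L by rewrite divr_gt0// sqrtr_gt0.
have fib w : same_fibre k z w -> `|w - z| <= 1 ->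
    D w /\ forall c : 'cV[R]_s, `|invmx (J w) *m c| <= L * `|c|.
  move=> zw wz1; have wz := same_fibre_lsub zw; split; first exact: D_lsub Dz.
  move=> c; rewrite (le_trans (norm_mulmx_le _ _))// ler_wpM2r// -/(invJ_norm w).
  have J0 := invJ_norm_ge0 w.
  have J1 : 0 <= 8 * (invJ_norm w + 1) by lra.
  have := HG Dz wz wz1; rewrite -(ler_sqrt _ (ltW Hz)) sqrtr_sqr ger0_norm//.
  by rewrite /L; lra.
have small : 2 * L * `|t *: Delta z - Delta z| < 1.
  rewrite -[in X in _ - X](scale1r (Delta z)) -scalerBl normrZ.
  have tt : `|t - 1| <= 2 by rewrite ler_norml; apply/andP; split; lra.
  apply: (@le_lt_trans _ _ (4 * L * `|Delta z|)).
    have h : `|t - 1| * `|Delta z| <= 2 * `|Delta z| by rewrite ler_wpM2r.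
    have -> : 4 * L = 2 * L * 2 by ring.
    by rewrite -[leRHS]mulrA ler_wpM2l// mulr_ge0// ltW.
  rewrite -ltr_sqr ?nnegrE ?mulr_ge0 ?(ltW L0)// expr1n.
  have -> : (4 * L * `|Delta z|) ^+ 2 = (Num.sqrt (H z)) ^+ 2 * `|Delta z| ^+ 2 / 4.
    by rewrite /L; field.
  rewrite sqr_sqrtr ?(ltW Hz)//.
  have := ler_wpM2l (ltW Hz) (normsq_le_Delta_sq z); move: gz; rewrite /defect/=; lra.
have [w [Dw zw Dew wz]] := fibre_solution oD k_inj (fun i => smooth_set0 1 i xpred0)
   J_unit Dz ltr01 L0 fib small.
by exists w; split => //; rewrite (le_trans wz)// ltW.
Qed.

Definition fibre_path t z : 'rV[R]_N := xget z (fibre_path_spec t z).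

Lemma fibre_pathP t z : small_defect z -> -1 < t -> t < 2 -> fibre_path_spec t z (fibre_path t z).
Proof.
move=> Uz t1 t2; have [w wP] := fibre_path_exists Uz t1 t2.
exact: (xgetPex z (ex_intro _ w wP)).
Qed.

Lemma fibre_path1 z : small_defect z -> fibre_path 1 z = z.
Proof.
move=> Uz; have h1 : -1 < 1 :> R by lra.
have h2 : 1 < 2 :> R by lra.
have [Dw zw Dew _] := fibre_pathP Uz h1 h2.
apply/esym/Delta_inj => //; first by case: Uz.
by rewrite Dew scale1r.
Qed.

Definition any_time (A : set 'rV[R]_N) : set 'rV[R]_(1 + N) := [set e | A (rsubmx e)].

Lemma open_any_time A : open A -> open (any_time A).
Proof.
move=> oA; apply: (@open_comp _ _ (fun e : 'rV[R]_(1 + N) => rsubmx e)) => // x _.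
exact: rsubmx_continuous.
Qed.

Definition path_dom : set 'rV[R]_(1 + N) :=
  [set e : 'rV[R]_(1 + N) | -1 < e 0 (lshift N ord0) /\ e 0 (lshift N ord0) < 2] `&` any_time small_defect.

Lemma open_path_dom : open path_dom.
Proof.
apply: openI; last exact/open_any_time/open_small_defect.
rewrite (_ : [set e | _] = (fun e : 'rV[R]_(1 + N) => e 0 (lshift N ord0)) @^-1` (`]-1, 2[%classic)).
  apply: (@open_comp _ _ (fun e : 'rV[R]_(1 + N) => e 0 (lshift N ord0))).
    by move=> x _; exact: coord_continuous.
  exact: interval_open.
by apply/seteqP; split => e /=; rewrite in_itv/=; [move=> [-> ->]|move=> /andP[]].
Qed.

Definition fibre_path_at (e : 'rV[R]_(1 + N)) := fibre_path (e 0 (lshift N ord0)) (rsubmx e).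

(** The path solves Delta (lambda) = t Delta z along the fibre of z, and its
    growth is clear from |lambda - z| <= 1. *)
Lemma tempered_fibre_path K B : compact K -> K `<=` X -> forall n j,
  tempered n path_dom (any_time (tube K)) B (fun e => fibre_path_at e 0 j).
Proof.
move=> cK KX.
have sel f n : tempered n D (tube K) predT f ->
    tempered n path_dom (any_time (tube K)) B (fun e => f (rsubmx e)).
  move=> fT; apply: (@tempered_select _ _ _ _ _ _ D (tube K) _ predT f (@rshift 1 N)
    (fun e : 'rV[R]_(1 + N) => rsubmx e)) => //; first exact: open_path_dom.
    by move=> x j; rewrite mxE.
  by move=> e [_ []].
apply: (@tempered_solution R N s Delta k D oD k_inj (fun i => smooth_set0 1 i xpred0)
  J_unit Delta_inj invJ_continuous _ path_dom _ B (tube K) (fun e => rsubmx e)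
  (fun e => e 0 (lshift N ord0) *: Delta (rsubmx e)) fibre_path_at).
- exact: open_path_dom.
- move=> n j; apply: (sel (fun z => z 0 j)); exact: tempered_coord.
- move=> n i; apply: tempered_eq (_ : tempered n _ _ B
    (fun e => e 0 (lshift N ord0) * Delta (rsubmx e) i 0)); first exact: open_path_dom.
    by move=> e _; rewrite mxE.
  apply: temperedM; first exact: open_path_dom.
    exact/tempered_coord/open_path_dom.
  exact/(sel (fun z => Delta z i 0))/DeltaT.
- exact: DeltaT.
- exact: tempered_invJ.
- by move=> e [[t1 t2] Ue]; have [] := fibre_pathP Ue t1 t2.
- move=> e [[t1 t2] Ue] Ke; have [_ zw _ _] := fibre_pathP Ue t1 t2.
  by rewrite /tube/= (same_fibre_lsub zw).
- move=> j; apply: growth_le (growthD (growth_cst path_dom (any_time (tube K)) 1) (growth_normr _ _)) => // e [[t1 t2] Ue] _.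
  have [_ _ _ le1] := fibre_pathP Ue t1 t2.
  rewrite [leRHS]ger0_norm ?addr_ge0//.
  rewrite (le_trans (ler_mx_norm _ _ _))// -(subrK (rsubmx e) (fibre_path_at e)).
  by rewrite (le_trans (ler_normD _ _))// lerD// norm_rsubmx_le.
Qed.

(** The vectors are (t, (eta, z)): integration parameter, group parameter and
    jet. The path depends on t and z only. *)
Definition sel_time (j : 'I_(1 + N)) : 'I_(1 + (1 + N)) :=
  match fintype.split j with
  | inl i => lshift (1 + N) i
  | inr i => rshift 1 (rshift 1 i)
  end.

Definition forget_param (e : 'rV[R]_(1 + (1 + N))) : 'rV[R]_(1 + N) :=
  row_mx (lsubmx e) (rsubmx (rsubmx e)).

Lemma forget_paramE e j : forget_param e 0 j = e 0 (sel_time j).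
Proof. by rewrite mxE /sel_time; case: fintype.split => i; rewrite !mxE. Qed.

Variables (W : set 'rV[R]_(1 + N)) (F : 'rV[R]_(1 + N) -> R).
Let Bz : pred 'I_(1 + N) := fun i => (0 < i)%N.
Let Bz' : pred 'I_(1 + (1 + N)) := fun i => (1 < i)%N.
Hypothesis oW : open W.
Hypothesis WD : forall e, W e -> D (rsubmx e).
Hypothesis Wfib : forall e e', lsubmx e' = lsubmx e ->
  lsubmx (rsubmx e') = lsubmx (rsubmx e) -> W e -> W e'.
Hypothesis FT : forall n, tempered n W set0 Bz F.
Hypothesis F0 : forall e, W e -> Delta (rsubmx e) = 0 -> F e = 0.

Definition lifted_point (e : 'rV[R]_(1 + (1 + N))) : 'rV[R]_(1 + N) :=
  row_mx (lsubmx (rsubmx e)) (fibre_path_at (forget_param e)).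

Lemma lifted_pointl e i : lifted_point e 0 (lshift N i) = e 0 (rshift 1 (lshift N i)).
Proof. by rewrite row_mxEl !mxE. Qed.

Lemma lifted_pointr e i : lifted_point e 0 (rshift 1 i) = fibre_path_at (forget_param e) 0 i.
Proof. by rewrite row_mxEr. Qed.

(** The entry j of the row vector d_k F(eta, lambda) J(lambda)^-1. *)
Definition quotient_integrand j e : R := \sum_l
  'D_(e_ (rshift 1 (k l))) F (lifted_point e) * invmx (J (fibre_path_at (forget_param e))) l j.

Definition int_dom : set 'rV[R]_(1 + N) := W `&` any_time small_defect.

Definition integrand_dom : set 'rV[R]_(1 + (1 + N)) :=
  [set e | path_dom (forget_param e)] `&` [set e | W (rsubmx e)].

Lemma open_integrand_dom : open integrand_dom.
Proof.
apply: openI.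
  apply: (@open_comp _ _ forget_param) open_path_dom => x _.
  apply: continuous_mx => i j; rewrite (ord1 i).
  apply: continuous_ext (@coord_continuous _ _ _ 0 (sel_time j) x) => y.
  by rewrite forget_paramE.
apply: (@open_comp _ _ (fun e : 'rV[R]_(1 + (1 + N)) => rsubmx e)) oW => x _.
exact: rsubmx_continuous.
Qed.

Lemma integrand_fibre_path e : integrand_dom e ->
  fibre_path_spec (e 0 (lshift (1 + N) ord0)) (rsubmx (rsubmx e)) (fibre_path_at (forget_param e)).
Proof.
move=> [[[]]]; rewrite /any_time/= /fibre_path_at !row_mxKr.
rewrite mxE; case: fintype.splitP => [i _|i //].
by rewrite (ord1 i) mxE => t1 t2 Ue _; exact: fibre_pathP.
Qed.

Section IntegrandTempered.
Variables (KW : set 'rV[R]_(1 + N)) (K : set 'rV[R]_p).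
Hypothesis cK : compact K.
Hypothesis KX : K `<=` X.
Hypothesis KWK : forall e, KW e -> K (lsubmx (rsubmx e)).
Hypothesis KWfib : forall e e', lsubmx e' = lsubmx e ->
  lsubmx (rsubmx e') = lsubmx (rsubmx e) -> KW e -> KW e'.
Hypothesis FKW : forall n, tempered n W KW Bz F.

Let K' : set 'rV[R]_(1 + (1 + N)) := [set e | KW (rsubmx e)].

Lemma tempered_forget n j :
  tempered n integrand_dom K' Bz' (fun e => fibre_path_at (forget_param e) 0 j).
Proof.
apply: (@tempered_select _ _ _ _ _ _ path_dom (any_time (tube K)) _ predT
  (fun e => fibre_path_at e 0 j) sel_time forget_param) => //.
- exact: open_integrand_dom.
- exact: open_path_dom.
- exact: forget_paramE.
- by move=> e [].
- move=> e _ /KWK; by rewrite /any_time/tube/= /forget_param row_mxKr.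
- exact: tempered_fibre_path.
Qed.

Lemma lifted_fib e : lsubmx (lifted_point e) = lsubmx (rsubmx e) /\
  (integrand_dom e ->
   lsubmx (rsubmx (lifted_point e)) = lsubmx (rsubmx (rsubmx e))).
Proof.
rewrite /lifted_point row_mxKl row_mxKr; split => // /integrand_fibre_path[_ zw _ _].
exact: same_fibre_lsub.
Qed.

Lemma tempered_integrand n j : tempered n integrand_dom K' Bz' (quotient_integrand j).
Proof.
have oI := open_integrand_dom.
apply: tempered_sum => // l _; apply: temperedM => //.
  apply: (@tempered_comp _ _ _ _ integrand_dom K' W KW Bz' Bz
      ('D_(e_ (rshift 1 (k l))) F) lifted_point) => //.
  - by move=> e Ie; have [h1 /(_ Ie) h2] := lifted_fib e; apply: Wfib h1 h2 _; case: Ie.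
  - by move=> e Ie; have [h1 /(_ Ie) h2] := lifted_fib e; exact: KWfib h1 h2.
  - move=> i j' Bi Bj e _.
    have [i' j'E|i' j'E] := fintype.splitP j'; last by rewrite /Bz j'E in Bj.
    have -> : j' = lshift N i' by exact: val_inj.
    rewrite (funext (fun y => lifted_pointl y i')) derive_coord0//.
    by apply: contraTneq Bi => ->; rewrite /Bz' (ord1 i').
  - move=> j'; have [i' j'E|i' j'E] := fintype.splitP j'.
      have -> : j' = lshift N i' by exact: val_inj.
      by rewrite (funext (fun y => lifted_pointl y i')); exact: tempered_coord.
    have -> : j' = rshift 1 i' by exact: val_inj.
    by rewrite (funext (fun y => lifted_pointr y i')); exact: tempered_forget.
  - have := tempered_derive (rshift 1 (k l)) (FKW n.+1).
    by have -> : Bz (rshift 1 (k l)) = true by [].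
apply: (@tempered_comp _ _ _ _ integrand_dom K' D (tube K) Bz' predT
      (fun z => invmx (J z) l j) (fun e => fibre_path_at (forget_param e))) => //.
- by move=> e /integrand_fibre_path[].
- move=> e /integrand_fibre_path[_ zw _ _] /KWK; by rewrite /tube/= (same_fibre_lsub zw).
- exact: tempered_forget.
- exact: tempered_invJ.
Qed.

Definition quotient_int j e : R := unit_integral (fun t => quotient_integrand j (with_time t e)).

Lemma with_time_l t (e : 'rV[R]_(1 + N)) i : with_time t e 0 (lshift (1 + N) i) = t.
Proof. by rewrite row_mxEl mxE. Qed.

Lemma integrand_dom_time e t : int_dom e -> -1 < t -> t < 2 -> integrand_dom (with_time t e).
Proof.
move=> [We Ue] t1 t2; split; last by rewrite /= rsubmx_with_time.
rewrite /path_dom/= /any_time/= /forget_param row_mxKr rsubmx_with_time.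
have -> : row_mx (lsubmx (with_time t e)) (rsubmx e) 0 (lshift N ord0) = t.
  by rewrite row_mxEl mxE with_time_l.
by split.
Qed.

Lemma tempered_quotient_int n j : tempered n int_dom KW Bz (quotient_int j).
Proof.
apply: (tempered_unit_integral open_integrand_dom _ _ _ _ (tempered_integrand n j)).
- by apply: openI => //; exact/open_any_time/open_small_defect.
- move=> e t De /andP[t0 t1]; apply: integrand_dom_time => //; lra.
- by move=> e t De Ke _; rewrite /K'/= rsubmx_with_time.
- by move=> i Bi; rewrite /Bz' /= add1n ltnS.
Qed.

End IntegrandTempered.

Let integrand0 n j : tempered n integrand_dom set0 Bz' (quotient_integrand j).
Proof.
by apply: (@tempered_integrand set0 set0 compact0) => //; apply: tempered_sub (FT _).
Qed.

(** Differentiating Delta (lambda) = t Delta z at fixed z. *)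
Lemma is_derive_fibre_path z (t : R) : small_defect z -> -1 < t -> t < 2 ->
  is_derive t (1 : R) (fun s => fibre_path s z)
    (lift_cV k (invmx (J (fibre_path t z)) *m Delta z)).
Proof.
move=> Uz t1 t2; pose O : set R := `]-1, 2[%classic.
have Ot : O t by rewrite /O/= in_itv/= t1.
have dy : is_derive t (1 : R) (fun s : R => s *: Delta z) (Delta z).
  apply: is_derive_mx => i j; rewrite (ord1 j).
  have -> : (fun s : R => (s *: Delta z) i 0) = (fun s : R => s * Delta z i 0).
    by apply/funext => s'; rewrite mxE.
  have := is_deriveM (is_derive_id t (1 : R)) (is_derive_cst (Delta z i 0) t (1 : R)).
  by move=> Hd; apply: (is_derive_eq Hd); rewrite scaler0 add0r /GRing.scale/= mulr1.
have cb : {for t, continuous (fun=> z)} by exact: cst_continuous.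
have cy : {for t, continuous (fun s : R => s *: Delta z)}.
  by have [dy' _] := dy; exact/differentiable_continuous/derivable1_diffP.
have laP (r : R) : O r -> [/\ D (fibre_path r z), same_fibre k z (fibre_path r z) &
    Delta (fibre_path r z) = r *: Delta z].
  by rewrite /O/= in_itv/= => /andP[r1 r2]; have [] := fibre_pathP Uz r1 r2.
have oO : open O by exact: interval_open.
have := is_derive_solution oD k_inj (fun i => smooth_set0 1 i xpred0) J_unit Delta_inj
  invJ_continuous oO Ot cb cy laP (is_derive_cst z t (1 : R)) dy.
move=> Hd; apply: (is_derive_eq Hd).
set uo := \row_j _; have -> : uo = 0 by apply/rowP => j; rewrite !mxE; case: ifP.
rewrite add0r; congr (lift_cV k (_ *m _)); apply/colP => i; rewrite mxE big1 ?subr0//.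
by move=> j _; rewrite mxE mul0r.
Qed.

(** The fundamental theorem of calculus along the path: F vanishes at its
    initial point, where Delta does, and its endpoint is z. *)
Lemma quotient_int_eq e : int_dom e ->
  \sum_j quotient_int j e * Delta (rsubmx e) j 0 = F e.
Proof.
move=> [We Ue]; set z := rsubmx e in Ue *; have Uz : small_defect z := Ue.
have lpE (t : R) : lifted_point (with_time t e) = row_mx (lsubmx e) (fibre_path t z).
  rewrite /lifted_point /fibre_path_at /forget_param !rsubmx_with_time row_mxKr row_mxEl mxE.
  by rewrite with_time_l.
have laE (t : R) : fibre_path_at (forget_param (with_time t e)) = fibre_path t z.
  by rewrite -[LHS](row_mxKr (lsubmx (rsubmx (with_time t e)))) -/(lifted_point _) lpE row_mxKr.
have in_dom (t : R) : 0 <= t <= 1 -> [/\ -1 < t, t < 2 & integrand_dom (with_time t e)].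
  by move=> /andP[t0 t1]; split; [lra|lra|apply: integrand_dom_time => //; lra].
have ci j : unit_continuous (fun t => quotient_integrand j (with_time t e)).
  apply: (unit_continuous_with_time (tempered_continuous (integrand0 0%N j))).
  by move=> t /in_dom[].
have [csum sumE] := unit_integral_sumZ (fun j => Delta z j 0) ci.
rewrite -[LHS]sumE.
have -> : F e = F (row_mx (lsubmx e) (fibre_path 1 z)) - F (row_mx (lsubmx e) (fibre_path 0 z)).
  have h0 : -1 < 0 :> R by lra.
  have h0' : 0 < 2 :> R by lra.
  have [D0 zf0 De0 _] := fibre_pathP Uz h0 h0'.
  rewrite (fibre_path1 Uz) hsubmxK [X in _ - X]F0 ?subr0//.
    apply: Wfib We; first by rewrite row_mxKl.
    by rewrite row_mxKr (same_fibre_lsub zf0).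
  by rewrite row_mxKr De0 scale0r.
apply: (unit_FTC (f := fun t => F (row_mx (lsubmx e) (fibre_path t z)))); last exact: csum.
move=> t /in_dom[t1 t2 It].
pose dphi (j : 'I_(1 + N)) : R :=
  (row_mx 0 (lift_cV k (invmx (J (fibre_path t z)) *m Delta z)) : 'rV[R]_(1 + N)) 0 j.
have dlam := is_derive_fibre_path Uz t1 t2.
have [h1 /(_ It) h2] := lifted_fib (with_time t e).
have Wl : W (row_mx (lsubmx e) (fibre_path t z)).
  rewrite -lpE; apply: Wfib We; rewrite ?h1 ?h2 rsubmx_with_time//.
have dF : is_derive t (1 : R) (F \o (fun s => row_mx (lsubmx e) (fibre_path s z)))
    (\sum_j dphi j * 'D_(e_ j) F (row_mx (lsubmx e) (fibre_path t z))).
  apply: (is_derive_comp_C1 (d := fun j => 'D_(e_ j) F)).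
  - move=> j; rewrite /dphi.
    have [i jE|i jE] := fintype.splitP j.
      have -> : j = lshift N i by exact: val_inj.
      rewrite (_ : (fun r => _) = cst (lsubmx e 0 i)); last first.
        by apply/funext => r; rewrite row_mxEl.
      rewrite row_mxEl [X in is_derive _ _ _ X]mxE; exact: is_derive_cst.
    have -> : j = rshift 1 i by exact: val_inj.
    rewrite (_ : (fun r => _) = (fun r => fibre_path r z 0 i)); last first.
      by apply/funext => r; rewrite row_mxEr.
    rewrite row_mxEr; exact: is_derive_entry.
  - have := near_open oW Wl; apply: filterS => y Wy i.
    exact: tempered_is_derive (FT 1).
  - move=> i; exact: (tempered_continuous (tempered_derive i (FT 1)) Wl).
apply: (is_derive_eq dF); rewrite big_split_ord/= big1 ?add0r; last first.
  by move=> i _; rewrite /dphi row_mxEl mxE mul0r.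
under eq_bigr do rewrite /dphi row_mxEr.
rewrite (sum_lift_cV k _ (fun j => 'D_(e_ (rshift 1 j)) F (row_mx (lsubmx e) (fibre_path t z)))).
rewrite /quotient_integrand lpE laE.
under [RHS]eq_bigr do rewrite mulr_suml.
rewrite exchange_big/=; apply: eq_bigr => l _.
rewrite mxE mulr_suml; apply: eq_bigr => j _.
by rewrite mulrC mulrA.
Qed.

(** Near the zero set of Delta this is the integral along the path, away from
    it F Delta^T / |Delta|^2, the factor of least norm. *)
Definition quotient j e : R :=
  cutoff (defect (rsubmx e)) * quotient_int j e +
  (1 - cutoff (defect (rsubmx e))) * ((Delta_sq (rsubmx e))^-1 * (F e * Delta (rsubmx e) j 0)).

Lemma quotient_eq e : W e -> \sum_j quotient j e * Delta (rsubmx e) j 0 = F e.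
Proof.
move=> We; set z := rsubmx e; have Dz : D z := WD We.
pose chi := cutoff (defect z).
have E j : quotient j e * Delta z j 0 = chi * (quotient_int j e * Delta z j 0) +
    (1 - chi) * (Delta_sq z)^-1 * F e * Delta z j 0 ^+ 2.
  rewrite /quotient -/z -/chi.
  by move: chi (quotient_int j e) (Delta_sq z)^-1 (F e) (Delta z j 0) => c1 c2 c3 c4 c5; ring.
under eq_bigr do rewrite E.
rewrite big_split/= -!mulr_sumr -/(Delta_sq z).
have -> : chi * (\sum_j quotient_int j e * Delta z j 0) = chi * F e.
  have [g3|g3] := ltP (defect z) 3; first by rewrite quotient_int_eq.
  by rewrite /chi cutoff_eq0 ?mul0r// (le_trans _ g3)//; lra.
have [sq0|sq0] := eqVneq (Delta_sq z) 0.
  by rewrite /chi cutoff_eq1 ?subrr ?mul0r ?addr0 ?mul1r// /defect sq0 mul0r.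
by field.
Qed.

(** Each summand is tempered where its cutoff factor does not vanish and is
    identically zero on an open set that covers the rest of W. Where the defect
    is at least 1/2, the majorant H bounds the inverse of |Delta|^2. *)
Lemma tempered_quotient KW K j : compact K -> K `<=` X ->
  (forall e, KW e -> K (lsubmx (rsubmx e))) ->
  (forall e e', lsubmx e' = lsubmx e ->
     lsubmx (rsubmx e') = lsubmx (rsubmx e) -> KW e -> KW e') ->
  (forall n, tempered n W KW Bz F) -> forall n, tempered n W KW Bz (quotient j).
Proof.
move=> cK KX KWK KWfib FKW n.
have base f : tempered n D (tube K) predT f -> tempered n W KW Bz (fun e => f (rsubmx e)).
  move=> fT; apply: (@tempered_select _ _ _ _ _ _ D (tube K) _ predT f (@rshift 1 N)
    (fun e : 'rV[R]_(1 + N) => rsubmx e)) => //.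
    by move=> e i; rewrite mxE.
  by move=> e _; exact: KWK.
have gT := base _ (tempered_defect cK KX n).
have gc e : W e -> {for e, continuous (fun e => defect (rsubmx e))}.
  by move=> We; exact: (tempered_continuous gT We).
have cT := tempered_cutoff oW gT.
have oint : open int_dom by apply: openI => //; exact/open_any_time/open_small_defect.
have restrict (E : set 'rV[R]_(1 + N)) f : (forall e, E e -> W e) ->
    tempered n W KW Bz f -> tempered n E KW Bz f.
  by move=> EW; exact: tempered_sub.
have T1 : tempered n W KW Bz (fun e => cutoff (defect (rsubmx e)) * quotient_int j e).
  (* The integral is only available for defect < 3, and the cutoff vanishes
     from 2 on. *)
  pose W2 := W `&` [set e | 2 < defect (rsubmx e)].
  have oW2 : open W2 by apply: open_gt_on.
  have cover : W = int_dom `|` W2.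
    apply/seteqP; split => [e We|e [[]|[]]//].
    have [g3|g3] := ltP (defect (rsubmx e)) 3; first by left; split => //; split => //; exact: WD.
    by right; split => //=; rewrite (lt_le_trans _ g3)//; lra.
  rewrite [W in tempered _ W]cover; apply: tempered_setU.
    apply: temperedM => //; first by apply: restrict cT => e [].
    exact: (tempered_quotient_int cK KX KWK KWfib FKW).
  apply: tempered_eq (tempered_cst _ _ _ 0 oW2) => // e [We /ltW g2].
  by rewrite cutoff_eq0// mul0r.
have T2 : tempered n W KW Bz (fun e => (1 - cutoff (defect (rsubmx e))) *
    ((Delta_sq (rsubmx e))^-1 * (F e * Delta (rsubmx e) j 0))).
  (* The cutoff is 1 up to 1, and 1 / Delta_sq is at most 2 H from 1 / 2 on. *)
  pose W1 := W `&` [set e | 1 / 2 < defect (rsubmx e)].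
  pose W2 := W `&` [set e | defect (rsubmx e) < 1].
  have oW1 : open W1 by apply: open_gt_on.
  have oW2 : open W2 by apply: open_lt_on.
  have cover : W = W1 `|` W2.
    apply/seteqP; split => [e We|e [[]|[]]//].
    have [g3|g3] := ltP (defect (rsubmx e)) 1; first by right.
    by left; split => //=; lra.
  rewrite [W in tempered _ W]cover; apply: tempered_setU; last first.
    apply: tempered_eq (tempered_cst _ _ _ 0 oW2) => // e [We /ltW g2].
    by rewrite cutoff_eq1// subrr mul0r.
  have W1W e : W1 e -> W e by case.
  have sq_gt0 e : W1 e -> 0 < Delta_sq (rsubmx e).
    move=> [We g1]; rewrite lt_def Delta_sq_ge0 andbT; apply: contraTneq g1.
    by rewrite /= /defect => ->; rewrite mul0r -leNgt; lra.
  apply: temperedM => //.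
    apply: temperedB => //; first exact: tempered_cst.
    exact: restrict cT.
  apply: temperedM => //.
    apply: temperedV => //.
    - by move=> e /sq_gt0; rewrite lt0r => /andP[].
    - have gH := tempered_growth (temperedZ 2 oW (base _ (HT cK KX n))).
      apply: growth_le gH => [e We Ke|e W1e _]; first by split => //; exact: W1W.
      have s0 := sq_gt0 e W1e; have H0 := H_gt0 (WD (W1W _ W1e)).
      rewrite !ger0_norm ?invr_ge0 ?mulr_ge0 ?(ltW H0) ?(ltW s0)//.
      rewrite -div1r ler_pdivrMr//; case: W1e => _ /=; rewrite /defect; lra.
    - apply: restrict (base _ (tempered_Delta_sq cK KX n)); exact: W1W.
  apply: restrict W1W _; apply: temperedM => //.
  exact: (base (fun z => Delta z j 0) (DeltaT cK KX n j)).
exact: temperedD.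
Qed.

End Lifting.

(** * Jets of composite functions and Taylor polynomials *)

Section JetEquality.
Variable R : realType.
Local Notation e_ i := (coord_vec R i).
Local Notation iter_pd s f := (iterated_derive [seq e_ i | i <- s] f).

(** Defined by recursion on the first derivative taken, in order to match the
    induction in the chain rule. *)
Fixpoint same_jet n a (x : 'rV[R]_a) (f g : 'rV[R]_a -> R) : Prop :=
  f x = g x /\
  if n is n'.+1 then forall i, same_jet n' x ('D_(e_ i) f) ('D_(e_ i) g) else True.

Section OneSpace.
Variable a : nat.
Implicit Types (x : 'rV[R]_a) (f g h : 'rV[R]_a -> R) (D : set 'rV[R]_a).

Lemma iter_pd_rcons s i f : iter_pd (rcons s i) f = iter_pd s ('D_(e_ i) f).
Proof. by rewrite /iterated_derive map_rcons -cats1 foldr_cat. Qed.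

Lemma same_jetP n x f g :
  same_jet n x f g <-> forall s, (size s <= n)%N -> iter_pd s f x = iter_pd s g x.
Proof.
elim: n f g => [|n IH] f g /=.
  by split=> [[fg _] [|]//|H]; split=> //; exact: (H [::]).
split=> [[fg H] s|H].
  case/lastP: s => [|s i]; first by [].
  by rewrite size_rcons ltnS !iter_pd_rcons => sn; exact: (iffLR (IH _ _) (H i)).
split; first exact: (H [::]).
by move=> i; apply/IH => s sn; rewrite -!iter_pd_rcons; apply: H; rewrite size_rcons.
Qed.

Lemma same_jet_eq n D x f g : open D -> D x -> (forall y, D y -> f y = g y) ->
  same_jet n x f g.
Proof.
move=> oD Dx fg; apply/same_jetP => s _.
elim: s x Dx => [|i s IH] x Dx; first exact: fg.
exact: near_iterated_derive oD IH Dx.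
Qed.

Lemma same_jet_trans n x f g h : same_jet n x f g -> same_jet n x g h -> same_jet n x f h.
Proof. by move=> /same_jetP fg /same_jetP gh; apply/same_jetP => s sn; rewrite fg// gh. Qed.

Lemma same_jet_sym n x f g : same_jet n x f g -> same_jet n x g f.
Proof. by move=> /same_jetP fg; apply/same_jetP => s sn; rewrite fg. Qed.

Lemma same_jet_refl n x f : same_jet n x f f.
Proof. by apply/same_jetP. Qed.

Lemma same_jetW n x f g : same_jet n.+1 x f g -> same_jet n x f g.
Proof. by move=> /same_jetP fg; apply/same_jetP => s sn; rewrite fg// ltnW. Qed.

Lemma same_jetD n D x f f' g g' : open D -> D x ->
  (forall k, [/\ tempered k D set0 xpred0 f, tempered k D set0 xpred0 f',
     tempered k D set0 xpred0 g & tempered k D set0 xpred0 g']) ->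
  same_jet n x f f' -> same_jet n x g g' ->
  same_jet n x (fun y => f y + g y) (fun y => f' y + g' y).
Proof.
move=> oD Dx; elim: n f f' g g' => [|n IH] f f' g g' T [ff' dff'] [gg' dgg'].
  by split=> //; rewrite ff' gg'.
split; first by rewrite ff' gg'.
move=> i.
have dE h h' : tempered 1 D set0 xpred0 h -> tempered 1 D set0 xpred0 h' ->
    same_jet n x ('D_(e_ i) (fun y => h y + h' y))
      (fun y => 'D_(e_ i) h y + 'D_(e_ i) h' y).
  move=> hT hT'; apply: (same_jet_eq _ oD) => // y Dy.
  by have [_ ->] := is_deriveD (tempered_is_derive i Dy hT) (tempered_is_derive i Dy hT').
have [T1 T2 T3 T4] := T 1%N.
apply: same_jet_trans (dE _ _ T1 T3) _.
apply: same_jet_trans _ (same_jet_sym (dE _ _ T2 T4)).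
apply: IH; [|exact: dff'|exact: dgg'].
move=> k; have [S1 S2 S3 S4] := T k.+1.
by split; [exact: (tempered_derive i S1)|exact: (tempered_derive i S2)
  |exact: (tempered_derive i S3)|exact: (tempered_derive i S4)].
Qed.

Lemma same_jetM n D x f f' g g' : open D -> D x ->
  (forall k, [/\ tempered k D set0 xpred0 f, tempered k D set0 xpred0 f',
     tempered k D set0 xpred0 g & tempered k D set0 xpred0 g']) ->
  same_jet n x f f' -> same_jet n x g g' ->
  same_jet n x (fun y => f y * g y) (fun y => f' y * g' y).
Proof.
move=> oD Dx; elim: n f f' g g' => [|n IH] f f' g g' T ff' gg'.
  by case: ff' gg' => [ff' _] [gg' _]; split=> //; rewrite ff' gg'.
have ff'W := same_jetW ff'; have gg'W := same_jetW gg'.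
case: ff' gg' => [ff' dff'] [gg' dgg']; split; first by rewrite ff' gg'.
move=> i.
have dE h h' : tempered 1 D set0 xpred0 h -> tempered 1 D set0 xpred0 h' ->
    same_jet n x ('D_(e_ i) (fun y => h y * h' y))
      (fun y => h y * 'D_(e_ i) h' y + h' y * 'D_(e_ i) h y).
  move=> hT hT'; apply: (same_jet_eq _ oD) => // y Dy.
  by have [_ ->] := is_deriveM (tempered_is_derive i Dy hT) (tempered_is_derive i Dy hT').
have [T1 T2 T3 T4] := T 1%N.
apply: same_jet_trans (dE _ _ T1 T3) _.
apply: same_jet_trans _ (same_jet_sym (dE _ _ T2 T4)).
have TD k : [/\ tempered k D set0 xpred0 ('D_(e_ i) f), tempered k D set0 xpred0 ('D_(e_ i) f'),
    tempered k D set0 xpred0 ('D_(e_ i) g) & tempered k D set0 xpred0 ('D_(e_ i) g')].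
  have [S1 S2 S3 S4] := T k.+1.
  by split; [exact: (tempered_derive i S1)|exact: (tempered_derive i S2)
    |exact: (tempered_derive i S3)|exact: (tempered_derive i S4)].
apply: (same_jetD oD) => //.
- by move=> k; have [? ? ? ?] := T k; have [? ? ? ?] := TD k; split; exact: temperedM.
- apply: IH => //; [|exact: dgg'].
  by move=> k; have [? ? ? ?] := T k; have [? ? ? ?] := TD k; split.
- apply: IH => //; [|exact: dff'].
  by move=> k; have [? ? ? ?] := T k; have [? ? ? ?] := TD k; split.
Qed.

Lemma same_jet_sum n D x (I : finType) (F G : I -> 'rV[R]_a -> R) : open D -> D x ->
  (forall i k, tempered k D set0 xpred0 (F i)) ->
  (forall i k, tempered k D set0 xpred0 (G i)) ->
  (forall i, same_jet n x (F i) (G i)) ->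
  same_jet n x (fun y => \sum_i F i y) (fun y => \sum_i G i y).
Proof.
move=> oD Dx FT GT FG.
have sT (E : I -> 'rV[R]_a -> R) (ET : forall i k, tempered k D set0 xpred0 (E i))
    (r : seq I) k : tempered k D set0 xpred0 (fun y => \sum_(i <- r) E i y).
  elim: r => [|i r IH].
    by apply: tempered_eq (tempered_cst k _ _ 0 oD) => // y _; rewrite big_nil.
  by apply: tempered_eq (temperedD oD (ET i k) IH) => // y _; rewrite big_cons.
suff : forall r : seq I, same_jet n x (fun y => \sum_(i <- r) F i y)
    (fun y => \sum_(i <- r) G i y) by exact.
elim=> [|i r IH].
  by apply: (same_jet_eq _ oD) => // y _; rewrite !big_nil.
apply: same_jet_trans (same_jet_eq _ oD Dx (fun y _ => big_cons _ _ _ _ _ _)) _.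
apply: same_jet_trans _ (same_jet_sym (same_jet_eq _ oD Dx (fun y _ => big_cons _ _ _ _ _ _))).
by apply: (same_jetD oD) => // k; split => //; exact: sT.
Qed.

End OneSpace.

(** Induction on the order: the chain rule expresses the derivative of a
    composite by products of functions whose jets of one order less agree. *)
Lemma same_jet_comp n a b (D1 : set 'rV[R]_a) (D2 : set 'rV[R]_b) x
    (phi psi : 'rV[R]_a -> 'rV[R]_b) (f g : 'rV[R]_b -> R) :
  open D1 -> open D2 -> D1 x ->
  (forall y, D1 y -> D2 (phi y)) -> (forall y, D1 y -> D2 (psi y)) ->
  (forall j k, tempered k D1 set0 xpred0 (fun y => phi y 0 j)) ->
  (forall j k, tempered k D1 set0 xpred0 (fun y => psi y 0 j)) ->
  (forall k, tempered k D2 set0 xpred0 f) -> (forall k, tempered k D2 set0 xpred0 g) ->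
  phi x = psi x ->
  (forall j, same_jet n x (fun y => phi y 0 j) (fun y => psi y 0 j)) ->
  same_jet n (phi x) f g ->
  same_jet n x (f \o phi) (g \o psi).
Proof.
move=> oD1 oD2 Dx phiD psiD phiT psiT fT gT xE; elim: n f g fT gT => [|n IH] f g fT gT jets fg.
  by case: fg => [fg _]; split => //=; rewrite fg xE.
have fgW := same_jetW fg; have jetsW j := same_jetW (jets j).
case: fg => [fg dfg]; split; first by rewrite /= fg xE.
move=> i.
have dE (h : 'rV[R]_b -> R) (th : 'rV[R]_a -> 'rV[R]_b) : (forall y, D1 y -> D2 (th y)) ->
    (forall j k, tempered k D1 set0 xpred0 (fun y => th y 0 j)) ->
    (forall k, tempered k D2 set0 xpred0 h) ->
    same_jet n x ('D_(e_ i) (h \o th))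
      (fun y => \sum_j 'D_(e_ i) (fun y => th y 0 j) y * 'D_(e_ j) h (th y)).
  move=> thD thT hT; apply: (same_jet_eq _ oD1) => // y Dy.
  suff [] : is_derive y (e_ i) (h \o th)
    (\sum_j 'D_(e_ i) (fun y => th y 0 j) y * 'D_(e_ j) h (th y)) by [].
  apply: (is_derive_comp_C1 (d := fun j => 'D_(e_ j) h)).
  - move=> j; exact: (tempered_is_derive i Dy (thT j 1%N)).
  - have := near_open oD2 (thD y Dy); apply: filterS => y' Dy' j.
    exact: (tempered_is_derive j Dy' (hT 1%N)).
  - move=> j; exact: (tempered_continuous (tempered_derive j (hT 1%N)) (thD y Dy)).
apply: same_jet_trans (dE _ _ phiD phiT fT) _.
apply: same_jet_trans _ (same_jet_sym (dE _ _ psiD psiT gT)).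
have dT (th : 'rV[R]_a -> 'rV[R]_b) j k : (forall j k, tempered k D1 set0 xpred0 (fun y => th y 0 j)) ->
    tempered k D1 set0 xpred0 ('D_(e_ i) (fun y => th y 0 j)).
  by move=> thT; exact: (tempered_derive i (thT j k.+1)).
have cT (h : 'rV[R]_b -> R) (th : 'rV[R]_a -> 'rV[R]_b) j k : (forall y, D1 y -> D2 (th y)) ->
    (forall j k, tempered k D1 set0 xpred0 (fun y => th y 0 j)) ->
    (forall k, tempered k D2 set0 xpred0 h) ->
    tempered k D1 set0 xpred0 ('D_(e_ j) h \o th).
  move=> thD thT hT; apply: (@tempered_comp _ _ _ _ D1 set0 D2 set0 _ xpred0) => //.
  exact: (tempered_derive j (hT k.+1)).
apply: (same_jet_sum oD1) => //.
- move=> j k; apply: temperedM => //; first exact: (dT phi).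
  exact: (cT f phi).
- move=> j k; apply: temperedM => //; first exact: (dT psi).
  exact: (cT g psi).
- move=> j; apply: (same_jetM oD1) => //.
  + by move=> k; split; [exact: (dT phi)|exact: (dT psi)|exact: (cT f phi)|exact: (cT g psi)].
  + by have [_ /(_ i)] := jets j.
  + apply: (IH ('D_(e_ j) f) ('D_(e_ j) g)); [| |exact: jetsW|exact: dfg].
    * by move=> k; exact: (tempered_derive j (fT k.+1)).
    * by move=> k; exact: (tempered_derive j (gT k.+1)).
Qed.

End JetEquality.

Section TaylorPolynomial.
Variable R : realType.
Local Notation e_ i := (coord_vec R i).
Local Notation iter_pd s f := (iterated_derive [seq e_ i | i <- s] f).

Lemma is_derive_bigsum (V : normedModType R) (I : finType) (P : pred I)
    (F : I -> V -> R) (d : I -> R) x v :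
  (forall i, P i -> is_derive x v (F i) (d i)) ->
  is_derive x v (fun y => \sum_(i | P i) F i y) (\sum_(i | P i) d i).
Proof.
move=> dF; suff : forall r : seq I,
  is_derive x v (fun y => \sum_(i <- r | P i) F i y) (\sum_(i <- r | P i) d i) by exact.
elim=> [|i r IH].
  rewrite big_nil (_ : (fun y => _) = cst 0); first exact: is_derive_cst.
  by apply/funext => y; rewrite big_nil.
have [Pi|nPi] := boolP (P i); last first.
  rewrite big_cons (negbTE nPi) (_ : (fun y => _) = (fun y => \sum_(j <- r | P j) F j y))//.
  by apply/funext => y; rewrite big_cons (negbTE nPi).
rewrite big_cons Pi (_ : (fun y => _) = (F i \+ (fun y => \sum_(j <- r | P j) F j y))).
  exact: is_deriveD (dF i Pi) IH.
by apply/funext => y; rewrite big_cons Pi.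
Qed.

Lemma is_derive_const_along (V W : normedModType R) (f : V -> W) x v :
  (forall t : R, f (t *: v + x) = f x) -> is_derive x v f 0.
Proof.
move=> fx; suff H : (fun h : R => h^-1 *: (f (h *: v + x) - f x)) @ 0^' --> (0 : W).
  by split; [apply/cvg_ex; exists 0|exact: cvg_lim H].
by under eq_fun do rewrite fx subrr scaler0; exact: cvg_cst.
Qed.

Variable p : nat.
Implicit Types (J : 'I_p -> nat) (x y : 'rV[R]_p).

(** The divided powers of y - x, dual to the partial derivatives at x. *)
Definition monomial x J y : R := \prod_i ((y 0 i - x 0 i) ^+ J i / (J i)`!%:R).

Lemma tempered_monomial k (D K : set 'rV[R]_p) B x J : open D -> tempered k D K B (monomial x J).
Proof.
move=> oD; apply: tempered_prod => // i _; apply: temperedM => //; last exact: tempered_cst.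
by apply: temperedX => //; apply: temperedB => //; [exact: tempered_coord|exact: tempered_cst].
Qed.

Lemma derive_monomial x J l y : 'D_(e_ l) (monomial x J) y =
  if (0 < J l)%N then monomial x (fun i => J i - (i == l))%N y else 0.
Proof.
pose r y := \prod_(i | i != l) ((y 0 i - x 0 i) ^+ J i / (J i)`!%:R).
have dr : is_derive y (e_ l) r 0.
  apply: is_derive_const_along => t; apply: eq_bigr => i il.
  by rewrite !mxE (negbTE il) mulr0 add0r.
(* The factor that depends on the coordinate l; the others form r, which is
   constant along e_l. *)
pose g (t : R) : R := (t - x 0 l) ^+ J l / (J l)`!%:R.
have dg : is_derive (y 0 l) (1 : R) g (if (0 < J l)%N then
    (y 0 l - x 0 l) ^+ (J l).-1 / ((J l).-1)`!%:R else 0).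
  have d0 := is_deriveB (is_derive_id (y 0 l) (1 : R)) (is_derive_cst (x 0 l) (y 0 l) (1 : R)).
  have d1 := is_deriveX (J l) d0.
  have d2 := is_deriveM d1 (is_derive_cst ((J l)`!%:R^-1 : R) (y 0 l) (1 : R)).
  rewrite (_ : g = (id - cst (x 0 l)) ^+ J l * cst ((J l)`!%:R^-1 : R)); last first.
    by apply/funext => t; rewrite exprfctE.
  apply: (is_derive_eq d2); rewrite scaler0 add0r /GRing.scale/= subr0 mulr1.
  case: (J l) => [|j]; first by rewrite mul0r mulr0.
  have a0 : (j.+1)%:R != 0 :> R by rewrite pnatr_eq0.
  have b0 : (j`!)%:R != 0 :> R by rewrite pnatr_eq0 -lt0n fact_gt0.
  rewrite /= factS natrM fctE/=; move: (j.+1)%:R (j`!)%:R a0 b0 => u v u0 v0.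
  by field; rewrite u0 v0.
have dgl := is_derive_coord_comp l dg; rewrite eqxx mul1r in dgl.
have -> : monomial x J = (fun y => g (y 0 l)) * r.
  by apply/funext => y'; rewrite /monomial (bigD1 l).
have [_ ->] := is_deriveM dgl dr.
rewrite scaler0 add0r; case: ifPn => J0; last by rewrite scaler0.
rewrite /monomial (bigD1 l)//= eqxx subn1 /GRing.scale/= mulrC; congr (_ * _).
by apply: eq_bigr => i il; rewrite (negbTE il) subn0.
Qed.

Lemma iter_pd_monomial x J s y : iter_pd s (monomial x J) y =
  if [forall i, (count_mem i s <= J i)%N]
  then monomial x (fun i => J i - count_mem i s)%N y else 0.
Proof.
elim: s y => [|l s IH] y.
  by rewrite ifT//; [apply: eq_bigr => i _; rewrite subn0|apply/forallP].
rewrite /= (funext IH).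
have [sJ|/forallPn[i si]] := boolP [forall i, (count_mem i s <= J i)%N]; last first.
  rewrite ifF; first exact: derive_cst.
  apply/negbTE/forallPn; exists i; apply: contra si; apply: leq_trans.
  exact: leq_addl.
move/forallP in sJ.
rewrite derive_monomial subn_gt0; have [sl|sl] := ltnP; last first.
  rewrite ifF//; apply/negbTE/forallPn; exists l.
  by rewrite eqxx -ltnNge ltnS.
rewrite ifT; last first.
  apply/forallP => i; have [<-|il] := eqVneq l i; first exact: sl.
  by rewrite add0n.
apply: eq_bigr => i _; rewrite -subnDA addnC (eq_sym l i).
by congr (_ ^+ _ / _`!%:R).
Qed.

Lemma monomial_center x J : monomial x J x = [forall i, J i == 0%N]%:R.
Proof.
have [/forallP J0|/forallPn[i Ji]] := boolP [forall i, J i == 0%N].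
  rewrite /monomial big1// => i _; rewrite (eqP (J0 i)) expr0 fact0.
  by rewrite invr1 mul1r.
by rewrite /monomial (bigD1 i)//= subrr expr0n (negbTE Ji) mul0r mul0r.
Qed.

Lemma iter_pd_lincomb (I : finType) (P : pred I) (w : I -> R)
    (f : I -> 'rV[R]_p -> R) s y :
  (forall i k, tempered k setT set0 xpred0 (f i)) ->
  iter_pd s (fun y => \sum_(i | P i) w i * f i y) y = \sum_(i | P i) w i * iter_pd s (f i) y.
Proof.
move=> fT; elim: s y => //= l s IH y; rewrite (funext IH).
suff [] : is_derive y (e_ l) (fun y => \sum_(i | P i) w i * iter_pd s (f i) y)
  (\sum_(i | P i) w i * 'D_(e_ l) (iter_pd s (f i)) y) by [].
apply: is_derive_bigsum => i _.
have sT k : tempered k setT set0 xpred0 (iter_pd s (f i)).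
  elim: s k {IH} => [|l' s IH] k; first exact: fT.
  exact: (tempered_derive l' (IH k.+1)).
have := is_deriveM (is_derive_cst (w i) y (e_ l)) (tempered_is_derive l (Logic.I : setT y) (sT 1%N)).
by move=> H; apply: (is_derive_eq H); rewrite scaler0 addr0.
Qed.

Variables q n : nat.
Local Notation V := #|jet_var p q n|.

(** The coordinates of v are read as derivatives at x, whatever the order in
    which the jet variables are enumerated. *)
Definition taylor x (v : 'rV[R]_V) (alpha : 'I_q) y : R :=
  \sum_(c | var_dep (enum_val c) == alpha) v 0 c * monomial x (var_order (enum_val c)) y.

Definition taylor_map x (v : 'rV[R]_V) y : 'rV[R]_q := \row_alpha taylor x v alpha y.

Lemma jet_var_inj (c c' : jet_var p q n) : var_dep c = var_dep c' ->
  (forall i, var_order c i = var_order c' i) -> c = c'.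
Proof.
case: c c' => [k [a J]] [k' [a' J']]; rewrite /var_dep /var_order /= => <- JJ'.
have kk' : k = k'.
  apply: val_inj; rewrite /= -(eqP (valP J)) -(eqP (valP J')).
  by apply: eq_bigr => i _; exact: JJ'.
case: _ / kk' J' JJ' => J' JJ'; suff -> : J = J' by [].
by apply: val_inj; apply/ffunP => i; apply: val_inj; exact: JJ'.
Qed.

(** Duality of divided powers and partial derivatives, which picks the
    coefficient of the same multi-index. *)
Lemma pr_taylor x v : pr n (taylor_map x v) x = v.
Proof.
apply/rowP => c; rewrite mxE multi_deriveE; set alpha := var_dep _.
have -> : (fun y => taylor_map x v y 0 alpha) = taylor x v alpha.
  by apply/funext => y; rewrite mxE.
rewrite /taylor iter_pd_lincomb; last by move=> i k; exact/tempered_monomial/openT.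
rewrite (bigD1 c)//= big1 ?addr0 => [|c' /andP[/eqP c'a c'c]].
  rewrite iter_pd_monomial ifT; last by apply/forallP => i; rewrite count_canonical_seq.
  rewrite monomial_center (_ : [forall i, _]) ?mulr1//.
  by apply/forallP => i; rewrite count_canonical_seq subnn.
rewrite iter_pd_monomial; case: ifPn; last by rewrite mulr0.
move=> /forallP le_c; rewrite monomial_center; case: forallP; last by rewrite mulr0.
move=> ge_c; case/negP: c'c; apply/eqP/enum_val_inj; apply: jet_var_inj => // i.
apply/eqP; rewrite eqn_leq; have := ge_c i; have := le_c i.
by rewrite count_canonical_seq subn_eq0 => -> ->.
Qed.

(** The coordinates of the jet are the derivatives for one ordering of each
    multi-index; by symmetry they determine all derivatives up to order n. *)
Lemma pr_same_jet (D : set 'rV[R]_p) (u u' : 'rV[R]_p -> 'rV[R]_q) x alpha :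
  open D -> D x ->
  (forall k, tempered k D set0 xpred0 (fun y => u y 0 alpha)) ->
  (forall k, tempered k D set0 xpred0 (fun y => u' y 0 alpha)) ->
  pr n u x = pr n u' x ->
  same_jet n x (fun y => u y 0 alpha) (fun y => u' y 0 alpha).
Proof.
move=> oD Dx uT u'T uu'; apply/same_jetP => s sn.
rewrite (iterated_derive_count _ oD uT Dx) (iterated_derive_count _ oD u'T Dx).
pose k : 'I_n.+1 := @Ordinal n.+1 (size s) sn.
have cs i : (count_mem i s < k.+1)%N by rewrite ltnS count_size.
have Jk : (\sum_i [ffun i => Ordinal (cs i)] i == k)%N.
  under eq_bigr do rewrite ffunE.
  rewrite /= -size_canonical_seq; apply/eqP/perm_size; rewrite perm_sym.
  exact: perm_canonical_seq.
pose c : jet_var p q n := Tagged (fun k : 'I_n.+1 => ('I_q * multi_index p k)%type)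
  (alpha, exist _ [ffun i => Ordinal (cs i)] Jk : multi_index p k).
have := congr1 (fun v : 'rV[R]_V => v 0 (enum_rank c)) uu'; rewrite !mxE enum_rankK.
have -> : var_order c = (fun i => count_mem i s).
  by apply/funext => i; rewrite /var_order /= ffunE.
by [].
Qed.

End TaylorPolynomial.

(** * Functions depending on the group parameter *)

Section TimeParameter.
Variable R : realType.
Local Notation e_ i := (coord_vec R i).
Local Notation iter_pd s f := (iterated_derive [seq e_ i | i <- s] f).

Lemma slowly_increasing_tempered p m r c (D : set 'rV[R]_(p + m))
    (F : 'rV[R]_(p + m) -> 'M[R]_(r, c)) (K : set 'rV[R]_p) i j :
  open D -> slowly_increasing D F -> compact K -> K `<=` lsubmx @` D ->
  forall k, tempered k D (tube K) predT (fun z => F z i j).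
Proof.
move=> oD FS cK KD; have [_ Fs _] := FS.
have Fsij := (iffLR (smooth_on_entries F oD) Fs) i j.
apply: iterated_growth_tempered => // s _.
have G := slowly_increasing_growth (fun i => count_mem i s) FS cK KD.
apply: growth_le G => // z Dz _.
rewrite (iterated_derive_count _ oD (smooth_on_tempered xpred0 Fsij) Dz).
by rewrite /multi_derive -(smooth_on_entry _ _ _ oD Fs Dz) normr_id ler_mx_norm.
Qed.

(** Continuous functions are bounded on compact sets, in all directions. *)
Lemma compact_tempered a (D K : set 'rV[R]_a) B f : open D -> compact K -> K `<=` D ->
  (forall k, tempered k D set0 xpred0 f) -> forall k, tempered k D K B f.
Proof.
move=> oD cK KD fT; have fs := tempered_smooth_on oD fT.
apply: iterated_growth_tempered => // s _.
have cs : {within K, continuous (iter_pd s f)}.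
  apply: continuous_in_subspaceT => x; rewrite inE => /KD Dx.
  exact: (fs _ _ Dx).1.
have [C [_ CP]] := compact_bounded (continuous_compact cs cK).
exists (C + 1), 0%N => x _ Kx; rewrite expr0 mulr1.
by apply: CP; rewrite ?ltrDl//; exists x.
Qed.

Variable m : nat.

Definition time (y : 'rV[R]_(1 + m)) : R := y 0 (lshift m ord0).

Lemma with_timeK (y : 'rV[R]_(1 + m)) : with_time (time y) (rsubmx y) = y.
Proof.
rewrite -[RHS]hsubmxK /with_time; congr row_mx; apply/matrixP => i j.
by rewrite !mxE ord1 /time (ord1 j).
Qed.

Lemma time_with_time t (w : 'rV[R]_m) : time (with_time t w) = t.
Proof. by rewrite /time row_mxEl mxE. Qed.

Lemma iter_pd_row_mx a b (f : 'rV[R]_(a + b) -> R) (v : 'rV[R]_a) s w :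
  iter_pd s (fun w => f (row_mx v w)) w = iter_pd (map (@rshift a b) s) f (row_mx v w).
Proof.
rewrite (iterated_derive_comp_affine (h := row_mx v) (L := row_mx 0)); last first.
  by move=> t u u'; rewrite scale_row_mx add_row_mx scaler0 add0r.
rewrite /=; congr (iterated_derive _ _ _); rewrite -!map_comp.
by apply: eq_map => i; exact: row_mx0_coord.
Qed.

Lemma time_state_continuous : continuous (fun y : 'rV[R]_(1 + m) => (time y, rsubmx y)).
Proof.
move=> y; have c1 : {for y, continuous time} by exact: coord_continuous.
have c2 : {for y, continuous (fun y : 'rV[R]_(1 + m) => rsubmx y)} by exact: rsubmx_continuous.
exact: (cvg_pair c1 c2).
Qed.

Lemma open_at_time (dom : set (R * 'rV[R]_m)) :
  open dom -> open [set y | dom (time y, rsubmx y)].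
Proof.
move=> od; apply: (@open_comp _ _ (fun y : 'rV[R]_(1 + m) => (time y, rsubmx y))) => // y _.
exact: time_state_continuous.
Qed.

Lemma timed_tempered r (g : R -> 'rV[R]_m -> 'rV[R]_r) (dom : set (R * 'rV[R]_m)) B j :
  open dom -> smooth_on dom (fun t => g t.1 t.2) ->
  forall k, tempered k [set y | dom (time y, rsubmx y)] set0 B
    (fun y => g (time y) (rsubmx y) 0 j).
Proof.
move=> od gs; apply: smooth_on_tempered.
pose h (y : 'rV[R]_(1 + m)) := (time y, rsubmx y).
have hc : continuous h.
  exact: time_state_continuous.
have hL (t : R) u w : h (t *: u + w) = t *: h u + h w.
  by rewrite /h /time !mxE linearD linearZ.
have H := smooth_on_comp_affine hL hc gs.
exact: (iffLR (smooth_on_entries _ (open_at_time od)) H 0 j).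
Qed.

(** At a fixed group parameter, the derivatives along the remaining directions
    are those of the restricted function. *)
Lemma tempered_at_time (D : set 'rV[R]_(1 + m)) (f : 'rV[R]_(1 + m) -> R) t
    (Dt K : set 'rV[R]_m) : smooth_on D f ->
  (forall w, D (with_time t w) -> Dt w) ->
  (forall k, tempered k Dt K predT (fun w => f (with_time t w))) ->
  forall k, tempered k D [set y | time y = t /\ K (rsubmx y)] (fun i => (0 < i)%N) f.
Proof.
move=> fs DDt fT; apply: iterated_growth_tempered => // s sB.
have [s' ->] : exists s' : seq 'I_m, s = map (@rshift 1 m) s'.
  elim: s sB => [|i s IH] /=; first by exists [::].
  move=> /andP[i0 /IH[s' ->]]; have [l il|l il] := fintype.splitP i.
    by rewrite il (ord1 l) in i0.
  by exists (l :: s'); congr (_ :: _); exact: val_inj.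
have sT : all predT s' by apply/allP.
have G := tempered_growth (tempered_iterated fT sT 0%N).
have D1 : forall x, (D x) -> [set y | time y = t /\ K (rsubmx y)] x ->
    Dt (rsubmx x) /\ K (rsubmx x).
  move=> x Dx [xt Kx]; split => //; apply: DDt.
  by rewrite -xt with_timeK.
have Gx j : growth D [set y | time y = t /\ K (rsubmx y)] (fun x : 'rV[R]_(1 + m) => rsubmx x 0 j).
  apply: growth_le (growth_coord D _ (rshift 1 j)) => // x _ _.
  by rewrite mxE.
have [C [n CP]] := growth_comp D1 Gx G.
exists C, n => x Dx Kx; have := CP x Dx Kx; case: Kx => xt _.
by rewrite /= /with_time iter_pd_row_mx -/(with_time t _) -xt with_timeK.
Qed.

End TimeParameter.

(** * The prolonged action *)

Lemma row_mx_continuous (R : realType) a b (v : 'rV[R]_a) :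
  continuous (fun w : 'rV[R]_b => row_mx v w).
Proof.
move=> w; apply: continuous_mx => i j; have [l jl|l jl] := fintype.splitP j.
  have -> : j = lshift b l by exact: val_inj.
  by apply: continuous_ext (@cst_continuous _ _ (v i l) w) => y; rewrite row_mxEl.
have -> : j = rshift a l by exact: val_inj.
apply: continuous_ext (@coord_continuous _ _ _ 0 l w) => y.
by rewrite row_mxEr (ord1 i).
Qed.

Section Prolongation.
Variables (R : realType) (p q n : nat).
Local Notation e_ i := (coord_vec R i).
Local Notation iter_pd s f := (iterated_derive [seq e_ i | i <- s] f).
Local Notation V := #|jet_var p q n|.
Local Notation N := (p + V)%N.
Variables (M : set 'rV[R]_(p + q)) (eta0 : R) (dom : set (R * 'rV[R]_(p + q))).
Variables (Xi : R -> 'rV[R]_p -> 'rV[R]_p) (Phi : R -> 'rV[R]_(p + q) -> 'rV[R]_q).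
Hypothesis G : local_transformation_group M eta0 dom (projectable_action Xi Phi).
Hypothesis G_slow : slowly_increasing_group eta0 dom Xi Phi.

(** Slow increase of Phi eta presupposes that it is defined on full fibres. *)
Lemma dom_lsub eta z w : lsubmx w = lsubmx z -> dom (eta, z) -> dom (eta, w).
Proof.
move=> wz dz; have [eta_lt _] := ltg_dom G dz; have [fib _ _] := G_slow eta_lt.
by rewrite -(hsubmxK w) wz; apply: (fib _ (rsubmx z)); rewrite hsubmxK.
Qed.

Definition base_dom eta : set 'rV[R]_p := [set x | dom (eta, row_mx x 0)].

Lemma base_domP eta z : dom (eta, z) <-> base_dom eta (lsubmx z).
Proof. by split; apply: dom_lsub; rewrite row_mxKl. Qed.

Lemma base_dom_image eta : base_dom eta = lsubmx @` dom_at dom eta.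
Proof.
apply/seteqP; split => [x dx|_ [z dz <-]]; last exact: (iffLR (base_domP _ _) dz).
by exists (row_mx x 0); rewrite ?row_mxKl.
Qed.

(** The inverse law of the group, read on the independent variables. *)
Lemma Xi_inv eta x : base_dom eta x ->
  base_dom (- eta) (Xi eta x) /\ Xi (- eta) (Xi eta x) = x.
Proof.
move=> dx; have [dgx gg] := ltg_inv G dx.
have gE : lsubmx (projectable_action Xi Phi eta (row_mx x 0)) = Xi eta x.
  by rewrite row_mxKl row_mxKl.
split; first by move/base_domP: dgx; rewrite gE.
have := congr1 lsubmx gg; rewrite /projectable_action !row_mxKl; exact.
Qed.

Lemma open_dom_at eta : open (dom_at dom eta).
Proof.
apply: (@open_comp _ _ (fun w : 'rV[R]_(p + q) => (eta, w)) dom) (ltg_open G).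
move=> w _; have c1 : {for w, continuous (fun=> eta)} by exact: cst_continuous.
have c2 : {for w, continuous (@id 'rV[R]_(p + q))} by exact: cvg_id.
exact: (cvg_pair c1 c2).
Qed.

Definition timed_base_dom : set 'rV[R]_(1 + p) := [set y | base_dom (time y) (rsubmx y)].

Lemma state_continuous : continuous (fun y : 'rV[R]_(1 + p) => (time y, row_mx (rsubmx y) (0 : 'rV[R]_q))).
Proof.
move=> y; have c1 : {for y, continuous (@time R p)} by exact: coord_continuous.
have c2 : {for y, continuous (fun y : 'rV[R]_(1 + p) => row_mx (rsubmx y) (0 : 'rV[R]_q))}.
  apply: continuous_mx => i j; have [l jl|l jl] := fintype.splitP j.
    have -> : j = lshift q l by exact: val_inj.
    apply: continuous_ext (@coord_continuous _ _ _ 0 (rshift 1 l) y) => y'.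
    by rewrite row_mxEl mxE (ord1 i).
  have -> : j = rshift p l by exact: val_inj.
  by apply: continuous_ext (@cst_continuous _ _ (0 : R) y) => y'; rewrite row_mxEr mxE.
exact: (cvg_pair c1 c2).
Qed.

Lemma open_timed_base_dom : open timed_base_dom.
Proof.
apply: (@open_comp _ _ (fun y : 'rV[R]_(1 + p) => (time y, row_mx (rsubmx y) (0 : 'rV[R]_q))) dom)
  (ltg_open G) => y _.
exact: state_continuous.
Qed.

Lemma Xi_tempered k B l : tempered k timed_base_dom set0 B
  (fun y => Xi (time y) (rsubmx y) 0 l).
Proof.
apply: smooth_on_tempered.
pose h (y : 'rV[R]_(1 + p)) := (time y, row_mx (rsubmx y) (0 : 'rV[R]_q)).
have hL (t : R) u w : h (t *: u + w) = t *: h u + h w.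
  rewrite /h /time !mxE linearD linearZ; congr (_, _).
  by rewrite /= scale_row_mx add_row_mx scaler0 addr0.
have H := smooth_on_comp_affine hL state_continuous (ltg_smooth G).
have := iffLR (smooth_on_entries _ open_timed_base_dom) H 0 (lshift q l).
rewrite (_ : (fun y => _) = (fun y => Xi (time y) (rsubmx y) 0 l))//.
by apply/funext => y; rewrite /= row_mxEl row_mxKl.
Qed.

Lemma open_base_dom eta : open (base_dom eta).
Proof.
rewrite (_ : base_dom eta = with_time eta @^-1` timed_base_dom).
  apply: (@open_comp _ _ (fun x : 'rV[R]_p => with_time eta x) timed_base_dom) open_timed_base_dom => x _.
  exact: row_mx_continuous.
by apply/seteqP; split => x; rewrite /timed_base_dom/= time_with_time rsubmx_with_time.
Qed.

Lemma Xi_at_tempered eta k B l :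
  tempered k (base_dom eta) set0 B (fun x => Xi eta x 0 l).
Proof.
have h x : (fun y : 'rV[R]_(1 + p) => Xi (time y) (rsubmx y) 0 l) (with_time eta x) = Xi eta x 0 l.
  by rewrite time_with_time rsubmx_with_time.
apply: tempered_eq (fun x _ => h x) _; first exact: open_base_dom.
apply: (@tempered_comp _ k _ _ (base_dom eta) set0 timed_base_dom set0 B predT
  (fun y => Xi (time y) (rsubmx y) 0 l) (fun x => with_time eta x)) => //.
- exact: open_base_dom.
- exact: open_timed_base_dom.
- by move=> x; rewrite /timed_base_dom/= time_with_time rsubmx_with_time.
- move=> j; have [i ji|i ji] := fintype.splitP j.
    have -> : j = lshift p i by exact: val_inj.
    rewrite (_ : (fun x => _) = (fun=> eta)); first exact/tempered_cst/open_base_dom.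
    by apply/funext => x; rewrite row_mxEl mxE.
  have -> : j = rshift 1 i by exact: val_inj.
  rewrite (_ : (fun x => _) = (fun x : 'rV[R]_p => x 0 i)); first exact/tempered_coord/open_base_dom.
  by apply/funext => x; rewrite row_mxEr.
- exact: Xi_tempered.
Qed.

Lemma Xi_continuous eta x : base_dom eta x -> {for x, continuous (Xi eta)}.
Proof.
move=> dx; apply: continuous_mx => i l; rewrite (ord1 i).
exact: (tempered_continuous (Xi_at_tempered eta 0 xpred0 l) dx).
Qed.

Lemma Xi_image eta (K : set 'rV[R]_p) : compact K -> K `<=` base_dom eta ->
  [/\ compact (Xi eta @` K), Xi eta @` K `<=` base_dom (- eta) &
   forall y, base_dom (- eta) y -> K (Xi (- eta) y) -> (Xi eta @` K) y].
Proof.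
move=> cK KD; split.
- apply: continuous_compact cK; apply: continuous_in_subspaceT => x.
  by rewrite inE => /KD; exact: Xi_continuous.
- by move=> _ [x Kx <-]; have [] := Xi_inv (KD _ Kx).
- move=> y dy Ky; exists (Xi (- eta) y) => //.
  by have [_] := Xi_inv dy; rewrite opprK.
Qed.

(** Over a compact set of independent variables there is nothing to bound at
    infinity, because Xi does not involve the dependent ones. *)
Lemma Xi_tempered_at eta (K : set 'rV[R]_p) k B l : compact K -> K `<=` base_dom eta ->
  tempered k timed_base_dom [set y | time y = eta /\ K (rsubmx y)] B
    (fun y => Xi (time y) (rsubmx y) 0 l).
Proof.
move=> cK KD.
have -> : [set y : 'rV[R]_(1 + p) | time y = eta /\ K (rsubmx y)] = with_time eta @` K.
  apply/seteqP; split => [y [<- Ky]|_ [x Kx <-]].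
    by exists (rsubmx y) => //; rewrite with_timeK.
  by rewrite /= time_with_time rsubmx_with_time.
apply: compact_tempered; first exact: open_timed_base_dom.
- apply: continuous_compact cK; apply: continuous_subspaceT.
  exact: row_mx_continuous.
- move=> _ [x /KD Kx <-].
  by rewrite /timed_base_dom/= time_with_time rsubmx_with_time.
- by move=> k'; exact: Xi_tempered.
Qed.

Lemma open_timed_dom : open [set y : 'rV[R]_(1 + (p + q)) | dom (time y, rsubmx y)].
Proof. exact/open_at_time/(ltg_open G). Qed.

Lemma Phi_at_tempered eta k alpha :
  tempered k (dom_at dom eta) set0 xpred0 (fun w => Phi eta w 0 alpha).
Proof.
have [eta_lt|eta_ge] := ltP `|eta| eta0.
  have [_ Ps _] := G_slow eta_lt; apply: smooth_on_tempered.
  have H := iffLR (smooth_on_entries (Phi eta) (@open_dom_at eta)) Ps 0 alpha.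
  exact: H.
apply: tempered_local => w dw.
by have [] := ltg_dom G dw; rewrite ltNge eta_ge.
Qed.

Lemma Phi_tempered_at eta (K : set 'rV[R]_p) k alpha : compact K -> K `<=` base_dom eta ->
  `|eta| < eta0 ->
  tempered k [set y : 'rV[R]_(1 + (p + q)) | dom (time y, rsubmx y)]
    [set y | time y = eta /\ tube K (rsubmx y)] (fun i => (0 < i)%N)
    (fun y => Phi (time y) (rsubmx y) 0 alpha).
Proof.
move=> cK KD eta_lt; apply: (tempered_at_time (Dt := dom_at dom eta)).
- apply: (tempered_smooth_on (B := xpred0)); first exact: open_timed_dom.
  move=> k'; have := timed_tempered xpred0 (rshift p alpha) (ltg_open G) (ltg_smooth G) k'.
  apply: tempered_eq; first exact: open_timed_dom.
  by move=> y _; rewrite row_mxEr.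
- by move=> w /=; rewrite time_with_time rsubmx_with_time.
- have -> : (fun w => Phi (time (with_time eta w)) (rsubmx (with_time eta w)) 0 alpha) =
      (fun w => Phi eta w 0 alpha).
    by apply/funext => w; rewrite time_with_time rsubmx_with_time.
  apply: slowly_increasing_tempered => //; first exact: open_dom_at.
    exact: G_slow.
  by rewrite -base_dom_image.
Qed.

Definition trans_param (e : 'rV[R]_((1 + N) + p)) : R := time (lsubmx e).
Definition trans_jet (e : 'rV[R]_((1 + N) + p)) : 'rV[R]_N := rsubmx (lsubmx e).
Definition trans_preim (e : 'rV[R]_((1 + N) + p)) : 'rV[R]_p :=
  Xi (- trans_param e) (rsubmx e).

(** A point e is (eta, z, y): the function of y is the transform by g_eta of
    the Taylor polynomial of the jet z. Keeping y as a variable makes its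
    derivatives in y partial derivatives, which are then taken at y = Xi eta
    x. *)
Definition trans_taylor alpha (e : 'rV[R]_((1 + N) + p)) : R :=
  Phi (trans_param e) (row_mx (trans_preim e)
    (taylor_map (lsubmx (trans_jet e)) (rsubmx (trans_jet e)) (trans_preim e))) 0 alpha.

(** Only the preimage of y has to be defined: by [Xi_inv] it then belongs to
    the domain of g_eta, whose fibres are full. *)
Definition trans_dom : set 'rV[R]_((1 + N) + p) :=
  [set e | base_dom (- trans_param e) (rsubmx e)].

Definition trans_base (e : 'rV[R]_((1 + N) + p)) : 'rV[R]_(1 + p) :=
  with_time (- trans_param e) (rsubmx e).

Lemma trans_base_l e i : trans_base e 0 (lshift p i) = - e 0 (lshift p (lshift N ord0)).
Proof. by rewrite row_mxEl mxE /trans_param /time mxE. Qed.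

Lemma trans_base_r e i : trans_base e 0 (rshift 1 i) = e 0 (rshift (1 + N) i).
Proof. by rewrite row_mxEr mxE. Qed.

Lemma tempered_trans_base k D K B j : open D -> tempered k D K B (fun e => trans_base e 0 j).
Proof.
move=> oD; have [i ji|i ji] := fintype.splitP j.
  have -> : j = lshift p i by exact: val_inj.
  rewrite (funext (fun e => trans_base_l e i)).
  have := temperedZ (-1) oD (tempered_coord k K B (lshift p (lshift N ord0)) oD).
  by apply: tempered_eq => // e _; rewrite mulN1r.
have -> : j = rshift 1 i by exact: val_inj.
by rewrite (funext (fun e => trans_base_r e i)); exact: tempered_coord.
Qed.

Lemma trans_domE : trans_dom = trans_base @^-1` timed_base_dom.
Proof.
apply/seteqP; split => e; rewrite /timed_base_dom/trans_base/= time_with_time rsubmx_with_time;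
  exact.
Qed.

Lemma open_trans_dom : open trans_dom.
Proof.
rewrite trans_domE.
apply: (@open_comp _ _ trans_base timed_base_dom) open_timed_base_dom => e _.
apply: continuous_mx => i j; rewrite (ord1 i).
exact: (tempered_continuous (@tempered_trans_base 0 setT set0 xpred0 j openT) (Logic.I : setT e)).
Qed.

Definition jet_dom : set 'rV[R]_(1 + N) :=
  [set y | base_dom (time y) (lsubmx (rsubmx y))].

Definition base_of_jet (y : 'rV[R]_(1 + N)) : 'rV[R]_(1 + p) :=
  with_time (time y) (lsubmx (rsubmx y)).

(** The selection of (eta, x) among the coordinates (eta, z). *)
Definition base_coord (j : 'I_(1 + p)) : 'I_(1 + N) :=
  match fintype.split j with
  | inl i => lshift N i
  | inr i => rshift 1 (lshift V i)
  end.

Lemma base_of_jetE y j : base_of_jet y 0 j = y 0 (base_coord j).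
Proof.
rewrite mxE /base_coord; case: fintype.splitP => i _; rewrite !mxE//.
by rewrite /time (ord1 i).
Qed.

Lemma jet_domE : jet_dom = base_of_jet @^-1` timed_base_dom.
Proof.
by apply/seteqP; split => y; rewrite /timed_base_dom/= time_with_time rsubmx_with_time.
Qed.

Lemma open_jet_dom : open jet_dom.
Proof.
rewrite jet_domE.
apply: (@open_comp _ _ base_of_jet timed_base_dom) open_timed_base_dom => y _.
apply: continuous_mx => i j; rewrite (ord1 i).
apply: continuous_ext (@coord_continuous _ _ _ 0 (base_coord j) y) => y'.
by rewrite base_of_jetE.
Qed.

Section AtTime.
Variables (eta : R) (K : set 'rV[R]_p).
Hypothesis eta_lt : `|eta| < eta0.
Hypothesis cK : compact K.
Hypothesis KD : K `<=` base_dom eta.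

Let KE : set 'rV[R]_((1 + N) + p) := [set e | trans_param e = eta /\ K (trans_preim e)].
Let BE : pred 'I_((1 + N) + p) := fun i => (0 < i)%N.

Lemma tempered_trans_preim k l : tempered k trans_dom KE BE (fun e => trans_preim e 0 l).
Proof.
have [cK' K'D K'P] := Xi_image cK KD.
have h e : (fun y : 'rV[R]_(1 + p) => Xi (time y) (rsubmx y) 0 l) (trans_base e) =
    trans_preim e 0 l by rewrite time_with_time rsubmx_with_time.
apply: tempered_eq (fun e _ => h e) _; first exact: open_trans_dom.
apply: (@tempered_comp _ k _ _ trans_dom KE timed_base_dom
  [set y | time y = - eta /\ (Xi eta @` K) (rsubmx y)] BE predT
  (fun y => Xi (time y) (rsubmx y) 0 l) trans_base) => //.
- exact: open_trans_dom.
- exact: open_timed_base_dom.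
- by move=> e; rewrite trans_domE.
- move=> e De [te Ke]; rewrite /= time_with_time rsubmx_with_time te; split=> //.
  by apply: K'P; rewrite -te.
- by move=> j; exact/tempered_trans_base/open_trans_dom.
- exact: Xi_tempered_at.
Qed.

Definition trans_point e : 'rV[R]_(p + q) := row_mx (trans_preim e)
    (taylor_map (lsubmx (trans_jet e)) (rsubmx (trans_jet e)) (trans_preim e)).

Lemma tempered_trans_point k j : tempered k trans_dom KE BE (fun e => trans_point e 0 j).
Proof.
have oD := open_trans_dom.
have [i ji|i ji] := fintype.splitP j.
  have -> : j = lshift q i by exact: val_inj.
  rewrite (_ : (fun e => _) = (fun e => trans_preim e 0 i)); first exact: tempered_trans_preim.
  by apply/funext => e; rewrite row_mxEl.
have -> : j = rshift p i by exact: val_inj.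
rewrite (_ : (fun e => _) = (fun e : 'rV[R]_((1 + N) + p) =>
   \sum_(c < V | var_dep (enum_val c) == i)
   e 0 (lshift p (rshift 1 (rshift p c))) * \prod_l ((trans_preim e 0 l -
     e 0 (lshift p (rshift 1 (lshift V l)))) ^+ var_order (enum_val c) l
     * ((var_order (enum_val c) l)`!%:R)^-1))); last first.
  apply/funext => e; rewrite row_mxEr mxE; apply: eq_bigr => c _; rewrite !mxE.
  by congr (_ * _); apply: eq_bigr => l _; rewrite !mxE.
apply: tempered_sum => // c _; apply: temperedM => //; first exact: tempered_coord.
apply: tempered_prod => // l _; apply: temperedM => //; last exact: tempered_cst.
apply: temperedX => //; apply: temperedB => //; first exact: tempered_trans_preim.
exact: tempered_coord.
Qed.

Lemma trans_point_dom e : trans_dom e -> dom (trans_param e, trans_point e).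
Proof.
move=> De; apply/base_domP; rewrite row_mxKl.
by have [+ _] := Xi_inv De; rewrite opprK.
Qed.

Lemma tempered_trans_taylor k alpha : tempered k trans_dom KE BE (trans_taylor alpha).
Proof.
have oD := open_trans_dom.
pose phi e := with_time (trans_param e) (trans_point e).
have h e : (fun y : 'rV[R]_(1 + (p + q)) => Phi (time y) (rsubmx y) 0 alpha) (phi e) =
    trans_taylor alpha e by rewrite time_with_time rsubmx_with_time.
have phil i : (fun e => phi e 0 (lshift (p + q) i)) = (fun e => e 0 (lshift p (lshift N ord0))).
  by apply/funext => e; rewrite row_mxEl mxE /trans_param /time mxE.
apply: tempered_eq (fun e _ => h e) _ => //.
apply: (@tempered_comp _ k _ _ trans_dom KE _ _ BE _
  (fun y : 'rV[R]_(1 + (p + q)) => Phi (time y) (rsubmx y) 0 alpha) phi oD open_timed_dom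
  _ _ _ _ (Phi_tempered_at k alpha cK KD eta_lt)).
- by move=> e De /=; rewrite time_with_time rsubmx_with_time; exact: trans_point_dom.
- move=> e De [te Ke] /=; rewrite time_with_time rsubmx_with_time te; split=> //.
  by rewrite /tube/= row_mxKl.
- move=> i j Bi Bj e _; have [l jl|l jl] := fintype.splitP j; last by rewrite jl in Bj.
  have -> : j = lshift (p + q) l by exact: val_inj.
  by rewrite phil derive_coord0//; apply: contraTneq Bi => ->.
- move=> j; have [l jl|l jl] := fintype.splitP j.
    have -> : j = lshift (p + q) l by exact: val_inj.
    by rewrite phil; exact: tempered_coord.
  have -> : j = rshift 1 l by exact: val_inj.
  rewrite (_ : (fun e => _) = (fun e => trans_point e 0 l)); first exact: tempered_trans_point.
  by apply/funext => e; rewrite row_mxEr.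
Qed.

Let KW : set 'rV[R]_(1 + N) := [set y | time y = eta /\ K (lsubmx (rsubmx y))].
Let BW : pred 'I_(1 + N) := fun i => (0 < i)%N.

Lemma tempered_new_base k l : tempered k jet_dom KW BW
  (fun y => Xi (time y) (lsubmx (rsubmx y)) 0 l).
Proof.
have h y : (fun y : 'rV[R]_(1 + p) => Xi (time y) (rsubmx y) 0 l) (base_of_jet y) =
    Xi (time y) (lsubmx (rsubmx y)) 0 l by rewrite time_with_time rsubmx_with_time.
apply: tempered_eq (fun y _ => h y) _; first exact: open_jet_dom.
apply: (@tempered_select _ _ _ _ _ _ timed_base_dom
  [set y | time y = eta /\ K (rsubmx y)] _ predT
  (fun y : 'rV[R]_(1 + p) => Xi (time y) (rsubmx y) 0 l) base_coord base_of_jet) => //.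
- exact: open_jet_dom.
- exact: open_timed_base_dom.
- exact: base_of_jetE.
- by move=> y; rewrite jet_domE.
- by move=> y _; rewrite /= time_with_time rsubmx_with_time.
- exact: Xi_tempered_at.
Qed.

Definition trans_jet_point (y : 'rV[R]_(1 + N)) : 'rV[R]_((1 + N) + p) :=
  row_mx y (Xi (time y) (lsubmx (rsubmx y))).

Definition trans_component (c : jet_var p q n) (y : 'rV[R]_(1 + N)) : R :=
  iter_pd (map (@rshift (1 + N) p) (canonical_seq (var_order c)))
    (trans_taylor (var_dep c)) (trans_jet_point y).

(** The n-th prolongation of the action, as an explicit function of (eta,
    z). *)
Definition prolongation (y : 'rV[R]_(1 + N)) : 'rV[R]_N :=
  row_mx (Xi (time y) (lsubmx (rsubmx y))) (\row_c trans_component (enum_val c) y).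

(** At eta, the independent variables stay in the compact set K and their
    images in Xi eta (K); the derivative in eta is the only one left without
    bounds. *)
Lemma tempered_prolongation k j : tempered k jet_dom KW BW (fun y => prolongation y 0 j).
Proof.
have oW := open_jet_dom.
have [l jl|l jl] := fintype.splitP j.
  have -> : j = lshift V l by exact: val_inj.
  rewrite (_ : (fun y => _) = (fun y => Xi (time y) (lsubmx (rsubmx y)) 0 l)).
    exact: tempered_new_base.
  by apply/funext => y; rewrite row_mxEl.
have -> : j = rshift p l by exact: val_inj.
rewrite (_ : (fun y => _) = trans_component (enum_val l)); last first.
  by apply/funext => y; rewrite row_mxEr mxE.
have sB : all BE (map (@rshift (1 + N) p) (canonical_seq (var_order (enum_val l)))).
  by apply/allP => _ /mapP[i _ ->].
have fT := tempered_iterated (tempered_trans_taylor^~ (var_dep (enum_val l))) sB k.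
have jpl y i : trans_jet_point y 0 (lshift p i) = y 0 i by rewrite row_mxEl.
apply: (@tempered_comp _ k _ _ jet_dom KW trans_dom KE BW BE _ trans_jet_point) => //.
- exact: open_trans_dom.
- move=> y Wy; rewrite /trans_dom/= /trans_param row_mxKl row_mxKr.
  by have [] := Xi_inv Wy.
- move=> y Wy [ty Ky]; rewrite /KE/= /trans_preim /trans_param row_mxKl row_mxKr; split=> //.
  by have [_ ->] := Xi_inv Wy.
- move=> i j' Bi Bj y _; have [m jm|m jm] := fintype.splitP j'; last by rewrite /BE jm in Bj.
  have -> : j' = lshift p m by exact: val_inj.
  rewrite (funext (fun y => jpl y m)) derive_coord0//.
  by apply: contraTneq Bi => ->; rewrite /BE jm in Bj.
- move=> j'; have [m jm|m jm] := fintype.splitP j'.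
    have -> : j' = lshift p m by exact: val_inj.
    by rewrite (funext (fun y => jpl y m)); exact: tempered_coord.
  have -> : j' = rshift (1 + N) m by exact: val_inj.
  rewrite (_ : (fun y => _) = (fun y => Xi (time y) (lsubmx (rsubmx y)) 0 m)).
    exact: tempered_new_base.
  by apply/funext => y; rewrite row_mxEr.
Qed.

End AtTime.

End Prolongation.

Section TransformedJets.
Variables (R : realType) (p q n : nat).
Local Notation e_ i := (coord_vec R i).
Local Notation iter_pd s f := (iterated_derive [seq e_ i | i <- s] f).
Local Notation V := #|jet_var p q n|.
Local Notation N := (p + V)%N.
Variables (M : set 'rV[R]_(p + q)) (eta0 : R) (dom : set (R * 'rV[R]_(p + q))).
Variables (Xi : R -> 'rV[R]_p -> 'rV[R]_p) (Phi : R -> 'rV[R]_(p + q) -> 'rV[R]_q).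
Hypothesis G : local_transformation_group M eta0 dom (projectable_action Xi Phi).
Hypothesis G_slow : slowly_increasing_group eta0 dom Xi Phi.
Local Notation base_dom := (@base_dom R p q dom).
Local Notation prolongation := (@prolongation R p q n Xi Phi).

Lemma smooth_on_coord a b (D : set 'rV[R]_a) (u : 'rV[R]_a -> 'rV[R]_b) j k :
  open D -> smooth_on D u -> tempered k D set0 xpred0 (fun y => u y 0 j).
Proof.
by move=> oD us; apply: smooth_on_tempered; exact: (iffLR (smooth_on_entries _ oD) us 0 j).
Qed.

(** Near Xi eta x the transform of u is the composite of Phi eta with the graph
    of u over Xi (- eta), and the same holds for the transform of the Taylor
    polynomial of the jet of u. The jets of u and of its Taylor polynomial
    agree, hence those of the composites. *)
Lemma pr_act_fun eta (Omega : set 'rV[R]_p) u x :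
  open Omega -> smooth_on Omega u -> graph_in (dom_at dom eta) Omega u -> Omega x ->
  row_mx (Xi eta x) (pr n (act_fun Xi Phi eta Omega u) (Xi eta x)) =
  prolongation (with_time eta (row_mx x (pr n u x))).
Proof.
move=> oO us gu Ox; set v := pr n u x; set y := with_time eta _.
have yE : rsubmx y = row_mx x v by rewrite rsubmx_with_time.
have ty : time y = eta by rewrite time_with_time.
have bO x' : Omega x' -> base_dom eta x'.
  by move=> /gu dx'; have := iffLR (base_domP G G_slow eta _) dx'; rewrite row_mxKl.
have bx := bO _ Ox; have [bXx XXx] := Xi_inv G G_slow bx.
rewrite /prolongation ty yE row_mxKl; congr row_mx; apply/rowP => c; rewrite !mxE.
set alpha := var_dep _; set J := var_order _.
rewrite multi_deriveE /trans_component -/alpha -/J /trans_jet_point ty yE row_mxKl.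
rewrite -(iter_pd_row_mx (trans_taylor Xi Phi alpha) y).
(* A neighbourhood of Xi eta x on which both transforms are given by the
   inverse Xi (- eta). *)
set D1 := base_dom (- eta) `&` (Xi (- eta)) @^-1` Omega.
have oD1 : open D1.
  apply: open_preimage_on => //; first exact: (open_base_dom G).
  by move=> z; exact: (Xi_continuous G).
have D1x : D1 (Xi eta x) by split => //=; rewrite XXx.
have sJ : (size (canonical_seq J) <= n)%N.
  rewrite size_canonical_seq /J /var_order; case: (enum_val c) => [k [a' J']] /=.
  by rewrite (eqP (valP J')) -ltnS.
apply: (iffLR (same_jetP n _ _ _)) sJ.
pose T := taylor_map x v.
pose f w := Phi eta w 0 alpha.
pose phi w := row_mx (Xi (- eta) w) (u (Xi (- eta) w)).
pose psi w := row_mx (Xi (- eta) w) (T (Xi (- eta) w)).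
have injO : {in Omega &, injective (Xi eta)}.
  move=> x1 x2; rewrite !inE => /bO b1 /bO b2 x12.
  by have [_ <-] := Xi_inv G G_slow b1; have [_ <-] := Xi_inv G G_slow b2; rewrite x12.
have E1 w : D1 w -> act_fun Xi Phi eta Omega u w 0 alpha = (f \o phi) w.
  move=> [bw Ow]; rewrite /act_fun /= /f /phi.
  suff -> : pinv Omega (Xi eta) w = Xi (- eta) w by [].
  have [_] := Xi_inv G G_slow bw; rewrite opprK => wE.
  by rewrite -{1}wE pinvKV// inE.
have E2 w : D1 w -> trans_taylor Xi Phi alpha (row_mx y w) = (f \o psi) w.
  move=> _; rewrite /trans_taylor /trans_preim /trans_param /trans_jet row_mxKl row_mxKr ty yE.
  by rewrite row_mxKl row_mxKr.
apply: same_jet_trans (same_jet_eq _ oD1 D1x E1) _.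
apply: same_jet_trans _ (same_jet_sym (same_jet_eq _ oD1 D1x E2)).
have XT l k : tempered k D1 set0 xpred0 (fun w => Xi (- eta) w 0 l).
  by apply: tempered_sub (Xi_at_tempered G (- eta) k xpred0 l) => // w [].
have uT l k : tempered k Omega set0 xpred0 (fun w => u w 0 l) by exact: smooth_on_coord.
have TT l k : tempered k Omega set0 xpred0 (fun w => T w 0 l).
  rewrite (_ : (fun w => _) = taylor x v l); last by apply/funext => w; rewrite mxE.
  apply: tempered_sum => // c' _; apply: temperedM => //; first exact: tempered_cst.
  exact: tempered_monomial.
have compT (h : 'rV[R]_p -> 'rV[R]_q) l k :
    (forall l k, tempered k Omega set0 xpred0 (fun w => h w 0 l)) ->
    tempered k D1 set0 xpred0 (fun w => h (Xi (- eta) w) 0 l).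
  move=> hT; apply: (@tempered_comp _ k _ _ D1 set0 Omega set0 xpred0 xpred0
    (fun w => h w 0 l) (Xi (- eta))) => //.
  by move=> w [].
have rowT (h : 'rV[R]_p -> 'rV[R]_q) j k :
    (forall l k, tempered k Omega set0 xpred0 (fun w => h w 0 l)) ->
    tempered k D1 set0 xpred0 (fun w => row_mx (Xi (- eta) w) (h (Xi (- eta) w)) 0 j).
  move=> hT; have [l jl|l jl] := fintype.splitP j.
    have -> : j = lshift q l by exact: val_inj.
    rewrite (_ : (fun w => _) = (fun w => Xi (- eta) w 0 l)) //.
    by apply/funext => w; rewrite row_mxEl.
  have -> : j = rshift p l by exact: val_inj.
  rewrite (_ : (fun w => _) = (fun w => h (Xi (- eta) w) 0 l)); first exact: compT.
  by apply/funext => w; rewrite row_mxEr.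
have rowD (h : 'rV[R]_p -> 'rV[R]_q) w : D1 w ->
    dom_at dom eta (row_mx (Xi (- eta) w) (h (Xi (- eta) w))).
  by move=> [_ Ow]; apply/(base_domP G G_slow); rewrite row_mxKl; exact: bO.
have jet_u l : same_jet n x (fun w => u w 0 l) (fun w => T w 0 l).
  apply: (pr_same_jet oO Ox); [exact: uT|exact: TT|].
  by rewrite pr_taylor.
apply: (same_jet_comp (D2 := dom_at dom eta) oD1) => //.
- exact: (open_dom_at G).
- exact: rowD.
- exact: rowD.
- by move=> j k; exact: rowT.
- by move=> j k; exact: rowT.
- by move=> k; exact: (Phi_at_tempered G G_slow).
- by move=> k; exact: (Phi_at_tempered G G_slow).
- rewrite /phi /psi XXx; congr row_mx; apply/rowP => l.
  by have := iffLR (same_jetP n _ _ _) (jet_u l) [::] isT.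
- move=> j; have [l jl|l jl] := fintype.splitP j.
    have -> : j = lshift q l by exact: val_inj.
    by apply: (same_jet_eq _ oD1) => // w _; rewrite !row_mxEl.
  have -> : j = rshift p l by exact: val_inj.
  rewrite (_ : (fun w => phi w 0 _) = (fun w => u w 0 l) \o Xi (- eta)); last first.
    by apply/funext => w; rewrite row_mxEr.
  rewrite (_ : (fun w => psi w 0 _) = (fun w => T w 0 l) \o Xi (- eta)); last first.
    by apply/funext => w; rewrite row_mxEr.
  have XD w : D1 w -> Omega (Xi (- eta) w) by case.
  apply: (same_jet_comp oD1 oO D1x XD XD XT XT (uT l) (TT l)) => //.
  + by move=> l'; exact: same_jet_refl.
  + by rewrite XXx.
- exact: same_jet_refl.
Qed.

Lemma prolongs_prolongation eta z w : prolongs dom Xi Phi eta z w ->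
  base_dom eta (lsubmx z) /\ w = prolongation (with_time eta z).
Proof.
case=> Omega [u [[oO Ox] us gu uz ->]]; split.
  by have := iffLR (base_domP G G_slow eta _) (gu _ Ox); rewrite row_mxKl.
by rewrite pr_act_fun// uz hsubmxK.
Qed.

(** The Taylor polynomial of the jet is a representative on the whole domain of
    the independent variables, as the fibres are full. *)
Lemma taylor_prolongs eta (z : 'rV[R]_N) : base_dom eta (lsubmx z) ->
  exists w, prolongs dom Xi Phi eta z w.
Proof.
move=> bz; pose u := taylor_map (lsubmx z) (rsubmx z).
have uT k j : tempered k setT set0 xpred0 (fun y => u y 0 j).
  rewrite (_ : (fun w => _) = taylor (lsubmx z) (rsubmx z) j); last first.
    by apply/funext => w; rewrite mxE.
  apply: tempered_sum => [|c _]; first exact: openT.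
  apply: temperedM; [exact: openT|exact/tempered_cst/openT|exact/tempered_monomial/openT].
have us (Omega : set 'rV[R]_p) : open Omega -> smooth_on Omega u.
  move=> oO; apply/(smooth_on_entries _ oO) => i j; rewrite (ord1 i).
  apply: (tempered_smooth_on (B := xpred0)) => // k.
  exact: tempered_sub (uT k j).
eexists; exists (base_dom eta), u; split => //.
- by split => //; exact: (open_base_dom G).
- exact/us/(open_base_dom G).
- by move=> x bx; apply/(base_domP G G_slow); rewrite row_mxKl.
- exact: pr_taylor.
Qed.

Lemma pr_domE : pr_dom (n := n) dom Xi Phi = [set t | base_dom t.1 (lsubmx t.2)].
Proof.
apply/seteqP; split => -[eta z] /=; first by move=> [w /prolongs_prolongation[]].
exact: taylor_prolongs.
Qed.

Lemma pr_actionE eta (z : 'rV[R]_N) : base_dom eta (lsubmx z) ->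
  pr_action dom Xi Phi eta z = prolongation (with_time eta z).
Proof.
move=> /taylor_prolongs ex.
have H : prolongs dom Xi Phi eta z (pr_action dom Xi Phi eta z) := xgetPex z ex.
by have [_ ->] := prolongs_prolongation H.
Qed.

(** Local solvability provides a solution through the jet z; it is restricted
    to the points where g_eta acts, and its transform is a solution. *)
Lemma prolongation_zero s (Delta : 'rV[R]_N -> 'cV[R]_s) eta z :
  symmetry_group M Delta eta0 dom Xi Phi -> locally_solvable M Delta ->
  base_dom eta (lsubmx z) -> jet_space M z -> Delta z = 0 ->
  Delta (prolongation (with_time eta z)) = 0.
Proof.
case=> _ sym solv bz Mz Dz.
case: (solv _ Mz Dz) => Omega [u [[oO us gu uD] Ox uz]].
pose O' := Omega `&` base_dom eta.
have oO' : open O' by apply: openI => //; exact: (open_base_dom G).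
have gu' : graph_in (dom_at dom eta) O' u.
  by move=> x [_ bx]; apply/(base_domP G G_slow); rewrite row_mxKl.
have us' : smooth_on O' u by move=> l x [Ol _]; exact: us.
have sol : is_solution M Delta O' u.
  by split => // x [Ol _]; [exact: gu|exact: uD].
have eta_lt : `|eta| < eta0 by have [] := ltg_dom G bz.
have [_ _ _ H] := sym _ _ _ eta_lt sol gu'.
have O'x : O' (lsubmx z) by [].
have := H _ (imageP _ O'x); rewrite (pr_act_fun oO' us' gu' O'x) uz hsubmxK.
exact.
Qed.

End TransformedJets.

(** * The factor of the transformed system *)

Section JetSpace.
Variables (R : realType) (p q n : nat) (M : set 'rV[R]_(p + q)).
Local Notation e_ i := (coord_vec R i).
Local Notation V := #|jet_var p q n|.
Local Notation N := (p + V)%N.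
Local Notation D := (jet_space (n := n) M).

Lemma open_jet_space : open M -> open D.
Proof.
move=> oM; apply: (@open_comp _ _ (@base_point R p q n) M) oM => z _.
apply: continuous_mx => i j; rewrite (ord1 i); have [l jl|l jl] := fintype.splitP j.
  have -> : j = lshift q l by exact: val_inj.
  apply: continuous_ext (@coord_continuous _ _ _ 0 (lshift V l) z) => z'.
  by rewrite row_mxEl mxE.
have -> : j = rshift p l by exact: val_inj.
apply: continuous_ext (@coord_continuous _ _ _ 0
  (rshift p (enum_rank (undiff_var p n l))) z) => z'.
by rewrite row_mxEr !mxE.
Qed.

Hypothesis fibD : forall (x : 'rV[R]_p) (u v : 'rV[R]_V), D (row_mx x u) -> D (row_mx x v).

(** Full fibres make membership in the jet space depend on the independent
    variables only. *)
Lemma jet_space_base (z : 'rV[R]_N) w : M w -> lsubmx z = lsubmx w -> D z.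
Proof.
move=> Mw zw; pose v : 'rV[R]_V := \row_c rsubmx w 0 (var_dep (enum_val c)).
have H : D (row_mx (lsubmx w) v).
  rewrite /jet_space/= /base_point row_mxKl row_mxKr (_ : \row_a _ = rsubmx w) ?hsubmxK//.
  by apply/rowP => a; rewrite !mxE enum_rankK.
by rewrite -(hsubmxK z) zw; exact: fibD H.
Qed.

Lemma open_jet_base : open M -> open (lsubmx @` D).
Proof.
move=> /open_jet_space oD.
have -> : lsubmx @` D = (fun x : 'rV[R]_p => row_mx x (0 : 'rV[R]_V)) @^-1` D.
  apply/seteqP; split => [_ [z Dz <-]|x Dx]; last by exists (row_mx x 0); rewrite ?row_mxKl.
  by apply: (fibD (u := rsubmx z)); rewrite hsubmxK.
apply: (@open_comp _ _ (fun x : 'rV[R]_p => row_mx x (0 : 'rV[R]_V)) D) oD => x _.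
apply: continuous_mx => i j; rewrite (ord1 i); have [l jl|l jl] := fintype.splitP j.
  have -> : j = lshift V l by exact: val_inj.
  apply: continuous_ext (@coord_continuous _ _ _ 0 l x) => y; by rewrite row_mxEl.
have -> : j = rshift p l by exact: val_inj.
by apply: continuous_ext (@cst_continuous _ _ (0 : R) x) => y; rewrite row_mxEr mxE.
Qed.

End JetSpace.

Section SlowIncrease.
Variable R : realType.
Local Notation e_ i := (coord_vec R i).

Lemma tempered_slowly_increasing p m r c (D : set 'rV[R]_(p + m))
    (F : 'rV[R]_(p + m) -> 'M[R]_(r, c)) : open D ->
  (forall x v w, D (row_mx x v) -> D (row_mx x w)) ->
  (forall (K : set 'rV[R]_p), compact K -> K `<=` lsubmx @` D ->
    forall i j k, tempered k D (tube K) predT (fun z => F z i j)) ->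
  slowly_increasing D F.
Proof.
move=> oD fib FT.
have Fsij i j : smooth_on D (fun z => F z i j).
  apply: (tempered_smooth_on (B := predT)) => // k.
  by apply: tempered_set0 (FT set0 compact0 _ i j k) => x.
have Fs : smooth_on D F by apply/(smooth_on_entries _ oD).
apply: growth_slowly_increasing => // K J cK KD.
have G i j : growth D (tube K) (fun z => `|multi_derive J F z i j|).
  have sB : all predT (canonical_seq J) by apply/allP.
  have := tempered_growth (tempered_iterated (FT K cK KD i j) sB 0%N).
  apply: growth_le => // z Dz _; rewrite normr_id -multi_deriveE.
  by rewrite /multi_derive (smooth_on_entry _ _ _ oD Fs Dz).
have := @growth_sum _ _ D (tube K) _ xpredT _ (fun i _ =>
  @growth_sum _ _ D (tube K) _ xpredT _ (fun j _ => G i j)).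
apply: growth_le => // z _ _; rewrite normr_id ger0_norm; last first.
  by rewrite sumr_ge0 // => i _; rewrite sumr_ge0.
apply: mx_norm_le => [|i j]; first by rewrite sumr_ge0 // => i _; rewrite sumr_ge0.
rewrite (bigD1 i)//= (bigD1 j)//= -addrA lerDl addr_ge0//.
  by rewrite sumr_ge0.
by rewrite sumr_ge0 // => i' _; rewrite sumr_ge0.
Qed.

(** Restriction to a fixed group parameter removes the direction without
    bounds. *)
Lemma tempered_with_time m k (D K : set 'rV[R]_(1 + m)) (Dt Kt : set 'rV[R]_m) t f :
  open D -> open Dt -> (forall w, Dt w -> D (with_time t w)) ->
  (forall w, Kt w -> K (with_time t w)) ->
  tempered k D K (fun i => (0 < i)%N) f ->
  tempered k Dt Kt predT (fun w => f (with_time t w)).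
Proof.
move=> oD oDt DD KK fT.
have wl i : (fun w : 'rV[R]_m => with_time t w 0 (lshift m i)) = fun=> t.
  by apply/funext => w; rewrite row_mxEl mxE.
apply: (@tempered_comp _ k _ _ Dt Kt D K predT _ f (with_time t) oDt oD DD _ _ _ fT).
- by move=> x _; exact: KK.
- move=> i j _ Bj x _; have [l jl|l jl] := fintype.splitP j; last by rewrite jl in Bj.
  have -> : j = lshift m l by exact: val_inj.
  by rewrite wl derive_cst.
- move=> j; have [l jl|l jl] := fintype.splitP j.
    have -> : j = lshift m l by exact: val_inj.
    by rewrite wl; exact: tempered_cst.
  have -> : j = rshift 1 l by exact: val_inj.
  rewrite (_ : (fun w => _) = (fun w : 'rV[R]_m => w 0 l)); first exact: tempered_coord.
  by apply/funext => w; rewrite row_mxEr.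
Qed.

Lemma pair_with_time_continuous m :
  continuous (fun t : R * 'rV[R]_m => with_time t.1 t.2).
Proof.
move=> t; apply: continuous_mx => i j; rewrite (ord1 i); have [l jl|l jl] := fintype.splitP j.
  have -> : j = lshift m l by exact: val_inj.
  apply: continuous_ext (_ : {for t, continuous fst}) => [t'|]; first by rewrite row_mxEl mxE.
  exact: cvg_fst.
have -> : j = rshift 1 l by exact: val_inj.
apply: continuous_ext (_ : {for t, continuous ((fun w : 'rV[R]_m => w 0 l) \o snd)}) => [t'|].
  by rewrite row_mxEr.
apply: continuous_comp; first exact: cvg_snd.
exact: coord_continuous.
Qed.

End SlowIncrease.

Theorem theorem2p1 (R : realType) (p q n s : nat)
  (M : set 'rV[R]_(p + q))
  (Delta : 'rV[R]_(jet_dim p q n) -> 'cV[R]_s)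
  (M_open : open M)
  (Delta_smooth : smooth_on (jet_space M) Delta)
  (Delta_nondegenerate : nondegenerate_system M Delta)
  (Delta_slow : slowly_increasing (jet_space M) Delta)
  (eta0 : R) (dom : set (R * 'rV[R]_(p + q)))
  (Xi : R -> 'rV[R]_p -> 'rV[R]_p) (Phi : R -> 'rV[R]_(p + q) -> 'rV[R]_q)
  (G_symmetry : symmetry_group M Delta eta0 dom Xi Phi)
  (G_slow : slowly_increasing_group eta0 dom Xi Phi)
  (k : 'I_s -> 'I_(jet_dim p q n))
  (k_dependent : forall j, (p <= k j)%N)
  (k_increasing : forall i j : 'I_s, (i < j)%N -> (k i < k j)%N)
  (Delta_injective : forall z w, jet_space M z -> jet_space M w ->
     (omit_coords k z, Delta z) = (omit_coords k w, Delta w) -> z = w)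
  (minor_neq0 : forall z, jet_space M z -> \det (Jacobian_minor k Delta z) != 0)
  (minor_slow : slowly_increasing (jet_space M)
     (fun z => (\det (Jacobian_minor k Delta z))^-1)) :
  let W := pr_dom (n := n) dom Xi Phi in
  exists Q : R -> 'rV[R]_(jet_dim p q n) -> 'M[R]_s,
    [/\ smooth_on W (fun t : R * 'rV[R]_(jet_dim p q n) => Q t.1 t.2),
        forall eta, slowly_increasing [set z | W (eta, z)] (Q eta),
        forall eta z, W (eta, z) ->
          Delta (pr_action dom Xi Phi eta z) = Q eta z *m Delta z
      & forall eta (Omega : set 'rV[R]_p) (u : 'rV[R]_p -> 'rV[R]_q),
          open Omega -> smooth_on Omega u ->
          graph_in (dom_at dom eta) Omega u ->
          forall x, Omega x ->
            Delta (row_mx (Xi eta x)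
                     (pr n (act_fun Xi Phi eta Omega u) (Xi eta x))) =
            Q eta (row_mx x (pr n u x)) *m Delta (row_mx x (pr n u x))].
Proof.
have [G sym] := G_symmetry; have solv := Delta_nondegenerate.1.
pose D := jet_space (n := n) M.
have fibD (x : 'rV[R]_p) (v w : 'rV[R]_#|jet_var p q n|) : D (row_mx x v) -> D (row_mx x w).
  by have [fib _ _] := Delta_slow; exact: fib.
have oD : open D := open_jet_space M_open.
have oX : open (lsubmx @` D) := open_jet_base fibD M_open.
have k_inj : injective k.
  move=> i j kij; have [/k_increasing|/k_increasing|/val_inj//] := ltngtP i j.
    by rewrite kij ltnn.
  by rewrite kij ltnn.
have DeltaT (K : set 'rV[R]_p) : compact K -> K `<=` lsubmx @` D ->
    forall m i, tempered m D (tube K) predT (fun z => Delta z i 0).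
  by move=> cK KD m i; exact: (slowly_increasing_tempered i 0 oD Delta_slow cK KD).
have Delta_inj z w : D z -> D w -> same_fibre k z w -> Delta z = Delta w -> z = w.
  move=> Dz Dw zw zwD; apply: Delta_injective => //; rewrite zwD; congr (_, _).
  apply/rowP => j; rewrite !mxE zw//.
  by have := enum_valP j; rewrite inE.
have detV (K : set 'rV[R]_p) : compact K -> K `<=` lsubmx @` D ->
    growth D (tube K) (fun z => (\det (Jacobian_minor k Delta z))^-1).
  move=> cK KD; have [_ ds _] := minor_slow.
  (* The multi-index zero: the empty sequence of derivatives leaves the
     function unchanged. *)
  have := slowly_increasing_growth (fun i => count_mem i [::]) minor_slow cK KD.
  apply: growth_le => // z Dz _; rewrite normr_id.
  by rewrite -(iterated_derive_count [::] oD (smooth_on_tempered xpred0 ds) Dz).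
have [H [HT HG]] := inverse_majorant oD oX fibD DeltaT minor_neq0 detV.
(* The domain of g_eta lies in M, and the fibres of the jet space are full. *)
have domD eta x : base_dom (q := q) dom eta x -> forall z, lsubmx z = x -> D z.
  move=> bx z zx; have [_ Mx] := ltg_dom G bx.
  by apply: (jet_space_base fibD Mx); rewrite row_mxKl.
pose W' := jet_dom (q := q) (n := n) dom.
have oW' : open W' := open_jet_dom (n := n) G.
have WD e : W' e -> D (rsubmx e) by move=> /domD; apply.
have time_lsub (e : 'rV[R]_(1 + jet_dim p q n)) : time e = lsubmx e 0 ord0 by rewrite mxE.
have Wfib e e' : lsubmx e' = lsubmx e -> lsubmx (rsubmx e') = lsubmx (rsubmx e) -> W' e -> W' e'.
  by move=> h1 h2; rewrite /W' /jet_dom /= !time_lsub h1 h2.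
pose pro := prolongation (n := n) Xi Phi.
pose F i y := Delta (pro y) i 0.
pose KW eta K := [set y : 'rV[R]_(1 + jet_dim p q n) | time y = eta /\ K (lsubmx (rsubmx y))].
have baseX eta : base_dom (q := q) dom eta `<=` lsubmx @` D.
  move=> x bx; exists (row_mx x 0); last by rewrite row_mxKl.
  by apply: (domD _ _ bx); rewrite row_mxKl.
have FT eta K : `|eta| < eta0 -> compact K -> K `<=` base_dom (q := q) dom eta ->
    forall i m, tempered m W' (KW eta K) (fun i => (0 < i)%N) (F i).
  move=> eta_lt cK KD i m; have [cK' K'D _] := Xi_image G G_slow cK KD.
  have K'X : Xi eta @` K `<=` lsubmx @` D by move=> x /K'D; exact: baseX.
  apply: (@tempered_comp _ m _ _ W' (KW eta K) D (tube (Xi eta @` K)) _ predT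
    (fun z => Delta z i 0) pro) => //.
  - move=> y Wy; have [bXy _] := Xi_inv G G_slow Wy.
    by apply: (domD _ _ bXy); rewrite row_mxKl.
  - move=> y _ [ty Ky]; rewrite /tube/= /pro /prolongation row_mxKl ty.
    by exists (lsubmx (rsubmx y)).
  - by move=> j; exact: (tempered_prolongation G G_slow eta_lt cK KD).
  - exact: DeltaT.
have F0 i e : W' e -> Delta (rsubmx e) = 0 -> F i e = 0.
  move=> We De; rewrite /F -(with_timeK e).
  by rewrite (prolongation_zero G G_slow G_symmetry solv We (WD _ We) De) mxE.
(* Smoothness alone follows from the bounds over the empty set, at any
   admissible parameter, such as 0. *)
have eta0_gt : `|0 : R| < eta0 by rewrite normr0; exact: (ltg_param G).
have FT0 i m : tempered m W' set0 (fun i => (0 < i)%N) (F i).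
  by apply: tempered_set0 (FT 0 set0 eta0_gt compact0 _ i m).
pose quot i j := quotient Delta k D H (F i) j.
have quotT eta K : `|eta| < eta0 -> compact K -> K `<=` base_dom (q := q) dom eta ->
    forall i j m, tempered m W' (KW eta K) (fun i => (0 < i)%N) (quot i j).
  move=> eta_lt cK KD i j m.
  apply: (tempered_quotient oD fibD k_inj k_dependent DeltaT Delta_inj minor_neq0 detV HT HG
    oW' WD Wfib j cK) => //.
  - by move=> x /KD; exact: baseX.
  - by move=> e [].
  - by move=> e e' h1 h2; rewrite /KW /= !time_lsub h1 h2.
  - exact: FT.
have quot_eq i e : W' e -> \sum_j quot i j e * Delta (rsubmx e) j 0 = F i e.
  exact: (quotient_eq oD fibD k_inj k_dependent DeltaT Delta_inj minor_neq0 detV HT HG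
    oW' WD Wfib (FT0 i) (F0 i)).
pose Q eta z : 'M[R]_s := \matrix_(i, j) quot i j (with_time eta z).
have W'E eta z : W' (with_time eta z) <-> base_dom (q := q) dom eta (lsubmx z).
  by rewrite /W' /jet_dom /= time_with_time rsubmx_with_time.
have Q_eq eta z : base_dom (q := q) dom eta (lsubmx z) ->
    Delta (pro (with_time eta z)) = Q eta z *m Delta z.
  move=> /W'E We; apply/colP => i; rewrite mxE -[LHS](quot_eq i _ We).
  by apply: eq_bigr => j _; rewrite mxE rsubmx_with_time.
have Q_smooth : smooth_on (pr_dom (n := n) dom Xi Phi)
    (fun t : R * 'rV[R]_(jet_dim p q n) => Q t.1 t.2).
  have quots : smooth_on W' (fun y => \matrix_(i < s, j < s) quot i j y).
    apply/(smooth_on_entries _ oW') => i j.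
    rewrite (_ : (fun y => _) = quot i j); last by apply/funext => y; rewrite mxE.
    apply: (tempered_smooth_on (B := fun i => (0 < i)%N)) => // m.
    exact: tempered_set0 (quotT 0 set0 eta0_gt compact0 _ i j m).
  pose wt (t : R * 'rV[R]_(jet_dim p q n)) := with_time t.1 t.2.
  have hL (c : R) t t' : wt (c *: t + t') = c *: wt t + wt t'.
    rewrite /wt /with_time scale_row_mx add_row_mx; congr row_mx.
    by apply/matrixP => i j; rewrite !mxE.
  have := smooth_on_comp_affine hL (@pair_with_time_continuous R _) quots.
  rewrite (pr_domE n G G_slow); congr (smooth_on _ _).
  by apply/seteqP; split => t /= /W'E.
exists Q; split => //.
- move=> eta; rewrite (pr_domE n G G_slow).
  have Wt : [set z | [set t : R * 'rV[R]_(jet_dim p q n) |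
      base_dom (q := q) dom t.1 (lsubmx t.2)] (eta, z)] = with_time eta @^-1` W'.
    by apply/seteqP; split => z /= /W'E.
  rewrite Wt; have oWt : open (with_time eta @^-1` W').
    apply: (@open_comp _ _ (fun z => with_time eta z) W') oW' => z _.
    exact: row_mx_continuous.
  apply: tempered_slowly_increasing => // [x v w /W'E|K cK KX i j m].
    by rewrite row_mxKl => bx; apply/W'E; rewrite row_mxKl.
  rewrite (_ : (fun z => _) = (fun z => quot i j (with_time eta z))); last first.
    by apply/funext => z; rewrite mxE.
  have KD : K `<=` base_dom (q := q) dom eta.
    by move=> x /KX[z /W'E bz <-].
  (* Beyond eta0 no jet can be prolonged, and there is nothing to prove. *)
  have [eta_lt|eta_ge] := ltP `|eta| eta0.
    apply: (tempered_with_time (D := W') (K := KW eta K)) => //.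
      by move=> w Kw; rewrite /KW/= time_with_time rsubmx_with_time.
    exact: quotT.
  apply: tempered_sub (_ : tempered m set0 set0 predT _).
  + move=> z /W'E bz; have [] := ltg_dom G bz; by rewrite ltNge eta_ge.
  + by move=> z /W'E bz; have [] := ltg_dom G bz; rewrite ltNge eta_ge.
  + by apply: tempered_local => x [].
- move=> eta z; rewrite (pr_domE n G G_slow) => bz.
  by rewrite (pr_actionE G G_slow)// Q_eq.
- move=> eta Omega u oO us gu x Ox; rewrite (pr_act_fun n G G_slow oO us gu Ox) -/pro Q_eq//.
  by have := iffLR (base_domP G G_slow eta _) (gu _ Ox); rewrite !row_mxKl.
Qed.
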